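(* Let $S$ be a hyperbolic surface with cusps. Then $S$ is packable by congruent horocycles with packing density $\frac{3}{\pi}$ if and only if, up to an appropriate conjugation in $\mathrm{PSL}_2(\mathbb{R})$, $S=\mathbb{H}^2/\Gamma$ for some $\Gamma<\mathrm{PSL}_2(\mathbb{Z})$.
   Context: A hyperbolic surface with cusps is a connected, complete, orientable, non-compact hyperbolic surface (constant curvature $-1$, no boundary) of finite area with $k\geq 1$ cusps; equivalently $S=\mathbb{H}^2/\Gamma$ for a torsion-free discrete co-finite (i.e. with finite-area fundamental domain) non-co-compact subgroup $\Gamma<\mathrm{PSL}_2(\mathbb{R})$. A horocycle packing of $S$ consists of horocycles centred at the cusps of $S$, one at each cusp, bounding embedded horoball (cusp) neighbourhoods with pairwise non-intersecting interiors. Its packing density is the total area of the cusp neighbourhoods bounded by the horocycles divided by the area of $S$. ''Congruent'' means that the horocycles, lifted to $\mathbb{H}^2$, are isometric to each other; this holds for any two horocycles of $\mathbb{H}^2$, and the cusp neighbourhoods in $S$ are not required to have equal areas. Let $\overline{S}$ be the completion of $S$ obtained by filling each cusp with a point; call the added points $c_1,\dots,c_k$. The packing graph $T$ has vertex set $\{c_1,\dots,c_k\}$, and vertices are connected by an edge whenever the corresponding horocycles are tangent: for each tangency point there is an edge, namely the geodesic of $S$ running between the two cusps through that point (loops, arising from self-tangency of a horocycle, and multiple edges are allowed). $S$ is packable by the horocycles if $T$ triangulates $\overline{S}$, i.e. $\overline{S}\setminus T$ is a collection of topological triangles. *)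

(* Defs.v *)
From HB Require Import structures.
From mathcomp Require Import all_boot all_order all_algebra.
From mathcomp Require Import all_classical all_reals all_analysis.
From mathcomp Require Import ring lra.
Set Implicit Arguments.
Unset Strict Implicit.
Unset Printing Implicit Defensive.
Import Order.TTheory GRing.Theory Num.Theory.
Import numFieldNormedType.Exports.
Local Open Scope classical_set_scope.
Local Open Scope quotient_scope.
Local Open Scope ring_scope.

(** A subgroup of PSL_2(R) is represented by its full preimage in SL_2(R), i.e.
    a subgroup of SL_2(R) containing -1; two matrices g and -g are the same
    element of PSL_2(R). *)
Record psl2_subgroup (R : realType) := Psl2Subgroup {
  psl2_carrier :> 'M[R]_2 -> Prop;
  psl2_det : forall g, psl2_carrier g -> \det g = 1;
  psl2_1 : psl2_carrier 1;
  psl2_opp : forall g, psl2_carrier g -> psl2_carrier (- g);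
  psl2_mul : forall g h, psl2_carrier g -> psl2_carrier h -> psl2_carrier (g * h);
  psl2_inv : forall g, psl2_carrier g -> psl2_carrier g^-1 }.

(** The preimage of PSL_2(Z) in SL_2(R). *)
Definition psl2Z (R : realType) : set 'M[R]_2 :=
  [set g | g \is a mxOver Num.int /\ \det g = 1].

Section HyperbolicPlane.
Context {R : realType}.
Implicit Types (g h : 'M[R]_2) (z w : R * R) (p q : option R) (t : R).

Definition uhp : set (R * R) := [set z | 0 < z.2].

(** The real and imaginary parts of (a z + b) / (c z + d) when
    a d - b c = 1, with z = z.1 + i z.2. *)
Definition moebius g z : R * R :=
  let n := (g 1 0 * z.1 + g 1 1) ^+ 2 + (g 1 0 * z.2) ^+ 2 in
  (((g 0 0 * z.1 + g 0 1) * (g 1 0 * z.1 + g 1 1) + g 0 0 * g 1 0 * z.2 ^+ 2) / n,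
   z.2 / n).

(** The circle at infinity is [option R], with [None] for the point infinity. *)
Definition boundary_action g p : option R :=
  match p with
  | None => if g 1 0 == 0 then None else Some (g 0 0 / g 1 0)
  | Some x => if g 1 0 * x + g 1 1 == 0 then None
              else Some ((g 0 0 * x + g 0 1) / (g 1 0 * x + g 1 1))
  end.

(** The horocycles centred at p are the level sets, for positive levels, of
    [height p]: horizontal lines if p is infinity, and for p = a the Euclidean
    circles of diameter 1/t tangent to the real axis at a. *)
Definition height p z : R :=
  match p with
  | None => z.2
  | Some a => z.2 / ((z.1 - a) ^+ 2 + z.2 ^+ 2)
  end.

Definition horocycle p t : set (R * R) := [set z | uhp z /\ height p z = t].

(** The open horoball bounded by [horocycle p t]. *)
Definition horoball p t : set (R * R) := [set z | uhp z /\ t < height p z].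

(** The complete geodesic of the upper half-plane with endpoints p and q. *)
Definition geodesic p q : set (R * R) :=
  match p, q with
  | None, None => set0
  | None, Some a | Some a, None => [set z | uhp z /\ z.1 = a]
  | Some a, Some b =>
      [set z | [/\ uhp z, a != b & (z.1 - a) * (z.1 - b) + z.2 ^+ 2 = 0]]
  end.

Definition hyp_area (A : set (R * R)) : \bar R :=
  (\int[(@lebesgue_measure R \x @lebesgue_measure R)%E]_(z in A) (z.2 ^- 2)%:E)%E.

Lemma det2E g : \det g = g 0 0 * g 1 1 - g 0 1 * g 1 0.
Proof.
rewrite (expand_det_row g 0) !big_ord_recl big_ord0 addr0 /cofactor !det_mx11.
rewrite !mxE /= expr0 mul1r expr1 mulN1r mulrN.
by congr (_ * g _ _ - g _ _ * g _ _); apply/val_inj.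
Qed.

Lemma mul2E g h i j : (g * h) i j = g i 0 * h 0 j + g i 1 * h 1 j.
Proof.
rewrite mxE !big_ord_recl big_ord0 addr0.
by congr (_ + g _ _ * h _ _); apply/val_inj.
Qed.

Lemma moebius_den_gt0 g z : \det g = 1 -> uhp z ->
  0 < (g 1 0 * z.1 + g 1 1) ^+ 2 + (g 1 0 * z.2) ^+ 2.
Proof.
rewrite det2E /uhp /= => dg z0.
have [c0|c0] := eqVneq (g 1 0) 0.
  rewrite c0 mulr0 subr0 in dg; rewrite c0 !mul0r add0r expr0n addr0.
  rewrite exprn_even_gt0 //=; apply: contra_eq_neq dg => ->.
  by rewrite mulr0 eq_sym oner_neq0.
apply: ltr_wpDl; first exact: sqr_ge0.
by rewrite exprn_even_gt0 //= mulf_neq0 // gt_eqF.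
Qed.

Lemma moebius_uhp g z : \det g = 1 -> uhp z -> uhp (moebius g z).
Proof. by move=> dg z0; apply: divr_gt0 => //; exact: moebius_den_gt0. Qed.

Lemma moebius1 z : moebius 1 z = z.
Proof.
by case: z => x y; rewrite /moebius !mxE /=; congr (_, _); field.
Qed.

Lemma moebiusM g h z : \det g = 1 -> \det h = 1 -> uhp z ->
  moebius (g * h) z = moebius g (moebius h z).
Proof.
move=> dg dh z0.
have n1 := moebius_den_gt0 dh z0.
have n2 := moebius_den_gt0 dg (moebius_uhp dh z0).
have dgh : \det (g * h) = 1 by rewrite [LHS]det_mulmx dg dh mulr1.
have := moebius_den_gt0 dgh z0.
move: n1 n2 dg dh; rewrite !det2E /moebius /= !mul2E.
case: z z0 => x y /= _.
move: (g 0 0) (g 0 1) (g 1 0) (g 1 1) (h 0 0) (h 0 1) (h 1 0) (h 1 1).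
move=> a b c d a' b' c' d'; set n := (c' * x + d') ^+ 2 + _ => n0.
set u := _ / n; set v := y / n; set m := (c * u + d) ^+ 2 + _ => m0 _ dh.
set k := (_ + _) ^+ 2 + _ => k0.
have n'0 : (c' * x + d') ^+ 2 + (c' * y) ^+ 2 != 0 by rewrite gt_eqF.
have ev : v = (a' * d' - b' * c') * y / n by rewrite dh mul1r.
have em : m = k / n by rewrite /m ev /u /n /k; field.
have e1 : (a * u + b) * (c * u + d) + a * c * v ^+ 2 =
  (((a * a' + b * c') * x + (a * b' + b * d')) *
   ((c * a' + d * c') * x + (c * b' + d * d')) +
   (a * a' + b * c') * (c * a' + d * c') * y ^+ 2) / n.
  by rewrite ev /u /n; field.
have n1 : n != 0 by rewrite gt_eqF.
have k1 : k != 0 by rewrite gt_eqF.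
rewrite e1 em /v; move: n1 k1; clearbody n k => n1 k1.
by congr (_, _); field; rewrite n1 k1.
Qed.

Lemma boundary_action1 p : boundary_action 1 p = p.
Proof.
case: p => [x|]; rewrite /boundary_action !mxE /= ?eqxx //.
by rewrite mul0r add0r oner_eq0 mul1r addr0 divr1.
Qed.

Lemma boundary_actionM g h p : \det g = 1 -> \det h = 1 ->
  boundary_action (g * h) p = boundary_action g (boundary_action h p).
Proof.
rewrite !det2E /boundary_action !mul2E.
move: (g 0 0) (g 0 1) (g 1 0) (g 1 1) (h 0 0) (h 0 1) (h 1 0) (h 1 1).
move=> a b c d a' b' c' d' dg dh; case: p => [x|].
  have -> : (c * a' + d * c') * x + (c * b' + d * d') =
            c * (a' * x + b') + d * (c' * x + d') by ring.
  have -> : (a * a' + b * c') * x + (a * b' + b * d') =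
            a * (a' * x + b') + b * (c' * x + d') by ring.
  have [v0|v0] := eqVneq (c' * x + d') 0.
    have u0 : a' * x + b' != 0.
      apply: contra_eq_neq dh => u0; rewrite eq_sym.
      have -> : a' * d' - b' * c' =
        a' * (c' * x + d') - c' * (a' * x + b') by ring.
      by rewrite u0 v0 !mulr0 subrr oner_neq0.
    rewrite v0 !mulr0 !addr0 mulf_eq0 (negPf u0) orbF.
    by case: eqP => // _; rewrite -mulf_div divff// mulr1.
  move: (a' * x + b') (c' * x + d') v0 => u v v0.
  have -> : c * (u / v) + d = (c * u + d * v) / v by field.
  rewrite mulf_eq0 invr_eq0 (negPf v0) orbF.
  by case: eqP => // /eqP w0; congr Some; field; rewrite w0 v0.
have [v0|v0] := eqVneq c' 0.
  have u0 : a' != 0.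
    by apply: contra_eq_neq dh => ->; rewrite v0 mul0r mulr0 subrr eq_sym oner_neq0.
  rewrite v0 !mulr0 !addr0 mulf_eq0 (negPf u0) orbF.
  by case: eqP => // _; rewrite -mulf_div divff// mulr1.
have -> : c * (a' / c') + d = (c * a' + d * c') / c' by field.
rewrite mulf_eq0 invr_eq0 (negPf v0) orbF.
by case: eqP => // /eqP w0; congr Some; field; rewrite w0 v0.
Qed.

End HyperbolicPlane.

Section FuchsianGroup.
Context {R : realType}.
Variable G : psl2_subgroup R.
Implicit Types (p q : option R).

Definition torsion_free := forall g n, G g -> (0 < n)%N ->
  g ^+ n = 1 \/ g ^+ n = -1 -> g = 1 \/ g = -1.

Definition discrete_subgroup := psl2_carrier G `<=` isolated (psl2_carrier G).

(** Fixed points of the parabolic elements of G; the cusps of the surface are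
    the G-orbits of these points. *)
Definition cusp p := exists g,
  [/\ G g, g <> 1, g <> -1, (\tr g) ^+ 2 = 4 & boundary_action g p = p].

Definition fundamental_domain (F : set (R * R)) :=
  [/\ measurable (F : set (measurableTypeR R * measurableTypeR R)),
      F `<=` uhp,
      forall z, uhp z -> exists2 g, G g & F (moebius g z) &
      forall g, G g -> g <> 1 -> g <> -1 ->
        hyp_area (F `&` moebius g @` F) = 0%E].

Definition cofinite := exists2 F, fundamental_domain F & (hyp_area F < +oo)%E.

(** The upper half-plane together with the parabolic fixed points of G. *)
Definition in_cusped_plane (x : (R * R) + option R) : bool :=
  match x with inl z => `[< uhp z >] | inr p => `[< cusp p >] end.

Definition cusped_plane := {x : (R * R) + option R | in_cusped_plane x}.

HB.instance Definition _ := Choice.on cusped_plane.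

Definition plane_part (U : set cusped_plane) : set (R * R) :=
  [set z | exists2 x, U x & val x = inl z].

(** The horoball topology: the Euclidean topology on the half-plane, and at a
    parabolic fixed point p the sets {p} union [horoball p t] as a basis of
    neighbourhoods. *)
Definition cusped_open (U : set cusped_plane) :=
  open (plane_part U) /\
  forall x p, U x -> val x = inr p ->
    exists2 t, 0 < t & horoball p t `<=` plane_part U.

Lemma open_uhp : open (@uhp R).
Proof.
have -> : @uhp R = snd @^-1` [set y | 0 < y] by [].
by apply: open_comp; [move=> z _; exact: cvg_snd | exact: open_gt].
Qed.

Lemma cusped_openT : cusped_open setT.
Proof.
have TE : plane_part setT = uhp.
  apply/seteqP; split=> z /=.
    by move=> [[[w|p] /= h] _ //= [<-]]; exact/asboolP.
  by move=> z0; exists (exist _ (inl z) (asboolT z0)).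
split; first by rewrite TE; exact: open_uhp.
by move=> x p _ _; exists 1 => //; rewrite TE => z [].
Qed.

Lemma cusped_openI : setI_closed cusped_open.
Proof.
move=> U V [oU cU] [oV cV].
have IE : plane_part (U `&` V) = plane_part U `&` plane_part V.
  apply/seteqP; split=> z /=.
    by move=> [x [Ux Vx] xz]; split; exists x.
  move=> [[x Ux xz] [y Vy yz]]; exists x => //; split=> //.
  by have -> : x = y by apply: val_inj; rewrite xz yz.
split; first by rewrite IE; exact: openI.
move=> x p [Ux Vx] xp.
have [t t0 tU] := cU _ _ Ux xp; have [s s0 sV] := cV _ _ Vx xp.
exists (Num.max t s); first by rewrite lt_max t0.
by rewrite IE => z [z0]; rewrite gt_max => /andP[tz sz]; split;
  [apply: tU | apply: sV].
Qed.

Lemma cusped_open_bigU (I : Type) (f : I -> set cusped_plane) :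
  (forall i, cusped_open (f i)) -> cusped_open (\bigcup_i f i).
Proof.
move=> of_; split.
  have -> : plane_part (\bigcup_i f i) = \bigcup_i plane_part (f i).
    apply/seteqP; split=> z /=.
      by move=> [x [i _ fx] xz]; exists i => //; exists x.
    by move=> [i _ [x fx xz]]; exists x => //; exists i.
  by apply: bigcup_open => i _; have [] := of_ i.
move=> x p [i _ fx] xp; have [_ /(_ _ _ fx xp)[t t0 tf]] := of_ i.
by exists t => // z /tf[y fy yz]; exists y => //; exists i.
Qed.

HB.instance Definition _ := isOpenTopological.Build cusped_plane
  cusped_openT cusped_openI cusped_open_bigU.

Definition ext_action (g : 'M[R]_2) (x : (R * R) + option R) :=
  match x with
  | inl z => inl (moebius g z)
  | inr p => inr (boundary_action g p)
  end.

Definition orbit_rel : rel cusped_plane :=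
  fun x y => `[< exists2 g, G g & ext_action g (val x) = val y >].

Lemma ext_actionM g h (x : cusped_plane) : G g -> G h ->
  ext_action (g * h) (val x) = ext_action g (ext_action h (val x)).
Proof.
move=> /psl2_det dg /psl2_det dh; case: x => [[z|p] /= z0]; congr (_ _).
  by apply: moebiusM => //; exact/asboolP.
exact: boundary_actionM.
Qed.

Lemma ext_action1 x : ext_action 1 x = x.
Proof. by case: x => [z|p] /=; rewrite ?moebius1 ?boundary_action1. Qed.

Lemma orbit_rel_equiv : equiv_class_of orbit_rel.
Proof.
have sym x y : orbit_rel x y -> orbit_rel y x.
  move=> /asboolP[g Gg xy]; apply/asboolP; exists g^-1; first exact: psl2_inv.
  rewrite -xy -ext_actionM ?mulVr ?ext_action1//; last exact: psl2_inv.
  by rewrite unitmxE (psl2_det Gg) unitr1.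
split=> [x|x y|y x z]; first by apply/asboolP; exists 1;
  [exact: psl2_1 | exact: ext_action1].
  by apply/idP/idP; exact: sym.
move=> /asboolP[g Gg xy] /asboolP[h Gh yz]; apply/asboolP.
by exists (h * g); [exact: psl2_mul | rewrite ext_actionM// xy].
Qed.

Canonical orbit_equiv := EquivRelPack orbit_rel_equiv.

(** The surface H^2/G with each cusp filled in by a point. *)
Definition filled_surface : topologicalType :=
  quotient_topology {eq_quot orbit_equiv}.

Definition orbit_of (x : cusped_plane) : filled_surface :=
  (\pi_{eq_quot orbit_equiv} x)%qT.

(** The image in H^2/G of a set of points of the half-plane. *)
Definition image_in_surface (A : set (R * R)) : set filled_surface :=
  [set orbit_of x | x in [set x | exists2 z, A z & val x = inl z]].

Definition surface : set filled_surface := image_in_surface uhp.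

Definition cusp_points : set filled_surface :=
  [set orbit_of x | x in [set x | exists p, val x = inr p]].

Definition hyperbolic_surface_with_cusps :=
  [/\ torsion_free, discrete_subgroup, cofinite & ~ compact surface].

(** A choice of one horocycle at each cusp of the surface is the same as a
    G-equivariant choice of a horocycle [horocycle p (t p)] at each parabolic
    fixed point p. *)
Definition horocycle_packing (t : option R -> R) :=
  [/\ forall p, cusp p -> 0 < t p,
      forall g p, G g -> cusp p ->
        moebius g @` horocycle p (t p) =
        horocycle (boundary_action g p) (t (boundary_action g p)),
      forall g p, G g -> cusp p ->
        (moebius g @` horoball p (t p)) `&` horoball p (t p) !=set0 ->
        boundary_action g p = p &
      forall p q, cusp p -> cusp q ->
        (forall g, G g -> boundary_action g p <> q) ->
        image_in_surface (horoball p (t p)) `&`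
        image_in_surface (horoball q (t q)) = set0].

Definition congruent_horocycles (t : option R -> R) :=
  forall p q, cusp p -> cusp q -> exists2 g, \det g = 1 &
    moebius g @` horocycle p (t p) = horocycle q (t q).

Definition cusp_neighbourhoods (t : option R -> R) : set (R * R) :=
  \bigcup_(p in cusp) horoball p (t p).

(** The area of a subset of H^2/G is that of its preimage within a
    fundamental domain, and does not depend on the latter. *)
Definition has_packing_density (t : option R -> R) (delta : R) :=
  exists F, [/\ fundamental_domain F, (hyp_area F < +oo)%E &
    fine (hyp_area (F `&` cusp_neighbourhoods t)) / fine (hyp_area F) = delta].

(** The horocycles at p and q are tangent, with tangency point z. *)
Definition tangent_at (t : option R -> R) p q (z : R * R) :=
  p <> q /\ horocycle p (t p) `&` horocycle q (t q) = [set z].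

(** The edges of the packing graph, as subsets of H^2/G, without their
    endpoints; taking q in the orbit of p gives the loops. *)
Definition packing_edge (t : option R -> R) : set (set filled_surface) :=
  [set image_in_surface (geodesic pqz.1.1 pqz.1.2) |
    pqz in [set pqz : option R * option R * (R * R) |
      let: (p, q, z) := pqz in
      [/\ cusp p, cusp q, tangent_at t p q z & geodesic p q z]]].

Definition packing_graph (t : option R -> R) : set filled_surface :=
  cusp_points `|` \bigcup_(e in packing_edge t) e.

End FuchsianGroup.

Arguments packing_edge {R} G t _.
Arguments packing_graph {R} G t _.
Arguments cusp_points {R} G _.
Arguments cusp {R} G p.

Definition homeomorphism_on (X Y : topologicalType) (A : set X) (B : set Y)
    (f : X -> Y) :=
  [/\ set_bij A B f, {within A, continuous f} &
      exists2 f' : Y -> X, {within B, continuous f'} &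
        forall x, A x -> f' (f x) = x].

Section Triangulation.
Context {R : realType}.

Definition std_triangle : set (R * R) :=
  [set z | [/\ 0 <= z.1, 0 <= z.2 & z.1 + z.2 <= 1]].
Definition std_triangle_interior : set (R * R) :=
  [set z | [/\ 0 < z.1, 0 < z.2 & z.1 + z.2 < 1]].
Definition std_triangle_sides : set (set (R * R)) :=
  [set [set z | 0 < z.1 < 1 /\ z.2 = 0];
       [set z | z.1 = 0 /\ 0 < z.2 < 1];
       [set z | 0 < z.1 < 1 /\ z.2 = 1 - z.1]].
Definition std_triangle_vertices : set (R * R) :=
  [set (0, 0); (1, 0); (0, 1)].

Variables (G : psl2_subgroup R) (t : option R -> R).

(** C is an open triangle bounded by the packing graph: the image of the
    interior of a closed triangle under a map sending vertices to vertices and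
    open sides to edges. As usual for triangulations of surfaces with loops and
    multiple edges, different sides may have the same image, and likewise for
    vertices. *)
Definition topological_triangle (C : set (filled_surface G)) :=
  exists phi : R * R -> filled_surface G,
    [/\ {within std_triangle, continuous phi},
        homeomorphism_on std_triangle_interior C phi,
        forall s, std_triangle_sides s ->
          exists2 e, packing_edge G t e & homeomorphism_on s e phi &
        phi @` std_triangle_vertices `<=` cusp_points G].

Definition packable :=
  forall x, ~ packing_graph G t x ->
    topological_triangle (connected_component (~` packing_graph G t) x).

End Triangulation.

(* Main.v *)
(* A cusp together with a horocycle centred at it is encoded by a vector v of R^2,
   up to sign: to a point z of the half-plane one attaches the positive definite
   form [qf z] of determinant 1, and the horocycle is [qf z v = 1].  Two horoballs
   are disjoint iff |det(v, w)| >= 1, with tangency in the case of equality, and the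
   geodesic joining their centres is the set where v and w are orthogonal.  A
   packing is thus a G-invariant set V of vectors with |det| >= 1.
   If the complementary regions of the packing graph are triangles, V is closed
   under (v, w) |-> v + w for tangent v and w: lifting the chart of a region, the
   face of the lifted graph next to the edge v w has its three sides there.  A
   Euclidean descent then puts V in the lattice spanned by a tangent pair, which
   G preserves up to SL_2(Z).
   Conversely, let V be the image of the primitive integer vectors.  Tangent v, w
   span, with v + w, an ideal triangle, which Selling's parameters identify with
   the standard triangle; the images of these triangles are the complementary
   regions.  The density is computed by comparing a fundamental domain with a
   finite union of translates of the modular triangle, which has area pi / 3 and
   meets the horoballs in a set of area 1. *)

Require Import Defs.
From HB Require Import structures.
From mathcomp Require Import all_boot all_order all_algebra.
From mathcomp Require Import all_classical all_reals all_analysis.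
From mathcomp Require Import measurable_realfun finmap ring lra.
Set Implicit Arguments.
Unset Strict Implicit.
Unset Printing Implicit Defensive.
Import Order.TTheory GRing.Theory Num.Theory.
Import numFieldNormedType.Exports.
Local Open Scope classical_set_scope.
Local Open Scope ring_scope.

(** * Quadratic forms and horocycles *)

(** From a packing, the only data are charts: [packable] provides continuous maps into a quotient
    space, without any control of lengths or angles. To learn which edges bound a region, its chart
    is lifted to the half-plane. Lifting needs the projection to be a covering, and this is again
    read off V: a form is bounded on only finitely many vectors of V, so only finitely many elements
    of G bring a point back near itself. The corners of a chart go to cusps, over which the
    half-plane has no point; lifts are therefore made on triangles with the corners cut off, the cut
    being fine enough for the points at hand. If v + w were missing from V, the region beside the
    edge v w would touch four explicit edges. Each of them occupies a side of the chart and
    different edges occupy different sides, of which there are only three. For the density, the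
    given fundamental domain is never described: sets with negligible overlaps are compared with
    sets that cover, once in each direction. *)

Section Forms.
Context {R : realType}.
Implicit Types (v w u : R * R) (z : R * R) (a : R) (g h : 'M[R]_2).

Definition vdet v w : R := v.1 * w.2 - v.2 * w.1.

(* The positive definite form of determinant 1 attached to z, polarised:
   [qf z v v = |v.1 - v.2 z|^2 / Im z]. *)
Definition bf z v w : R :=
  ((v.1 - v.2 * z.1) * (w.1 - w.2 * z.1) + v.2 * w.2 * z.2 ^+ 2) / z.2.

Definition qf z v : R := bf z v v.

Definition vact g v : R * R :=
  (g 0 0 * v.1 + g 0 1 * v.2, g 1 0 * v.1 + g 1 1 * v.2).

Definition slope v : option R := if v.2 == 0 then None else Some (v.1 / v.2).

(** [height (slope v) z] is this number divided by [qf z v], so it is the level at which the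
    horocycle centred at [slope v] becomes [qf z v = 1]. *)
Definition slope_height v : R := if v.2 == 0 then v.1 ^+ 2 else v.2 ^+ 2.

Let scaleE a v : a *: v = (a * v.1, a * v.2).
Proof. by []. Qed.

Lemma bfC z v w : bf z v w = bf z w v.
Proof. by rewrite /bf; congr (_ * _); ring. Qed.

Lemma bfDr z v w u : bf z v (w + u) = bf z v w + bf z v u.
Proof. by rewrite /bf -mulrDl /=; congr (_ * _); ring. Qed.

Lemma bfZr z v w a : bf z v (a *: w) = a * bf z v w.
Proof. by rewrite /bf mulrA scaleE /=; congr (_ * _); ring. Qed.

Lemma bfNr z v w : bf z v (- w) = - bf z v w.
Proof. by rewrite -scaleN1r bfZr mulN1r. Qed.

Lemma bfDl z v w u : bf z (w + u) v = bf z w v + bf z u v.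
Proof. by rewrite bfC bfDr !(bfC z v). Qed.

Lemma bfZl z v w a : bf z (a *: w) v = a * bf z w v.
Proof. by rewrite bfC bfZr (bfC z v). Qed.

Lemma bfNl z v w : bf z (- w) v = - bf z w v.
Proof. by rewrite bfC bfNr (bfC z v). Qed.

Lemma qfN z v : qf z (- v) = qf z v.
Proof. by rewrite /qf bfNl bfNr opprK. Qed.

(** Lagrange's identity for a form of determinant 1. It converts lengths and orthogonality at a
    point into [vdet], which does not depend on the point. *)
Lemma qf_gram z v w : uhp z -> qf z v * qf z w = bf z v w ^+ 2 + vdet v w ^+ 2.
Proof.
by rewrite /uhp /= => z0; rewrite /qf /bf /vdet; field; rewrite gt_eqF.
Qed.

Lemma vdetC v w : vdet w v = - vdet v w.
Proof. by rewrite /vdet; ring. Qed.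

Lemma vdetDr v w u : vdet v (w + u) = vdet v w + vdet v u.
Proof. by rewrite /vdet /=; ring. Qed.

Lemma vdetZr v w a : vdet v (a *: w) = a * vdet v w.
Proof. by rewrite /vdet scaleE /=; ring. Qed.

Lemma vdetNr v w : vdet v (- w) = - vdet v w.
Proof. by rewrite /vdet /=; ring. Qed.

Lemma vdetDl v w u : vdet (w + u) v = vdet w v + vdet u v.
Proof. by rewrite /vdet /=; ring. Qed.

Lemma vdetZl v w a : vdet (a *: w) v = a * vdet w v.
Proof. by rewrite /vdet scaleE /=; ring. Qed.

Lemma vdetNl v w : vdet (- w) v = - vdet w v.
Proof. by rewrite /vdet /=; ring. Qed.

Lemma vdetvv v : vdet v v = 0.
Proof. by rewrite /vdet; ring. Qed.

Lemma qf_gt0 z v : uhp z -> v != 0 -> 0 < qf z v.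
Proof.
case: v => a c; rewrite /uhp /= => z0 v0; rewrite /qf /bf divr_gt0 //=.
have [c0|c0] := eqVneq c 0.
  have a0 : a != 0 by apply: contra_neq v0 => ->; rewrite c0.
  rewrite c0 !mul0r subr0 addr0 -expr2 exprn_even_gt0 //.
apply: ltr_wpDl; first by rewrite -expr2 sqr_ge0.
by rewrite -expr2 mulr_gt0 // exprn_even_gt0 //= gt_eqF.
Qed.

(** Cramer's rule, with the denominator cleared. *)
Lemma vdet_expand v w u : vdet v w *: u = vdet u w *: v + vdet v u *: w.
Proof.
by rewrite /vdet !scaleE; apply: injective_projections => /=; ring.
Qed.

Lemma vdet_act g v w : \det g = 1 -> vdet (vact g v) (vact g w) = vdet v w.
Proof.
by rewrite det2E => dg; rewrite -[RHS]mul1r -dg /vdet /vact /=; ring.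
Qed.

Lemma vact1 v : vact 1 v = v.
Proof. by case: v => a c; rewrite /vact !mxE /=; congr (_, _); ring. Qed.

Lemma vactM g h v : vact (g * h) v = vact g (vact h v).
Proof. by rewrite /vact !mul2E /=; congr (_, _); ring. Qed.

Lemma vactN g v : vact (- g) v = - vact g v.
Proof. by rewrite /vact !mxE; apply: injective_projections => /=; ring. Qed.

Lemma vact_opp g v : vact g (- v) = - vact g v.
Proof. by rewrite /vact; apply: injective_projections => /=; ring. Qed.

Lemma vactD g v w : vact g (v + w) = vact g v + vact g w.
Proof. by rewrite /vact; apply: injective_projections => /=; ring. Qed.

Lemma vactZ g v a : vact g (a *: v) = a *: vact g v.
Proof. by rewrite /vact !scaleE; apply: injective_projections => /=; ring. Qed.

Lemma vact0 g : vact g 0 = 0.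
Proof. by rewrite /vact; apply: injective_projections => /=; ring. Qed.

Lemma unit_det1 g : \det g = 1 -> g \is a GRing.unit.
Proof. by move=> dg; rewrite unitmxE dg unitr1. Qed.

Lemma det1V g : \det g = 1 -> \det g^-1 = 1.
Proof. by move=> dg; rewrite -[LHS]/(\det (invmx g)) det_inv dg invr1. Qed.

Lemma det1M g h : \det g = 1 -> \det h = 1 -> \det (g * h) = 1.
Proof. by move=> dg dh; rewrite [LHS]det_mulmx dg dh mulr1. Qed.

Lemma vactK g v : \det g = 1 -> vact g^-1 (vact g v) = v.
Proof. by move=> dg; rewrite -vactM mulVr ?unit_det1 // vact1. Qed.

Lemma vactVK g v : \det g = 1 -> vact g (vact g^-1 v) = v.
Proof. by move=> dg; rewrite -vactM mulrV ?unit_det1 // vact1. Qed.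

Lemma moebiusK g z : \det g = 1 -> uhp z -> moebius g^-1 (moebius g z) = z.
Proof.
by move=> dg z0; rewrite -moebiusM ?det1V // mulVr ?unit_det1 // moebius1.
Qed.

Lemma moebiusVK g z : \det g = 1 -> uhp z -> moebius g (moebius g^-1 z) = z.
Proof.
by move=> dg z0; rewrite -moebiusM ?det1V // mulrV ?unit_det1 // moebius1.
Qed.

Lemma vact_eq0 g v : \det g = 1 -> (vact g v == 0) = (v == 0).
Proof.
move=> dg; apply/eqP/eqP => [h|->]; last exact: vact0.
by rewrite -(vactK v dg) h vact0.
Qed.

(** Under g the linear form k - l z turns into (k - l z) / (c z + d), and Im z is divided by |c z +
    d|^2, so the quotient defining [bf] is unchanged. *)
Lemma bf_act g z v w : \det g = 1 -> uhp z ->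
  bf (moebius g z) (vact g v) (vact g w) = bf z v w.
Proof.
move=> dg z0; have := moebius_den_gt0 dg z0; move: dg z0; rewrite det2E /uhp.
rewrite /bf /moebius /vact /=; case: z => x y; case: v => p q; case: w => r s /=.
move: (g 0 0) (g 0 1) (g 1 0) (g 1 1) => a b c d dg y0 n0.
set n := (c * x + d) ^+ 2 + _ in n0 *.
have n1 : n != 0 by rewrite gt_eqF.
have y1 : y != 0 by rewrite gt_eqF.
(* This is the real part of (k - l z) / (c z + d). *)
have E1 (k l : R) : a * k + b * l - (c * k + d * l) *
      (((a * x + b) * (c * x + d) + a * c * y ^+ 2) / n) =
      ((k - l * x) * (c * x + d) - l * c * y ^+ 2) / n.
  rewrite -[a * k + b * l](mulfK n1) mulrA -mulrBl; congr (_ * _).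
  by rewrite -[RHS]mul1r -dg /n; ring.
rewrite !E1.
have -> : forall A B C : R, (A / n * (B / n) + C * (y / n) ^+ 2) / (y / n) =
  (A * B + C * y ^+ 2) / n / y by move=> A B C; field; rewrite y1 n1.
by congr (_ * _); apply: (canLR (mulfK n1)); rewrite /n; ring.
Qed.

Lemma qf_act g z v : \det g = 1 -> uhp z -> qf (moebius g z) (vact g v) = qf z v.
Proof. exact: bf_act. Qed.

Lemma slope_act g v : \det g = 1 -> v != 0 ->
  slope (vact g v) = boundary_action g (slope v).
Proof.
rewrite det2E; case: v => p q dg v0; rewrite /slope /boundary_action /vact /=.
move: v0 dg; move: (g 0 0) (g 0 1) (g 1 0) (g 1 1) => a b c d v0 dg.
have [q0|q0] := eqVneq q 0.
  have p0 : p != 0 by apply: contra_neq v0 => ->; rewrite q0.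
  rewrite q0 !mulr0 !addr0 mulf_eq0 (negPf p0) orbF; case: eqVneq => // c0.
  by congr Some; field; rewrite c0 p0.
have -> : c * (p / q) + d = (c * p + d * q) / q by field.
have -> : a * (p / q) + b = (a * p + b * q) / q by field.
rewrite mulf_eq0 invr_eq0 (negPf q0) orbF; case: eqVneq => // c0.
by congr Some; field; rewrite c0 q0.
Qed.

Lemma slope_eq v w : v != 0 -> w != 0 -> (slope v = slope w) <-> (vdet v w = 0).
Proof.
case: v => a c; case: w => b d v0 w0; rewrite /slope /vdet /=.
have [c0|c0] := eqVneq c 0.
  have a0 : a != 0 by apply: contra_neq v0 => ->; rewrite c0.
  rewrite c0 mul0r subr0; have [d0|d0] := eqVneq d 0; first by rewrite d0 mulr0.
  by split=> // /eqP; rewrite mulf_eq0 (negPf a0) (negPf d0).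
have [d0|d0] := eqVneq d 0.
  have b0 : b != 0 by apply: contra_neq w0 => ->; rewrite d0.
  split=> // /eqP; rewrite d0 mulr0 sub0r oppr_eq0 mulf_eq0 (negPf b0).
  by rewrite (negPf c0).
split=> [[e]|e].
  have -> : a = b / d * c by rewrite -e; field.
  by field.
by congr Some; apply/eqP; rewrite eqr_div // -subr_eq0 -e; apply/eqP; ring.
Qed.

Lemma slopeN v : slope (- v) = slope v.
Proof. by case: v => a c; rewrite /slope /= oppr_eq0 invrN mulrNN. Qed.

Lemma slope_heightN v : slope_height (- v) = slope_height v.
Proof. by case: v => a c; rewrite /slope_height /= oppr_eq0 !sqrrN. Qed.

Lemma slope_height_gt0 v : v != 0 -> 0 < slope_height v.
Proof.
case: v => a c v0; rewrite /slope_height /=; have [c0|c0] := eqVneq c 0.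
  have a0 : a != 0 by apply: contra_neq v0 => ->; rewrite c0.
  by rewrite exprn_even_gt0.
by rewrite exprn_even_gt0.
Qed.

Lemma slope_height_qf v z : v != 0 -> uhp z ->
  height (slope v) z = slope_height v / qf z v.
Proof.
case: v => a c v0; case: z => x y; rewrite /uhp /= => y0.
have y1 : y != 0 by rewrite gt_eqF.
rewrite /height /slope /slope_height /qf /bf /=.
have [c0|c0] := eqVneq c 0.
  have a0 : a != 0 by apply: contra_neq v0 => ->; rewrite c0.
  by rewrite c0 !mul0r subr0 addr0; field; rewrite y1 a0.
have n0 : (x - a / c) ^+ 2 + y ^+ 2 != 0.
  by rewrite gt_eqF // ltr_wpDl ?sqr_ge0 // exprn_gt0.
have -> : (a - c * x) * (a - c * x) + c * c * y ^+ 2 =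
  c ^+ 2 * ((x - a / c) ^+ 2 + y ^+ 2) by field.
move: n0; set n := _ + _ => n0; field.
by rewrite c0 y1 n0.
Qed.

Lemma horoballE v : v != 0 ->
  horoball (slope v) (slope_height v) = [set z | uhp z /\ qf z v < 1].
Proof.
move=> v0; apply/seteqP; split=> z [z0 h]; split=> //; move: h;
  rewrite slope_height_qf // ltr_pdivlMr ?qf_gt0 //;
  by rewrite gtr_pMr ?slope_height_gt0.
Qed.

Lemma horocycleE v : v != 0 ->
  horocycle (slope v) (slope_height v) = [set z | uhp z /\ qf z v = 1].
Proof.
move=> v0; have s0 := slope_height_gt0 v0.
apply/seteqP; split=> z [z0 h]; split=> //; move: h;
  rewrite slope_height_qf //; have q0 := qf_gt0 z0 v0; last first.
  by move=> ->; rewrite divr1.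
move/(canRL (mulfVK (lt0r_neq0 q0)))/esym.
by rewrite -[RHS]mulr1 => /(mulfI (lt0r_neq0 s0)).
Qed.

Lemma geodesicE v w : v != 0 -> w != 0 -> vdet v w != 0 ->
  geodesic (slope v) (slope w) = [set z | uhp z /\ bf z v w = 0].
Proof.
case: v => a c; case: w => b d v0 w0 dt.
rewrite /geodesic /slope /bf /=; rewrite /vdet/= in dt.
have bf0 z X : uhp z -> (X / z.2 = 0) <-> X = 0.
  rewrite /uhp /= => z0; split=> [/eqP|->]; last by rewrite mul0r.
  by rewrite mulf_eq0 invr_eq0 (gt_eqF z0) orbF => /eqP.
have [c0|c0] := eqVneq c 0.
  have a0 : a != 0 by apply: contra_neq v0 => ->; rewrite c0.
  have [d0|d0] := eqVneq d 0.
    by case/eqP: dt; rewrite c0 d0; ring.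
  apply/seteqP; split=> z [z0 h]; split=> //; last move: h; rewrite ?bf0 //.
    by rewrite h c0; field.
  rewrite c0 !mul0r subr0 addr0 => /eqP; rewrite mulf_eq0 (negPf a0) /=.
  by rewrite subr_eq0 => /eqP ->; field.
have [d0|d0] := eqVneq d 0.
  have b0 : b != 0 by apply: contra_neq w0 => ->; rewrite d0.
  apply/seteqP; split=> z [z0 h]; split=> //; last move: h; rewrite ?bf0 //.
    by rewrite h d0; field.
  rewrite d0 mulr0 !mul0r subr0 addr0 => /eqP; rewrite mulf_eq0 (negPf b0) orbF.
  by rewrite subr_eq0 => /eqP ->; field.
have E z : (a - c * z.1) * (b - d * z.1) + c * d * z.2 ^+ 2 =
    c * d * ((z.1 - a / c) * (z.1 - b / d) + z.2 ^+ 2) by field; rewrite c0 d0.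
apply/seteqP; split=> [z [z0 _ h]|z [z0]].
  by split=> //; rewrite bf0 // E h mulr0.
rewrite bf0 // E => /eqP; rewrite !mulf_eq0 (negPf c0) (negPf d0) /= => /eqP h.
split=> //; apply: contra_neq dt => e.
have -> : a = b / d * c by rewrite -e; field.
by field.
Qed.

End Forms.

(** * Sets of vectors with determinants at least 1 *)

Section UnimodularSets.
Context {R : realType}.
Variable V : set (R * R).
Implicit Types (v w u : R * R) (z : R * R) (a b : R).

Definition unimodular :=
  [/\ forall v, V v -> v != 0, forall v, V v -> V (- v) &
      forall v w, V v -> V w -> [\/ w = v, w = - v | 1 <= `|vdet v w|]].

Definition edge v w := [/\ V v, V w & `|vdet v w| = 1].

Hypothesis hV : unimodular.

Lemma edgeC v w : edge v w -> edge w v.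
Proof. by move=> [Vv Vw d]; split=> //; rewrite vdetC normrN. Qed.

Lemma edgeNr v w : edge v w -> edge v (- w).
Proof.
by have [_ VN _] := hV; move=> [Vv Vw d]; split=> //; [exact: VN|rewrite vdetNr normrN].
Qed.

Lemma edgeNl v w : edge v w -> edge (- v) w.
Proof. by move/edgeC/edgeNr/edgeC. Qed.

Lemma edge_qf z v w : uhp z -> edge v w -> bf z v w = 0 ->
  qf z v * qf z w = 1.
Proof.
move=> z0 [_ _ d] b0; rewrite qf_gram // b0 expr0n add0r.
by rewrite -(real_normK (num_real _)) d expr1n.
Qed.

Lemma sqr_vdet_ge1 v w : V v -> V w -> w <> v -> w <> - v -> 1 <= vdet v w ^+ 2.
Proof.
move=> Vv Vw h1 h2; have [_ _ VV] := hV.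
case: (VV v w Vv Vw) => // d; rewrite -(real_normK (num_real _)).
by rewrite -[leLHS](expr1n _ 2) lerXn2r ?nnegrE.
Qed.

(** On the line of w u these two vectors are orthogonal, so the expansion of v along them obeys
    Pythagoras. Both coordinates are at least 1 in absolute value, and [qf z w + qf z u >= 2]
    because the product is 1. The bound 2 is what localises edges from here on. *)
Lemma qf_nonincident z v w u : uhp z -> V v -> edge w u -> bf z w u = 0 ->
  v <> w -> v <> - w -> v <> u -> v <> - u -> 2 <= qf z v.
Proof.
move=> z0 Vv ewu b0 h1 h2 h3 h4; have q1 := edge_qf z0 ewu b0.
have [Vw Vu d] := ewu; have [V0 _ _] := hV.
have d2 : vdet w u ^+ 2 = 1 by rewrite -(real_normK (num_real _)) d expr1n.
have e : qf z v = vdet w u ^+ 2 * qf z v by rewrite d2 mul1r.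
have {}e : qf z v = vdet v u ^+ 2 * qf z w + vdet w v ^+ 2 * qf z u.
  rewrite e /qf expr2 -mulrA -bfZr -bfZl vdet_expand !(bfDl, bfDr, bfZl, bfZr).
  by rewrite (bfC z u w) b0; ring.
have n1 : 1 <= vdet w v ^+ 2 by apply: sqr_vdet_ge1.
have n2 : 1 <= vdet v u ^+ 2 by rewrite vdetC sqrrN; apply: sqr_vdet_ge1.
have p1 := qf_gt0 z0 (V0 _ Vw); have p2 := qf_gt0 z0 (V0 _ Vu).
have le2 : 2 <= qf z w + qf z u.
  by have := sqr_ge0 (qf z w - qf z u); move: p1 p2 q1; nra.
rewrite e; apply: le_trans le2 _.
by apply: lerD; rewrite ler_peMl // ltW.
Qed.

(** Since [qf z v * qf z w = 1], one of the two values is below 2, and by [qf_nonincident] that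
    vector is an endpoint of the other edge as well; orthogonality then fixes the second
    endpoint. *)
Lemma edge_unique z v w u u' : uhp z -> edge v w -> edge u u' ->
  bf z v w = 0 -> bf z u u' = 0 ->
  ((u = v \/ u = - v) /\ (u' = w \/ u' = - w)) \/
  ((u = w \/ u = - w) /\ (u' = v \/ u' = - v)).
Proof.
have [V0 VN VV] := hV.
move=> z0.
have main v1 w1 u1 u1' : edge v1 w1 -> edge u1 u1' ->
    bf z v1 w1 = 0 -> bf z u1 u1' = 0 -> (u1 = v1 \/ u1 = - v1) ->
    (u1' = w1 \/ u1' = - w1).
  move=> e1 e2 b1 b2 uv.
  have b3 : bf z v1 u1' = 0.
    by case: uv b2 => ->// /eqP; rewrite bfNl oppr_eq0 => /eqP.
  have [Vv1 Vw1 d1] := e1; have [_ Vu1' d2] := e2.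
  have q0 := qf_gt0 z0 (V0 _ Vv1).
  have d3 : vdet w1 u1' = 0.
    have := vdet_expand v1 w1 u1' => /(congr1 (bf z v1)).
    rewrite bfZr b3 mulr0 bfDr !bfZr b1 mulr0 addr0 => /esym/eqP.
    by rewrite mulf_eq0 (gt_eqF q0) orbF vdetC oppr_eq0 => /eqP.
  case: (VV _ _ Vw1 Vu1') => [->|->|]; [by left|by right|].
  by rewrite d3 normr0 ler10.
move=> e1 e2 b1 b2; have q1 := edge_qf z0 e1 b1.
have [Vv Vw _] := e1; have p1 := qf_gt0 z0 (V0 _ Vv); have p2 := qf_gt0 z0 (V0 _ Vw).
wlog qv : v w e1 b1 q1 Vv Vw p1 p2 / qf z v < 2.
  move=> H; have [|qv] := ltP (qf z v) 2; first exact: H.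
  have /H : edge w v by exact: edgeC.
  rewrite bfC mulrC => /(_ b1 q1 Vw Vv p2 p1).
  have qw : qf z w < 2 by nra.
  by case=> //; [right|left].
have [uv|uv] := pselect (u = v \/ u = - v); first by left; split=> //; apply: main uv.
have [u'v|u'v] := pselect (u' = v \/ u' = - v).
  by right; split=> //; apply: (main v _ u') => //; [exact: edgeC|rewrite bfC].
suff h : 2 <= qf z v by move: (le_lt_trans h qv); rewrite ltxx.
apply: (qf_nonincident z0 Vv e2 b2) => e.
- by apply: uv; left.
- by apply: uv; right; rewrite e opprK.
- by apply: u'v; left.
- by apply: u'v; right; rewrite e opprK.
Qed.

(** Contrapositive of [qf_nonincident]: the horoball of v, enlarged to [qf z v < 2], is entered only
    by edges ending at v. *)
Lemma edge_incident z v u u' : uhp z -> V v -> edge u u' -> bf z u u' = 0 ->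
  qf z v < 2 -> exists2 w, edge v w & bf z v w = 0 /\
    ((u = v \/ u = - v) /\ (u' = w \/ u' = - w) \/
     (u = w \/ u = - w) /\ (u' = v \/ u' = - v)).
Proof.
move=> z0 Vv e b0 qv.
have [uv|uv] := pselect (u = v \/ u = - v).
  exists u'; last split; [| |by left; split=> //; left].
    by case: uv e => -> // /edgeNl; rewrite opprK.
  by case: uv b0 => ->// /eqP; rewrite bfNl oppr_eq0 => /eqP.
have [u'v|u'v] := pselect (u' = v \/ u' = - v).
  exists u; last split; [| |by right; split=> //; left].
    by case: u'v e => -> /edgeC // /edgeNl; rewrite opprK.
  by case: u'v b0 => ->; rewrite bfC // => /eqP; rewrite bfNl oppr_eq0 => /eqP.
suff h : 2 <= qf z v by move: (le_lt_trans h qv); rewrite ltxx.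
apply: (qf_nonincident z0 Vv e b0) => e'.
- by apply: uv; left.
- by apply: uv; right; rewrite e' opprK.
- by apply: u'v; left.
- by apply: u'v; right; rewrite e' opprK.
Qed.

(** Vectors with the same determinant against v differ by a multiple of v, so the neighbours of v
    are parametrised by a real number b. *)
Lemma edge_coset v w u : edge v w -> edge v u ->
  exists b, w + b *: v = u \/ w + b *: v = - u.
Proof.
move=> [Vv Vw d] [_ Vu d'].
have [V0 _ _] := hV; have v0 := V0 _ Vv.
have dn : vdet v w != 0 by rewrite -normr_gt0 d.
suff H u1 : vdet v u1 = vdet v w -> exists b, w + b *: v = u1.
  have /eqP := d; rewrite -d' eqr_norm2 => /orP[/eqP e|/eqP e].
    by have [b e'] := H u (esym e); exists b; left.
  have [|b e'] := H (- u); first by rewrite vdetNr e.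
  by exists b; right.
move=> e; exists (vdet u1 w / vdet v w); apply: (scalerI dn).
by rewrite scalerDr scalerA mulrC divfK // addrC (vdet_expand v w u1) e.
Qed.

Definition edge_free z := forall u u', edge u u' -> bf z u u' <> 0.

(** An edge through such a point would join v to some [w + b *: v]. Orthogonality at z places b
    strictly between 0 and a, where V has no such vector. *)
Lemma strip_edge_free z v w a : uhp z -> edge v w ->
  (forall b, 0 < b < a -> ~ V (w + b *: v)) ->
  qf z v < 2 -> bf z v w < 0 -> 0 < bf z v (w + a *: v) -> edge_free z.
Proof.
move=> z0 evw hb qv b1 b2 u u' e b0; have [V0 VN _] := hV; have [Vv _ _] := evw.
have [x ex [bx _]] := edge_incident z0 Vv e b0 qv.
have q0 := qf_gt0 z0 (V0 _ Vv).
have [b hbx] := edge_coset evw ex.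
have bb : bf z v w + b * qf z v = 0.
  rewrite /qf -bfZr -bfDr; case: hbx => -> //; by rewrite bfNr bx oppr0.
have [_ Vx _] := ex.
apply: (hb b); last by case: hbx => -> //; exact: VN.
move: b2; rewrite bfDr bfZr -/(qf z v) => b2.
by apply/andP; split; nra.
Qed.

(** Close to the line of v w any edge still ends at v, hence joins it to some [w + b *: v] with
    [bf z v w = - (b * qf z v)]. Distinct neighbours of v have |b| >= 1, so closeness forces b =
    0. *)
Lemma edge_near z v w u u' : uhp z -> edge v w -> qf z v < 2 ->
  `|bf z v w| < qf z v -> edge u u' -> bf z u u' = 0 -> bf z v w = 0.
Proof.
move=> z0 evw qv bv e b0; have [V0 VN VV] := hV; have [Vv Vw d] := evw.
have [x ex [bx _]] := edge_incident z0 Vv e b0 qv.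
have q0 := qf_gt0 z0 (V0 _ Vv); have [_ Vx dx] := ex.
have [b hbx] := edge_coset evw ex.
have bb : bf z v w = - (b * qf z v).
  apply/eqP; rewrite -addr_eq0 /qf -bfZr -bfDr; apply/eqP.
  by case: hbx => -> //; rewrite bfNr bx oppr0.
have Vy : V (w + b *: v) by case: hbx => -> //; exact: VN.
case: (VV _ _ Vw Vy) => [/(congr1 (fun y => y - w))|e1|].
- by rewrite addrC addKr subrr bb => /eqP; rewrite scaler_eq0 (negPf (V0 _ Vv)) orbF
    => /eqP ->; rewrite mul0r oppr0.
- have := congr1 (vdet v) e1; rewrite vdetDr vdetZr vdetvv mulr0 addr0 vdetNr.
  move=> /eqP; rewrite -addr_eq0 -mulr2n mulrn_eq0 /= => /eqP dz.
  by move: d; rewrite dz normr0 => /eqP; rewrite eq_sym oner_eq0.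
rewrite vdetDr vdetvv add0r vdetZr normrM vdetC normrN d mulr1 => hb1.
by move: bv; rewrite bb normrN normrM (gtr0_norm q0) ltNge ler_peMl // ltW.
Qed.

(** The four edges that the region beside v w would touch if [v + w] were missing. Two of them
    through one point would have the same endpoints up to sign by [edge_unique], which their
    coordinates in the basis v, w exclude. *)
Lemma four_edges v w a b c z : edge v w -> 1 < a -> 1 < b -> 1 <= c ->
  let w1 := w + a *: v in let w2 := v + b *: w in let w3 := - v + c *: w1 in
  edge v w1 -> edge w w2 -> edge w1 w3 -> uhp z ->
  [/\ bf z v w = 0 -> bf z v w1 <> 0, bf z v w = 0 -> bf z w w2 <> 0,
     bf z v w = 0 -> bf z w1 w3 <> 0, bf z v w1 = 0 -> bf z w w2 <> 0 &
     bf z v w1 = 0 -> bf z w1 w3 <> 0] /\ (bf z w w2 = 0 -> bf z w1 w3 <> 0).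
Proof.
move=> evw a1 b1 c1 w1 w2 w3 e1 e2 e3 z0.
have dvw : vdet v w != 0 by have [_ _ d] := evw; rewrite -normr_gt0 d.
have lin x y x' y' : x *: v + y *: w = x' *: v + y' *: w -> x = x' /\ y = y'.
  move=> h; have := congr1 (vdet v) h; have := congr1 (vdet w) h.
  rewrite !(vdetDr, vdetZr) !vdetvv !mulr0 !add0r !addr0.
  by rewrite (vdetC v w) => /mulIf h1 /mulIf h2; rewrite h1 ?oppr_eq0 // h2.
have E1 : w1 = a *: v + 1 *: w by rewrite scale1r addrC.
have E2 : w2 = 1 *: v + b *: w by rewrite scale1r.
have E3 : w3 = (c * a - 1) *: v + c *: w.
  by rewrite /w3 E1 scalerDr !scalerA scalerBl mulr1 scale1r; apply: injective_projections => /=; ring.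
have Ev : v = 1 *: v + 0 *: w by rewrite scale1r scale0r addr0.
have Ew : w = 0 *: v + 1 *: w by rewrite scale1r scale0r add0r.
have EN x y : - (x *: v + y *: w) = (- x) *: v + (- y) *: w.
  by rewrite opprD !scaleNr.
have ne x y x' y' u u' : u = x *: v + y *: w -> u' = x' *: v + y' *: w ->
    (x != x') || (y != y') -> (x != - x') || (y != - y') -> ~ (u = u' \/ u = - u').
  by move=> -> -> h1 h2 [/lin[e e']|]; [|rewrite EN => /lin[e e']]; subst;
    [move: h1|move: h2]; rewrite !eqxx.
have excl x1 y1 x2 y2 : edge x1 y1 -> edge x2 y2 ->
    (~ (x2 = x1 \/ x2 = - x1) \/ ~ (y2 = y1 \/ y2 = - y1)) ->
    (~ (x2 = y1 \/ x2 = - y1) \/ ~ (y2 = x1 \/ y2 = - x1)) ->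
    bf z x1 y1 = 0 -> bf z x2 y2 <> 0.
  move=> h1 h2 n1 n2 k1 k2.
  by case: (edge_unique z0 h1 h2 k1 k2) => -[p q]; [case: n1|case: n2]; exact.
have a0 : a != 0 by lra.
have an1 : a != 1 by lra.
have b0 : b != 0 by lra.
have bn1 : b != 1 by lra.
have c0 : c != 0 by lra.
have ca : c * a - 1 != 0 by nra.
have ? : a != - 1 by lra.
have ? : b != - 1 by lra.
have ? : (1 : R) != -1 by lra.
have ? : (1 : R) != 0 by lra.
split; [split|]; apply: excl => //.
- by right; apply: (ne _ _ _ _ _ _ E1 Ew); rewrite ?oppr0 a0.
- by left; apply: (ne _ _ _ _ _ _ Ev Ew); rewrite ?oppr0 ?oner_neq0.
- by left; apply: (ne _ _ _ _ _ _ Ew Ev); rewrite ?oppr0 ?oner_neq0 ?orbT.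
- by right; apply: (ne _ _ _ _ _ _ E2 Ev); rewrite ?oppr0 ?b0 ?orbT.
- by left; apply: (ne _ _ _ _ _ _ E1 Ev); rewrite ?oppr0 ?oner_neq0 ?orbT.
- by left; apply: (ne _ _ _ _ _ _ E1 Ew); rewrite ?oppr0 a0.
- by left; apply: (ne _ _ _ _ _ _ Ew Ev); rewrite ?oppr0 ?oner_neq0 ?orbT.
- by left; apply: (ne _ _ _ _ _ _ Ew E1); rewrite ?oppr0 ?(eq_sym 0) ?oppr_eq0 ?a0.
- by left; apply: (ne _ _ _ _ _ _ E1 Ev); rewrite ?oppr0 ?oner_neq0 ?orbT.
- by right; apply: (ne _ _ _ _ _ _ E3 Ev); rewrite ?oppr0 ?c0 ?orbT.
- by left; apply: (ne _ _ _ _ _ _ E1 Ew); rewrite ?oppr0 a0.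
- by left; apply: (ne _ _ _ _ _ _ E1 E2); rewrite ?an1 //; apply/orP; left.
Qed.

End UnimodularSets.

Lemma cvg_to_pair (S : Type) (T U : topologicalType) (F : set_system S)
    (FF : Filter F) (f : S -> T) (g : S -> U) (a : T) (b : U) :
  f @ F --> a -> g @ F --> b -> (fun x => (f x, g x)) @ F --> (a, b).
Proof. by move=> fa gb; exact: (cvg_pair fa gb). Qed.

(** * Segments of the Klein model *)

Section KleinPath.
Context {R : realType}.
Implicit Types (v w u : R * R) (z : R * R) (r : R).

(* Geodesics are straight in the coordinates [(x, x^2 + y^2)] of the Klein
   model; [kpath z0 z1] is the segment from z0 to z1. *)
Definition kpath z0 z1 r : R * R :=
  let x := (1 - r) * z0.1 + r * z1.1 in
  let s := (1 - r) * (z0.1 ^+ 2 + z0.2 ^+ 2) + r * (z1.1 ^+ 2 + z1.2 ^+ 2) in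
  (x, Num.sqrt (s - x ^+ 2)).

Arguments kpath : simpl never.

(** In the coordinates (x, s) the half-plane is the convex region s > x^2, on which the height
    sqrt(s - x^2) is concave; [t - m ^+ 2] is [r * (1 - r)] times a squared distance. *)
Lemma kpath_sqr z0 z1 r : uhp z0 -> uhp z1 -> 0 <= r <= 1 ->
  0 < (1 - r) * z0.2 + r * z1.2 <= (kpath z0 z1 r).2 /\
  (kpath z0 z1 r).2 ^+ 2 =
    (1 - r) * (z0.1 ^+ 2 + z0.2 ^+ 2) + r * (z1.1 ^+ 2 + z1.2 ^+ 2)
      - (kpath z0 z1 r).1 ^+ 2.
Proof.
rewrite /uhp /kpath; case: z0 => x0 y0; case: z1 => x1 y1 /= h0 h1 /andP[r0 r1].
have r1' : 0 <= 1 - r by rewrite subr_ge0.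
set t := (X in Num.sqrt X); set m := _ + r * y1.
have m0 : 0 < m.
  rewrite /m; have [->|rn] := eqVneq r 0; first by rewrite subr0 mul1r mul0r addr0.
  by rewrite ltr_wpDl ?mulr_ge0 // ?(ltW h0) // mulr_gt0 // lt_def rn.
have mt : m ^+ 2 <= t.
  rewrite -subr_ge0.
  have -> : t - m ^+ 2 = r * (1 - r) * ((x0 - x1) ^+ 2 + (y0 - y1) ^+ 2).
    by rewrite /t /m; ring.
  by rewrite !mulr_ge0 // addr_ge0 // sqr_ge0.
have t0 : 0 <= t by apply: le_trans mt; exact: sqr_ge0.
split; last by rewrite sqr_sqrtr.
rewrite m0 /= -(ler_pXn2r (n:=2)) ?nnegrE ?sqrtr_ge0 ?(ltW m0) //.
by rewrite sqr_sqrtr.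
Qed.

Lemma kpath_uhp z0 z1 r : uhp z0 -> uhp z1 -> 0 <= r <= 1 -> uhp (kpath z0 z1 r).
Proof.
move=> h0 h1 hr; have [/andP[p q] _] := kpath_sqr h0 h1 hr.
exact: lt_le_trans p q.
Qed.

(** [z.2 * bf z v w] is affine in x and x^2 + y^2, hence affine along a segment. Edge lines are
    therefore straight and their two sides convex. *)
Lemma bf_kpath z0 z1 r v w : uhp z0 -> uhp z1 -> 0 <= r <= 1 ->
  (kpath z0 z1 r).2 * bf (kpath z0 z1 r) v w =
  (1 - r) * (z0.2 * bf z0 v w) + r * (z1.2 * bf z1 v w).
Proof.
move=> h0 h1 hr; have := kpath_uhp h0 h1 hr; have [_ e] := kpath_sqr h0 h1 hr.
move: h0 h1; rewrite /uhp /= => /lt0r_neq0 h0 /lt0r_neq0 h1 /lt0r_neq0 h2.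
rewrite /bf !(mulrC _ (_ / _)) !divfK // e /kpath /=; ring.
Qed.

Lemma kpath0 z0 z1 : uhp z0 -> kpath z0 z1 0 = z0.
Proof.
case: z0 => x y; rewrite /uhp /kpath /= => y0.
rewrite subr0 !mul1r !mul0r !addr0 addrAC subrr add0r sqrtr_sqr gtr0_norm //.
Qed.

Lemma kpath1 z0 z1 : uhp z1 -> kpath z0 z1 1 = z1.
Proof.
case: z1 => x y; rewrite /uhp /kpath /= => y0.
rewrite subrr !mul1r !mul0r !add0r addrAC subrr add0r sqrtr_sqr gtr0_norm //.
Qed.

Lemma kpath_continuous z0 z1 : continuous (kpath z0 z1).
Proof.
have cl (a b : R) : continuous (fun r : R => (1 - r) * a + r * b).
  move=> r; apply: cvgD; apply: cvgM; try exact: cvg_cst; try exact: cvg_id.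
  by apply: cvgB; [exact: cvg_cst|exact: cvg_id].
move=> r; apply: cvg_to_pair; first exact: cl.
apply: cvg_comp; last exact: sqrt_continuous.
apply: cvgB; first exact: cl.
by apply: cvgM; exact: cl.
Qed.

(** If the signs differed, the affine function of [bf_kpath] would vanish at the parameter
    [A / (A - B)] of the segment. *)
Lemma kpath_same_side (P : set (R * R)) v w : P `<=` uhp ->
  (forall z0 z1 r, P z0 -> P z1 -> 0 <= r <= 1 -> P (kpath z0 z1 r)) ->
  (forall z, P z -> bf z v w <> 0) ->
  forall z0 z1, P z0 -> P z1 -> 0 < bf z0 v w * bf z1 v w.
Proof.
move=> Pu Pk Pn z0 z1 P0 P1; rewrite ltNge; apply/negP => neg.
have /eqP n0 := Pn _ P0; have /eqP n1 := Pn _ P1.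
have := Pu _ P0; have := Pu _ P1; rewrite /uhp /= => y1 y0.
set A := z0.2 * bf z0 v w; set B := z1.2 * bf z1 v w.
have A0 : A != 0 by rewrite mulf_neq0 // gt_eqF.
have AB : A * B <= 0.
  by rewrite /A /B mulrACA pmulr_rle0 // mulr_gt0.
have D0 : 0 < (A - B) ^+ 2.
  have A2 : 0 < A ^+ 2 by rewrite exprn_even_gt0.
  by apply: lt_le_trans A2 _; have := sqr_ge0 B; nra.
have D1 : A - B != 0 by apply: contraTneq D0 => ->; rewrite expr0n ltxx.
pose r := A / (A - B).
have r0 : 0 <= r.
  have -> : r = A * (A - B) / (A - B) ^+ 2 by rewrite /r; field.
  by rewrite divr_ge0 // ?(ltW D0) //; have := sqr_ge0 A; nra.
have r1 : 0 <= 1 - r.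
  have -> : 1 - r = - B * (A - B) / (A - B) ^+ 2 by rewrite /r; field.
  by rewrite divr_ge0 // ?(ltW D0) //; have := sqr_ge0 B; nra.
have hr : 0 <= r <= 1 by rewrite r0 -subr_ge0.
have Pr := Pk _ _ _ P0 P1 hr; have := Pn _ Pr; have := Pu _ Pr.
have := bf_kpath v w y0 y1 hr; rewrite -/A -/B.
have -> : (1 - r) * A + r * B = 0 by rewrite /r; field.
by move=> /eqP; rewrite mulf_eq0 /uhp /= => /orP[/eqP->|/eqP->//]; rewrite ltxx.
Qed.

(** The sector at v between the lines of v w and v w', within the enlarged horoball where only edges
    ending at v can occur. *)
Definition strip v w w' : set (R * R) :=
  [set z | [/\ uhp z, qf z v < 2, bf z v w < 0 & 0 < bf z v w']].

Lemma strip_kpath v w w' z0 z1 r : strip v w w' z0 -> strip v w w' z1 ->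
  0 <= r <= 1 -> strip v w w' (kpath z0 z1 r).
Proof.
move=> [u0 q0 a0 b0] [u1 q1 a1 b1] hr.
have hu := kpath_uhp u0 u1 hr; have [/andP[m0 mle] _] := kpath_sqr u0 u1 hr.
have E := bf_kpath _ _ u0 u1 hr.
move: (u0) (u1) (hu); rewrite /uhp /= => y0 y1 yr.
have /andP[r0 r1] := hr; have r1' : 0 <= 1 - r by rewrite subr_ge0.
have lin (A B : R) : 0 < A -> 0 < B -> 0 < (1 - r) * A + r * B.
  move=> A0 B0; have [->|rn] := eqVneq r 0; first by rewrite subr0 mul1r mul0r addr0.
  by rewrite ltr_wpDl ?mulr_ge0 // ?(ltW A0) // mulr_gt0 // lt_def rn.
split=> //.
- rewrite -(ltr_pM2l yr) /qf E.
  (* The bound 2 survives because the height along the segment is at least the interpolated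
     height. *)
  apply: (lt_le_trans (y := ((1 - r) * z0.2 + r * z1.2) * 2)); last by rewrite ler_pM2r.
  rewrite -subr_gt0.
  have -> : ((1 - r) * z0.2 + r * z1.2) * 2 - ((1 - r) * (z0.2 * bf z0 v v) +
    r * (z1.2 * bf z1 v v)) = (1 - r) * (z0.2 * (2 - qf z0 v)) +
    r * (z1.2 * (2 - qf z1 v)) by rewrite /qf; ring.
  by apply: lin; rewrite mulr_gt0 // subr_gt0.
- rewrite -(pmulr_rlt0 _ yr) E -oppr_gt0.
  have -> : - ((1 - r) * (z0.2 * bf z0 v w) + r * (z1.2 * bf z1 v w)) =
    (1 - r) * (z0.2 * - bf z0 v w) + r * (z1.2 * - bf z1 v w) by ring.
  by apply: lin; rewrite mulr_gt0 // oppr_gt0.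
- by rewrite -(pmulr_rgt0 _ yr) E; apply: lin; rewrite mulr_gt0.
Qed.

End KleinPath.

(** * Invariance under the group and the Euclidean descent *)

Section InvariantSets.
Context {R : realType}.
Variables (G : psl2_subgroup R) (V : set (R * R)).
Hypothesis hV : unimodular V.
Implicit Types (v w u : R * R) (z : R * R).

Lemma vact_eq1 g v w : vdet v w != 0 -> vact g v = v -> vact g w = w -> g = 1.
Proof.
move=> d gv gw.
have E u : vact g u = u.
  by apply: (scalerI d); rewrite -vactZ vdet_expand vactD !vactZ gv gw.
have [e00 e10] : (g 0 0, g 1 0) = (1, 0).
  by rewrite -(E (1, 0)) /vact /= !mulr1 !mulr0 !addr0.
have [e01 e11] : (g 0 1, g 1 1) = (0, 1).
  by rewrite -(E (0, 1)) /vact /= !mulr1 !mulr0 !add0r.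
apply/matrixP => i j; rewrite !mxE.
case: i => [[|[|//]] i]; case: j => [[|[|//]] j];
  [rewrite -[RHS]e00|rewrite -[RHS]e01|rewrite -[RHS]e10|rewrite -[RHS]e11];
  by congr (g _ _); apply/val_inj.
Qed.

Hypothesis VG : forall g v, G g -> V v -> V (vact g v).

(** A parabolic element fixing the centre of v moves w to [w + r *: v] with r nonzero, so V has
    vectors [w + a *: v] with a > 0. Unimodularity keeps these a at distance at least 1 from each
    other, so there is a smallest one. *)
Lemma next_edge v w : cusp G (slope v) -> edge V v w ->
  exists2 a, 1 <= a & V (w + a *: v) /\ forall b, 0 < b < a -> ~ V (w + b *: v).
Proof.
have [V0 VN VV] := hV.
move=> [g0 [Gg0 g01 g0N _ fix0]] [Vv Vw d].
have v0 := V0 _ Vv; have dn : vdet v w != 0 by rewrite -normr_gt0 d.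
(* After a change of sign if necessary, the element fixes v itself and not only its slope. *)
have [g [Gg g1 gN gv]] : exists g, [/\ G g, g <> 1, g <> -1 & vact g v = v].
  have dg := psl2_det Gg0.
  have := VV _ _ Vv (VG Gg0 Vv).
  have /slope_eq-> // : slope v = slope (vact g0 v) by rewrite slope_act // fix0.
    rewrite normr0 ler10 => -[e|e|//]; first by exists g0.
    exists (- g0); split; [exact: psl2_opp| | |by rewrite vactN e opprK].
      by move=> e'; apply: g0N; rewrite -e' opprK.
    by move=> /oppr_inj.
  by rewrite vact_eq0.
have dg := psl2_det Gg.
have [r rE] : exists r, vact g w = w + r *: v.
  exists (vdet (vact g w) w / vdet v w); apply: (scalerI dn).
  rewrite scalerDr scalerA mulrC divfK // addrC (vdet_expand v w (vact g w)).
  by rewrite -[in X in X *: w]gv vdet_act.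
have rn0 : r != 0.
  apply: contra_notN g1 => /eqP r0; apply: (vact_eq1 dn gv).
  by rewrite rE r0 scale0r addr0.
pose A := [set a | 0 < a /\ V (w + a *: v)].
have An0 : A !=set0.
  have [r0|r0] := ltP 0 r; first by exists r; split=> //; rewrite -rE; exact: VG.
  exists (- r); split; first by rewrite oppr_gt0 lt_def eq_sym rn0.
  have -> : w + - r *: v = vact g^-1 w; last by apply: VG => //; exact: psl2_inv.
  rewrite -[LHS](vactK _ dg); congr (vact _ _).
  by rewrite vactD vactZ gv rE scaleNr addrK.
have sep a b : A a -> A b -> a < b -> 1 <= b - a.
  move=> [a0 Va] [b0 Vb] ab.
  case: (VV _ _ Va Vb).
  - move=> /addrI /eqP; rewrite -subr_eq0 -scalerBl scaler_eq0 (negPf v0) orbF.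
    by rewrite subr_eq0 => /eqP e; rewrite e ltxx in ab.
  - move=> /(congr1 (vdet v)); rewrite vdetNr !vdetDr !vdetZr.
    rewrite vdetvv !mulr0 !addr0 => /eqP.
    by rewrite -addr_eq0 -mulr2n mulrn_eq0 /= (negPf dn).
  - have -> : vdet (w + a *: v) (w + b *: v) = - ((b - a) * vdet v w).
      by rewrite !(vdetDr, vdetDl, vdetZr, vdetZl) !vdetvv (vdetC v w); ring.
    by rewrite normrN normrM d mulr1 gtr0_norm ?subr_gt0.
have hA : has_inf A by split=> //; exists 0 => a [/ltW].
(* By the spacing [sep], an element below [inf A + 1] is already the least. *)
have [a Aa am] := inf_adherent (@ltr01 R) hA.
exists a.
  have [a0 Va] := Aa; case: (VV _ _ Vw Va).
  - move=> /(congr1 (fun y => y - w)) /eqP; rewrite addrC addKr subrr scaler_eq0.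
    by rewrite (negPf v0) orbF (gt_eqF a0).
  - move=> /(congr1 (vdet v)); rewrite vdetDr vdetNr vdetZr vdetvv mulr0 addr0 => /eqP.
    by rewrite -addr_eq0 -mulr2n mulrn_eq0 /= (negPf dn).
  - by rewrite vdetDr vdetvv add0r vdetZr normrM (vdetC v) normrN d mulr1 gtr0_norm.
split; first by have [] := Aa.
move=> b /andP[b0 ba] Vb; have Ab : A b by [].
have := sep _ _ Ab Aa ba; have := ge_inf hA.2 Ab; move: am.
set m := inf A; lra.
Qed.

(** The measure is the integral part of the sum of the absolute coordinates of u. Once the
    coordinates are nonnegative, passing to the pair v, v + w or v + w, w subtracts the smaller from
    the larger; the smaller is at least 1 unless u is v or w up to sign, so the measure drops. *)
Lemma unimodular_descent v w u :
  (forall v w, edge V v w -> V (v + w)) -> edge V v w -> V u ->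
  exists m n : int, u = m%:~R *: v + n%:~R *: w.
Proof.
have [V0 VN VV] := hV.
move=> Vadd; have [k] := ubnP (Num.truncn (`|vdet u w| + `|vdet v u|)).
elim: k v w => // k IH v w; rewrite ltnS => hk evw Vu.
have [Vv Vw d] := evw; have dn : vdet v w != 0 by rewrite -normr_gt0 d.
wlog u1 : v w evw Vv Vw d dn hk / 0 <= vdet u w * vdet v w.
  move=> H; have [|neg] := leP 0 (vdet u w * vdet v w); first exact: (H v w).
  have [|||||||m [n ->]] := H (- v) w; rewrite ?vdetNl ?normrN ?oppr_eq0 //.
  - exact: edgeNl.
  - exact: VN.
  - by rewrite mulrN oppr_ge0 ltW.
  by exists (- m), n; rewrite mulrNz scaleNr scalerN.
wlog u2 : v w evw Vv Vw d dn hk u1 / 0 <= vdet v u * vdet v w.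
  move=> H; have [|neg] := leP 0 (vdet v u * vdet v w); first exact: (H v w).
  have [||||||||m [n ->]] := H v (- w);
    rewrite ?vdetNr ?normrN ?oppr_eq0 ?mulrNN //.
  - exact: edgeNr.
  - exact: VN.
  - by rewrite mulrN oppr_ge0 ltW.
  by exists m, (- n); rewrite mulrNz scaleNr scalerN.
have [uv|[uv|nuv]] : u = v \/ u = - v \/ 1 <= `|vdet v u|.
  by case: (VV _ _ Vv Vu); auto.
- by exists 1, 0; rewrite scale1r scale0r addr0.
- by exists (-1), 0; rewrite scaleN1r scale0r addr0.
have [uw|[uw|nuw]] : u = w \/ u = - w \/ 1 <= `|vdet w u|.
  by case: (VV _ _ Vw Vu); auto.
- by exists 0, 1; rewrite scale1r scale0r add0r.
- by exists 0, (-1); rewrite scaleN1r scale0r add0r.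
rewrite vdetC normrN in nuw.
set A := vdet u w in u1 nuw hk; set B := vdet v u in u2 nuv hk.
have Vs := Vadd _ _ evw.
(* The normalisations [u1] and [u2] give A and B a common sign. *)
have dle : `|A - B| = `| `|A| - `|B| |.
  have [A0|A0] := leP 0 (vdet v w).
    have D1 : vdet v w = 1 by rewrite -d ger0_norm.
    by move: u1 u2; rewrite D1 !mulr1 => pA pB; rewrite (ger0_norm pA) (ger0_norm pB).
  have D1 : vdet v w = -1 by rewrite -d ltr0_norm // opprK.
  move: u1 u2; rewrite D1 !mulrN1 !oppr_ge0 => pA pB.
  by rewrite (ler0_norm pA) (ler0_norm pB) distrC opprK addrC.
case: (VV _ _ Vs Vu) => [->|->|].
- by exists 1, 1; rewrite !scale1r.
- by exists (-1), (-1); rewrite !scaleN1r opprD.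
have -> : vdet (v + w) u = B - A by rewrite vdetDl /A (vdetC u w).
move=> AB.
have shrink (x y : R) : 0 <= x -> x <= y - 1 -> (Num.truncn y <= k)%N ->
    (Num.truncn x < k)%N.
  move=> x0 xy; apply: leq_trans.
  have y0 : 0 <= y by lra.
  have := truncn_itv y0; have := truncn_itv x0 => /andP[t1 t2] /andP[t3 t4].
  have : (Num.truncn x).+1%:R < (Num.truncn y).+1%:R :> R.
    by apply: le_lt_trans t4; rewrite -natr1; lra.
  by rewrite ltr_nat ltnS.
have [leBA|ltAB] := leP `|B| `|A|.
  have [|||m [n ->]] := IH v (v + w).
  - have -> : vdet u (v + w) = A - B by rewrite vdetDr (vdetC v u) addrC.
    rewrite dle (ger0_norm (_ : 0 <= `|A| - `|B|)) ?subr_ge0 //.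
    by apply: shrink hk; [rewrite addr_ge0 // subr_ge0|lra].
  - by split=> //; rewrite vdetDr vdetvv add0r.
  - by [].
  by exists (m + n), n; rewrite scalerDr addrA intrD scalerDl.
have [|||m [n ->]] := IH (v + w) w.
- have -> : vdet (v + w) u = - (A - B) by rewrite vdetDl (vdetC u w) [RHS]opprB.
  rewrite normrN dle (distrC `|A|) (gtr0_norm (_ : 0 < `|B| - `|A|)) ?subr_gt0 //.
  by apply: shrink hk; [rewrite addr_ge0 // subr_ge0 ltW|lra].
- by split=> //; rewrite vdetDl vdetvv addr0.
- by [].
by exists m, (m + n); rewrite scalerDr -addrA intrD scalerDl.
Qed.

End InvariantSets.

Ltac cvg_arith := rewrite ?expr2; repeat lazymatch goal with
  | |- _ --> (_ + _)%R => apply: cvgD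
  | |- _ --> (- _)%R => apply: cvgN
  | |- _ --> (_ * _)%R => apply: cvgM
  | |- _ => first [exact: cvg_cst | exact: cvg_fst | exact: cvg_snd | exact: cvg_id]
  end.

(** * The covering of the surface by the half-plane *)

Section LocalFreeness.
Context {R : realType}.
Implicit Types (v w u : R * R) (z : R * R) (g h : 'M[R]_2).

Lemma bf_cvg z v w : uhp z -> bf y v w @[y --> z] --> bf z v w.
Proof.
rewrite /uhp /= => z0; rewrite /bf; apply: cvgM; first by cvg_arith.
by apply: cvgV; [rewrite gt_eqF|exact: cvg_snd].
Qed.

Lemma qf_cvg z v : uhp z -> qf y v @[y --> z] --> qf z v.
Proof. exact: bf_cvg. Qed.

Lemma moebius_cvg g z : \det g = 1 -> uhp z -> moebius g y @[y --> z] --> moebius g z.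
Proof.
move=> dg z0; have n0 := moebius_den_gt0 dg z0.
have nc : ((g 1 0 * y.1 + g 1 1) ^+ 2 + (g 1 0 * y.2) ^+ 2)^-1 @[y --> z] -->
  ((g 1 0 * z.1 + g 1 1) ^+ 2 + (g 1 0 * z.2) ^+ 2)^-1.
  by apply: cvgV; [rewrite gt_eqF|cvg_arith].
by rewrite /moebius; apply: cvg_to_pair; apply: cvgM nc; cvg_arith.
Qed.

Lemma finite_set_inj (T U : Type) (A : set T) (f : T -> U) :
  finite_set (f @` A) -> {in A &, injective f} -> finite_set A.
Proof. by move=> fA /inj_card_eq /eq_finite_set <-. Qed.

Lemma truncn_eq_dist (e x y : R) : 0 < e -> 0 <= x -> 0 <= y ->
  Num.truncn (x / e) = Num.truncn (y / e) -> `|x - y| < e.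
Proof.
move=> e0 x0 y0 E.
have /andP[a1 a2] := truncn_itv (divr_ge0 x0 (ltW e0)).
have /andP[b1 b2] := truncn_itv (divr_ge0 y0 (ltW e0)).
rewrite -{}E in b1 b2; move: a1 a2 b1 b2.
rewrite !ler_pdivlMr // !ltr_pdivrMr // -natr1 mulrDl mul1r.
by move=> *; rewrite ltr_norml; apply/andP; split; lra.
Qed.

(** A bound on [qf z u] confines u to a square. In each cell of a fine grid two vectors of V have
    determinant below 1 in absolute value, so they agree up to sign. *)
Lemma finite_qf_le (V : set (R * R)) z (M : R) : unimodular V -> uhp z ->
  finite_set [set u | V u /\ qf z u <= M].
Proof.
move=> [V0 _ VV] z0; have y0 : 0 < z.2 := z0.
have [M0|M0] := ltP M 0.
  rewrite (_ : [set u | _] = set0); first exact: finite_set0.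
  rewrite -subset0 => u [Vu h]; have := lt_le_trans (qf_gt0 z0 (V0 _ Vu)) h.
  by move=> /(lt_trans M0); rewrite ltxx.
pose a u := u.1 - u.2 * z.1; pose b u := u.2 * z.2.
have E u : qf z u = (a u ^+ 2 + b u ^+ 2) / z.2.
  by rewrite /qf /bf /a /b; congr (_ * _); ring.
(* C bounds both coordinates, as t^2 <= M y implies |t| <= 1 + M y. For cells of size e the
   determinant stays below 2 C e / y = 1. *)
pose C := 1 + M * z.2; pose e := z.2 / (2 * C).
have My : 0 <= M * z.2 by rewrite mulr_ge0 // ltW.
have C0 : 0 < C by rewrite /C; lra.
have e0 : 0 < e by rewrite divr_gt0 // mulr_gt0.
have sq t : t ^+ 2 <= M * z.2 -> `|t| <= C.
  move=> h; rewrite -(ler_pXn2r (n:=2)) ?nnegrE ?normr_ge0 ?(ltW C0) //.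
  rewrite real_normK ?num_real //; apply: le_trans h _; rewrite /C.
  by move: (M * z.2) My => m; nra.
have bnd u : qf z u <= M -> `|a u| <= C /\ `|b u| <= C.
  rewrite E ler_pdivrMr // => h; split; apply: sq; apply: le_trans h.
    by rewrite lerDl sqr_ge0.
  by rewrite lerDr sqr_ge0.
pose cell t := Num.truncn ((t + C) / e); pose K := Num.truncn ((C + C) / e).
have cellP t : `|t| <= C -> (cell t <= K)%N.
  rewrite ler_norml => /andP[t1 t2]; apply: le_truncn.
  by rewrite ler_pM2r ?invr_gt0 // lerD2r.
have near_cell t t' : `|t| <= C -> `|t'| <= C ->
    (inord (cell t) : 'I_K.+1) = inord (cell t') -> `|t' - t| < e.
  move=> h h' /(congr1 val); rewrite /= !inordK ?ltnS ?cellP // => ec.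
  have -> : t' - t = (t' + C) - (t + C) by ring.
  by move: h h'; rewrite !ler_norml => /andP[? ?] /andP[? ?];
    apply: truncn_eq_dist => //; lra.
(* Tells u from - u, which may lie in the same cell. *)
pose s u := (0 < u.1) || ((u.1 == 0) && (0 < u.2)).
apply: (@finite_set_inj _ ('I_K.+1 * 'I_K.+1 * bool)%type _
  (fun u => (inord (cell (a u)), inord (cell (b u)), s u))).
  exact: finite_finset.
move=> u u' /set_mem[Vu qu] /set_mem[Vu' qu'] [e1 e2 e3].
have [a1 b1] := bnd _ qu; have [a2 b2] := bnd _ qu'.
have da := near_cell _ _ a1 a2 e1; have db := near_cell _ _ b1 b2 e2.
case: (VV _ _ Vu Vu') => [//|h|].
  have := V0 _ Vu; move: e3; rewrite {}h /s /= oppr_eq0 !oppr_gt0.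
  case: (u) => p q /=; rewrite xpair_eqE /=.
  by case: (ltrgt0P p) => //= _; case: (ltrgt0P q).
have -> : vdet u u' = (a u * (b u' - b u) - b u * (a u' - a u)) / z.2.
  by rewrite /vdet /a /b; field; rewrite gt_eqF.
rewrite normrM normfV (gtr0_norm y0) ler_pdivlMr // mul1r leNgt; case/negP.
apply: (le_lt_trans (ler_normB _ _)); rewrite (normrM (a u)) (normrM (b u)).
rewrite [ltRHS](_ : _ = C * e + C * e); last by rewrite /e; field; rewrite gt_eqF.
have le_lt_mul (p q : R) : 0 <= p -> p <= C -> 0 <= q -> q < e -> p * q < C * e.
  by move=> *; apply: (@le_lt_trans _ _ (C * q)); [rewrite ler_wpM2r|rewrite ltr_pM2l].
by apply: ltrD; apply: le_lt_mul.
Qed.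

Definition qnear z : set (R * R) :=
  [set z' | `|z'.1 - z.1| < z.2 / 2 /\ z.2 / 2 < z'.2 < 2 * z.2].

Lemma nbhs_qnear z : uhp z -> nbhs z (qnear z).
Proof.
rewrite /uhp /= => z0; have h2 : 0 < z.2 / 2 by rewrite divr_gt0.
have f1 : \forall y \near z, `|z.1 - y.1| < z.2 / 2.
  have c1 : y.1 @[y --> z] --> z.1 by exact: cvg_fst.
  by move/cvgrPdist_lt : c1; exact.
have f2 : \forall y \near z, `|z.2 - y.2| < z.2 / 2.
  have c2 : y.2 @[y --> z] --> z.2 by exact: cvg_snd.
  by move/cvgrPdist_lt : c2; exact.
near=> y; split; first by rewrite distrC; near: y.
have : `|z.2 - y.2| < z.2 / 2 by near: y.
by rewrite ltr_norml => /andP[? ?]; apply/andP; split; lra.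
Unshelve. all: by end_near.
Qed.

Lemma qnear_qf z z' u : uhp z -> qnear z z' -> qf z u <= 6 * qf z' u /\
  qf z' u <= 6 * qf z u.
Proof.
have key (y y' A d u2 : R) : 0 < y -> 0 < y' -> y < 2 * y' -> y' < 2 * y ->
    d ^+ 2 <= y' ^+ 2 -> d ^+ 2 <= y ^+ 2 ->
  ((A + u2 * d) ^+ 2 + u2 ^+ 2 * y ^+ 2) / y <=
  6 * ((A ^+ 2 + u2 ^+ 2 * y' ^+ 2) / y').
  move=> y0 y'0 h1 h2 d1 d2; rewrite mulrA ler_pdivrMr // [leRHS]mulrAC ler_pdivlMr //.
  have : (A + u2 * d) ^+ 2 <= 2 * A ^+ 2 + 2 * (u2 ^+ 2 * d ^+ 2).
    by have := sqr_ge0 (A - u2 * d); nra.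
  have u0 := sqr_ge0 u2; have A0 := sqr_ge0 A.
  have : u2 ^+ 2 * d ^+ 2 <= u2 ^+ 2 * y' ^+ 2 by rewrite ler_wpM2l.
  move: (u2 ^+ 2) (A ^+ 2) (d ^+ 2) ((A + u2 * d) ^+ 2) u0 A0 => U B D S U0 B0 h3 h4.
  have h5 : S * y' <= (2 * B + 2 * (U * y' ^+ 2)) * y' by rewrite ler_pM2r //; lra.
  have h6 : (2 * B + 2 * (U * y' ^+ 2)) * y' <= (2 * B + 2 * (U * y' ^+ 2)) * (2 * y).
    by rewrite ler_wpM2l ?(ltW h2) // addr_ge0 ?mulr_ge0 ?sqr_ge0 ?(ltW y'0).
  have h7 : U * y * (y * y') <= U * y * (2 * y' ^+ 2).
    by rewrite ler_wpM2l ?mulr_ge0 ?(ltW y0) // expr2 mulrA ler_pM2r // ltW.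
  have h8 : U * y ^+ 2 * y' = U * y * (y * y') by ring.
  rewrite mulrDl h8; apply: le_trans (lerD (le_trans h5 h6) h7) _.
  rewrite -subr_ge0 (_ : _ - _ = 2 * (B * y)); last by ring.
  by rewrite mulr_ge0 // mulr_ge0 // ltW.
rewrite /uhp /= => y0 [dx /andP[l1 l2]].
have y'0 : 0 < z'.2 by lra.
have dd (t s : R) : `|t| < s -> t ^+ 2 <= s ^+ 2.
  move=> h; rewrite -(real_normK (num_real t)) lerXn2r ?nnegrE ?normr_ge0 ?(ltW h) //.
  exact: le_trans (normr_ge0 _) (ltW h).
have h1 : (z'.1 - z.1) ^+ 2 <= z.2 ^+ 2 by apply: dd; lra.
have h2 : (z'.1 - z.1) ^+ 2 <= z'.2 ^+ 2 by apply: dd; lra.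
split.
  have -> : qf z u = ((u.1 - u.2 * z'.1 + u.2 * (z'.1 - z.1)) ^+ 2
    + u.2 ^+ 2 * z.2 ^+ 2) / z.2 by rewrite /qf /bf; congr (_ * _); ring.
  have -> : qf z' u = ((u.1 - u.2 * z'.1) ^+ 2 + u.2 ^+ 2 * z'.2 ^+ 2) / z'.2.
    by rewrite /qf /bf; congr (_ * _); ring.
  by apply: key => //; lra.
have -> : qf z' u = ((u.1 - u.2 * z.1 + u.2 * (z.1 - z'.1)) ^+ 2
    + u.2 ^+ 2 * z'.2 ^+ 2) / z'.2 by rewrite /qf /bf; congr (_ * _); ring.
have -> : qf z u = ((u.1 - u.2 * z.1) ^+ 2 + u.2 ^+ 2 * z.2 ^+ 2) / z.2.
  by rewrite /qf /bf; congr (_ * _); ring.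
by apply: key => //; rewrite -?(sqrrN (z.1 - _)) ?opprB //; lra.
Qed.

Lemma qnear_uhp z z' : uhp z -> qnear z z' -> uhp z'.
Proof.
by rewrite /uhp /= => z0 [_ /andP[h _]]; apply: lt_trans h; rewrite divr_gt0.
Qed.

Lemma nbhs_uhp z : uhp z -> nbhs z (@uhp R).
Proof. by move=> z0; exact: open_nbhs_nbhs (conj open_uhp z0). Qed.

Variables (G : psl2_subgroup R) (V : set (R * R)).
Hypothesis hV : unimodular V.
Hypothesis VG : forall g v, G g -> V v -> V (vact g v).
Hypothesis tfG : torsion_free G.

(** g is determined by the images of the independent vectors v and w, and each image lies in a
    finite set. *)
Lemma finite_bounded_elements v w z M : edge V v w -> uhp z ->
  finite_set [set g | [/\ G g, qf z (vact g v) <= M & qf z (vact g w) <= M]].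
Proof.
move=> [Vv Vw d] z0; have dn : vdet v w != 0 by rewrite -normr_gt0 d.
apply: (@finite_set_inj _ _ _ (fun g => (vact g v, vact g w))).
  apply: sub_finite_set (finite_setX (finite_qf_le M hV z0) (finite_qf_le M hV z0)).
  by move=> _ [g [Gg h1 h2] <-]; split; split=> //; exact: VG.
move=> g h /set_mem[Gg _ _] /set_mem[Gh _ _] /pair_equal_spec[e1 e2].
have dg := psl2_det Gg; have dh := psl2_det Gh.
have : h^-1 * g = 1 by apply: (vact_eq1 dn); rewrite vactM ?e1 ?e2 vactK.
by move/(congr1 (fun x => h * x)); rewrite mulVKr ?unit_det1 // mulr1.
Qed.

(** All powers of g lie in a finite set, so two of them coincide and g has finite order. Freeness on
    points, on edges and on triangles reduces to this criterion. *)
Lemma bounded_powers_trivial v w z M g : edge V v w -> uhp z -> G g ->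
  (forall n, qf z (vact (g ^+ n) v) <= M /\ qf z (vact (g ^+ n) w) <= M) ->
  g = 1 \/ g = -1.
Proof.
move=> evw z0 Gg bnd; have dg := psl2_det Gg.
have GX n : G (g ^+ n).
  by elim: n => [|n IH]; [exact: psl2_1|rewrite exprS; exact: psl2_mul].
have fin := finite_bounded_elements M evw z0.
have /existsNP[m /existsNP[n h]] : ~ forall m n, (m < n)%N -> g ^+ m <> g ^+ n.
  move=> inj; apply: infinite_nat.
  apply: (@finite_set_inj _ _ _ (fun n => g ^+ n)).
    by apply: sub_finite_set fin => _ [n _ <-]; have [? ?] := bnd n; split.
  move=> m n _ _ e; case: (ltngtP m n) => // mn; first by case: (inj _ _ mn).
  by case: (inj _ _ mn).
move/not_implyP: h => [mn /contrapT e].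
apply: (tfG Gg (n := (n - m)%N)); first by rewrite subn_gt0.
left; have um : g ^+ m \is a GRing.unit by rewrite unitrX ?unit_det1.
by apply: (mulrI um); rewrite -exprD subnKC ?(ltnW mn) // mulr1.
Qed.

Lemma stabilizer_trivial v w z g : edge V v w -> uhp z -> G g ->
  moebius g z = z -> g = 1 \/ g = -1.
Proof.
move=> evw z0 Gg gz; have dg := psl2_det Gg.
have dX n : \det (g ^+ n) = 1 by elim: n => [|n IH]; [exact: det1|rewrite exprS det1M].
have gXz n : moebius (g ^+ n) z = z.
  elim: n => [|n IH]; first exact: moebius1.
  by rewrite exprS moebiusM ?IH.
pose M := Num.max (qf z v) (qf z w).
apply: (bounded_powers_trivial (M := M) evw z0 Gg) => n.
by split; rewrite -[z in qf z](gXz n) qf_act // le_max lexx ?orbT.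
Qed.

(** Proper discontinuity and freeness together. If g brings a point near z back near z, the forms of
    g v and g w at z are at most 36 = 6 * 6 times those of v and w, so finitely many g are
    concerned; each nontrivial one moves z and is excluded by separating z from its image. *)
Lemma free_nbhs v w z : edge V v w -> uhp z ->
  exists U, [/\ open U, U z, U `<=` uhp & forall g y, G g -> U y ->
    U (moebius g y) -> g = 1 \/ g = -1].
Proof.
move=> evw z0; pose M := Num.max (36 * qf z v) (36 * qf z w).
pose S := [set g | [/\ G g, qf z (vact g v) <= M & qf z (vact g w) <= M]].
have /finite_fsetP[D DE] : finite_set S by exact: finite_bounded_elements.
have sep g : exists A, nbhs z A /\ (G g -> ~ (g = 1 \/ g = -1) ->
    forall y, A y -> ~ A (moebius g y)).
  have [[Gg gn]|h] := pselect (G g /\ ~ (g = 1 \/ g = -1)); last first.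
    by exists setT; split; [exact: filterT|move=> Gg gn; case: h].
  have gz : z != moebius g z.
    by apply: contra_notN gn => /eqP e; exact: (stabilizer_trivial evw z0 Gg (esym e)).
  have hT : hausdorff_space (R * R)%type by exact: norm_hausdorff.
  move: hT; rewrite open_hausdorff => /(_ _ _ gz)[[A B] /=[/set_mem Az /set_mem Bz] [oA oB /eqP AB]].
  exists (A `&` (moebius g @^-1` B)); split.
    apply: filterI; first exact: open_nbhs_nbhs.
    by apply: (moebius_cvg (psl2_det Gg) z0); exact: open_nbhs_nbhs.
  by move=> _ _ y [_ By] [Agy _]; have : (A `&` B) (moebius g y) by []; rewrite AB.
have [A hA] := choice sep.
have nA : nbhs z (\bigcap_(g in [set` D]) A g).
  by apply: filter_bigI => g _; have [] := hA g.
have nU : nbhs z ((\bigcap_(g in [set` D]) A g) `&` qnear z).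
  by apply: filterI => //; exact: nbhs_qnear.
move: nU; rewrite nbhsE => -[U [oU Uz] US]; exists U; split=> //.
  by move=> y /US[_ /qnear_uhp]; exact.
move=> g y Gg Uy Ugy; apply: contrapT => gn.
have [_ qy] := US _ Uy; have [_ qgy] := US _ Ugy.
have y0 := qnear_uhp z0 qy; have dg := psl2_det Gg.
have bnd x : qf z (vact g x) <= 36 * qf z x.
  have [h1 _] := qnear_qf (vact g x) z0 qgy; have [_ h2] := qnear_qf x z0 qy.
  by rewrite qf_act // in h1; lra.
have Sg : g \in D.
  have : S g by split=> //; rewrite le_max bnd ?orbT.
  by rewrite DE.
have [_ /(_ Gg gn y)] := hA g; apply.
  by have [+ _] := US _ Uy; apply.
by have [+ _] := US _ Ugy; apply.
Qed.

End LocalFreeness.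

(** * The projection to the surface and its local inverses *)

Section SurfaceTopology.
Context {R : realType}.
Variable G : psl2_subgroup R.
Implicit Types (v w u : R * R) (z : R * R) (g h : 'M[R]_2).

Lemma moebiusN g z : moebius (- g) z = moebius g z.
Proof.
by rewrite /moebius !mxE /=; congr (_ / _, _ / _); ring.
Qed.

(** The inclusion of the half-plane as a total function, with default value i. *)
Definition plane_point z : cusped_plane G :=
  match pselect (uhp z) with
  | left h => exist _ (inl z) (asboolT h)
  | right _ => exist _ (inl (0, 1)) (asboolT ltr01)
  end.

Definition proj z : filled_surface G := orbit_of (plane_point z).

Lemma val_plane_point z : uhp z -> val (plane_point z) = inl z.
Proof. by rewrite /plane_point; case: pselect. Qed.

Lemma plane_pointE x z : val x = inl z -> uhp z /\ x = plane_point z.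
Proof.
case: x => x h /= xz; have z0 : uhp z by move: h; rewrite xz => /asboolP.
by split=> //; apply: val_inj; rewrite val_plane_point.
Qed.

Lemma orbit_ofP x y :
  orbit_of x = orbit_of y :> filled_surface G <->
  exists2 g, G g & ext_action g (val x) = val y.
Proof.
rewrite /orbit_of; split.
  by move/eqquotP => /asboolP.
by move=> h; apply/eqquotP/asboolP.
Qed.

Lemma projP z z' : uhp z -> uhp z' ->
  proj z = proj z' <-> exists2 g, G g & moebius g z = z'.
Proof.
move=> z0 z'0; rewrite /proj orbit_ofP !val_plane_point //=.
by split=> -[g Gg e]; exists g => //; [case: e|rewrite e].
Qed.

Lemma proj_act g z : G g -> uhp z -> proj (moebius g z) = proj z.
Proof.
move=> Gg z0; apply/esym/projP => //; last by exists g.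
exact: moebius_uhp (psl2_det Gg) z0.
Qed.

Lemma orbit_of_surj (x : filled_surface G) : exists y, x = orbit_of y.
Proof. by exists (repr x); rewrite /orbit_of reprK. Qed.

Lemma filled_surfaceP (x : filled_surface G) :
  (exists2 z, uhp z & x = proj z) \/ cusp_points G x.
Proof.
have [y ->] := orbit_of_surj x; case E : (val y) => [z|p].
  by left; have [z0 ->] := plane_pointE E; exists z.
by right; exists y => //; exists p.
Qed.

Lemma proj_not_cusp z : uhp z -> ~ cusp_points G (proj z).
Proof.
move=> z0 [y [p yp]] /orbit_ofP[g Gg].
by rewrite yp val_plane_point.
Qed.

Lemma image_in_surfaceE (A : set (R * R)) : A `<=` uhp ->
  image_in_surface A = proj @` A :> set (filled_surface G).
Proof.
move=> Au; apply/seteqP; split=> x.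
  by move=> [y [z Az /plane_pointE[_ ->]] <-]; exists z.
by move=> [z Az <-]; exists (plane_point z) => //; exists z => //;
  rewrite val_plane_point //; exact: Au.
Qed.

Lemma open_filledE (O : set (filled_surface G)) :
  open O = cusped_open (@orbit_of R G @^-1` O).
Proof. by []. Qed.

Lemma proj_cvg z : uhp z -> proj y @[y --> z] --> proj z.
Proof.
move=> z0 O; rewrite nbhsE => -[ B' [oB' B'z] B'B].
have /=[oP _] := oB'.
have : nbhs z (plane_part (@orbit_of R G @^-1` B')).
  apply: open_nbhs_nbhs; split=> //; exists (plane_point z) => //.
  exact: val_plane_point.
by apply: filterS => y [x Bx /plane_pointE[_ xy]]; apply: B'B; rewrite /proj -xy.
Qed.

Lemma open_moebius_image g (A : set (R * R)) : G g -> open A -> A `<=` uhp ->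
  open (moebius g @` A).
Proof.
move=> Gg oA Au; have dg := psl2_det Gg.
have -> : moebius g @` A = [set z | uhp z /\ A (moebius g^-1 z)].
  apply/seteqP; split=> [_ [z Az <-]|z [z0 Az]].
    by have z0 := Au _ Az; split; [exact: moebius_uhp|rewrite moebiusK].
  by exists (moebius g^-1 z) => //; rewrite moebiusVK.
rewrite openE => z [z0 Az]; apply: filterI; first exact: nbhs_uhp.
by apply: (moebius_cvg (det1V dg) z0); exact: open_nbhs_nbhs.
Qed.

(** The preimage is the union of the translates of A. The image contains no cusp, so the condition
    of [cusped_open] at cusps is vacuous. *)
Lemma open_proj_image (A : set (R * R)) : open A -> A `<=` uhp ->
  open (proj @` A).
Proof.
move=> oA Au; rewrite open_filledE; split.
  have -> : plane_part (@orbit_of R G @^-1` (proj @` A)) =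
      \bigcup_(g in psl2_carrier G) moebius g @` A.
    apply/seteqP; split=> z.
      move=> [x [y Ay yx] /plane_pointE[z0 xz]].
      have : proj y = proj z by rewrite yx xz.
      by move/(projP (Au _ Ay) z0) => [g Gg e]; exists g => //; exists y.
    move=> [g Gg [y Ay <-]]; exists (plane_point (moebius g y)).
      by exists y => //; rewrite -(proj_act Gg) //; exact: Au.
    by apply: val_plane_point; apply: moebius_uhp (psl2_det Gg) _; exact: Au.
  by apply: bigcup_open => g Gg; exact: open_moebius_image.
move=> x p [z Az zx] xp; exfalso; apply: (@proj_not_cusp z); first exact: Au.
by rewrite zx; exists x => //; exists p.
Qed.

Variable V : set (R * R).
Hypothesis hV : unimodular V.
Hypothesis VG : forall g v, G g -> V v -> V (vact g v).
Hypothesis cuspV : forall p, cusp G p <-> exists2 v, V v & slope v = p.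

(** One vector u0 of V controls the others: any u other than u0 and - u0 has [qf y u0 * qf y u >= 1]
    by the Gram identity. *)
Lemma qf_lower_bound z : uhp z -> exists2 e, 0 < e &
  \forall y \near z, forall u, V u -> e < qf y u.
Proof.
move=> z0; have [[u0 Vu0]|Vn] := pselect (V !=set0); last first.
  exists 1 => //; near=> y => u Vu; case: Vn; by exists u.
have [V0 _ VV] := hV.
have m0 := qf_gt0 z0 (V0 _ Vu0); set m := qf z u0 in m0.
(* m / 2 serves for u0 itself and 1 / (2 m) for the other vectors, as [qf y u0] is below 2 m near
   z. *)
exists (Num.min (m / 2) (m * 2)^-1); first by rewrite lt_min divr_gt0 // invr_gt0 mulr_gt0.
have c := @qf_cvg R z u0 z0.
have n1 : \forall y \near z, m / 2 < qf y u0.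
  by apply: (cvgr_gt _ c); rewrite ltr_pdivrMr // mulr_natr -/m; lra.
have n2 : \forall y \near z, qf y u0 < m * 2.
  by apply: (cvgr_lt _ c); rewrite -/m; lra.
have n3 : \forall y \near z, uhp y by exact: nbhs_uhp.
near=> y => u Vu.
have y0 : uhp y by near: y.
have q1 : m / 2 < qf y u0 by near: y.
have q2 : qf y u0 < m * 2 by near: y.
rewrite gt_min; case: (VV _ _ Vu0 Vu) => [->|->|d]; rewrite ?qfN ?q1 //.
have p0 := qf_gt0 y0 (V0 _ Vu0); have p1 := qf_gt0 y0 (V0 _ Vu).
have h : 1 <= qf y u0 * qf y u.
  rewrite qf_gram //; apply: ler_wpDl; first exact: sqr_ge0.
  by rewrite -(real_normK (num_real (vdet _ _))) -[leLHS](expr1n _ 2) lerXn2r ?nnegrE.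
have m2 : 0 < m * 2 by rewrite mulr_gt0.
apply/orP; right; rewrite -div1r ltr_pdivrMr // mulrC; apply: (le_lt_trans h).
by rewrite ltr_pM2r.
Unshelve. all: by end_near.
Qed.

Lemma horoball_slope v (s : R) : v != 0 -> 0 < s ->
  horoball (slope v) (slope_height v / s) = [set z | uhp z /\ qf z v < s].
Proof.
move=> v0 s0; have h0 := slope_height_gt0 v0.
apply/seteqP; split=> z [z0 h]; split=> //; have q0 := qf_gt0 z0 v0; move: h;
  by rewrite slope_height_qf // ltr_pM2l // ltf_pV2.
Qed.

(** Near z all forms exceed some e, so the horoballs [qf < e] along the orbit of the cusp stay away.
    This will exclude limits at the corners of a chart. *)
Lemma cusp_separated z (x : filled_surface G) : uhp z -> cusp_points G x ->
  exists A W, [/\ nbhs z A, nbhs x W & forall y, A y -> uhp y -> ~ W (proj y)].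
Proof.
have [V0 _ _] := hV.
move=> z0 [c [p cp] <-{x}]; have [e e0 He] := qf_lower_bound z0.
have pc : cusp G p by move: (valP c); rewrite cp => /asboolP.
have /cuspV[v Vv vp] := pc.
pose W := [set x : filled_surface G | x = orbit_of c \/
  exists2 y, x = proj y & exists g, [/\ G g, uhp y & qf y (vact g v) < e]].
exists [set y | forall u, V u -> e < qf y u], W; split=> //; last first.
  move=> y hy y0 [E|[y' E [g [Gg y'0 q]]]].
    by apply: (proj_not_cusp y0); rewrite E; exists c => //; exists p.
  have /projP[//|//|h Gh e'] := E.
  have /hy : V (vact (h^-1 * g) v).
    by apply: VG => //; apply: psl2_mul => //; exact: psl2_inv.
  rewrite -(qf_act _ (psl2_det Gh)) // e' vactM vactVK ?(psl2_det Gh) //.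
  by move/(lt_trans q); rewrite ltxx.
apply: open_nbhs_nbhs; split; last by left.
rewrite open_filledE; split.
  have -> : plane_part (@orbit_of R G @^-1` W) =
      [set y | uhp y /\ exists2 g, G g & qf y (vact g v) < e].
    apply/seteqP; split=> y.
      move=> [x hx /plane_pointE[y0 xy]]; split=> //.
      move: hx; rewrite xy -/(proj y) => -[E|[y' E [g [Gg y'0 q]]]].
        by case: (proj_not_cusp y0); rewrite /proj E; exists c => //; exists p.
      have /projP[//|//|h Gh e'] := E.
      exists (h^-1 * g); first by apply: psl2_mul => //; exact: psl2_inv.
      by rewrite -(qf_act _ (psl2_det Gh)) // e' vactM vactVK ?(psl2_det Gh).
    move=> [y0 [g Gg q]]; exists (plane_point y); last exact: val_plane_point.
    by right; exists y => //; exists g.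
  rewrite openE => y [y0 [g Gg q]]; apply: filterI; first exact: nbhs_uhp.
  have := @qf_cvg R y (vact g v) y0 => /cvgr_lt/(_ _ q).
  by apply: filterS => y' q'; exists g.
move=> x q hx xq.
have [g Gg gp] : exists2 g, G g & boundary_action g p = q.
  case: hx => [/esym/orbit_ofP[g Gg]|[y E [_ [_ y0 _]]]].
    by rewrite cp xq /= => -[E]; exists g.
  by case: (proj_not_cusp y0); rewrite -E; exists x => //; exists q.
have gv0 : vact g v != 0 by rewrite vact_eq0 ?(psl2_det Gg) ?V0.
exists (slope_height (vact g v) / e).
  by rewrite divr_gt0 // slope_height_gt0.
have -> : q = slope (vact g v) by rewrite slope_act ?(psl2_det Gg) ?V0 // vp.
rewrite horoball_slope // => y [y0 hy]; exists (plane_point y).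
  by right; exists y => //; exists g.
exact: val_plane_point.
Qed.

Variables (v0 w0 : R * R).
Hypothesis evw : edge V v0 w0.
Hypothesis tfG : torsion_free G.

Lemma local_section z : uhp z -> exists O s,
  [/\ open O, O (proj z), s (proj z) = z,
      forall x, O x -> uhp (s x) /\ proj (s x) = x &
      forall x, O x -> s y @[y --> x] --> s x].
Proof.
move=> z0; have [U [oU Uz Uu Uf]] := free_nbhs hV VG tfG evw z0.
pose s (x : filled_surface G) : R * R := xget z [set y | U y /\ proj y = x].
have sP y : U y -> s (proj y) = y.
  move=> Uy; rewrite /s; case: xgetP => [y' _ [Uy' E]|/(_ y)]; last by case.
  have /projP[||g Gg e] := E; [exact: Uu|exact: Uu|].
  by have := Uf g y' Gg Uy'; rewrite e => /(_ Uy)[] gE; rewrite -e gE ?moebiusN moebius1.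
exists (proj @` U), s; split.
- exact: open_proj_image.
- by exists z.
- exact: sP.
- by move=> _ [y Uy <-]; rewrite sP //; split=> //; exact: Uu.
- move=> _ [y Uy <-]; rewrite sP // => B; rewrite (nbhsE y) => -[B' [oB' B'y] B'B].
  have : nbhs (proj y) (proj @` (U `&` B')).
    apply: open_nbhs_nbhs; split; last by exists y.
    by apply: open_proj_image; [exact: openI|move=> ? [/Uu]].
  by apply: filterS => _ [y' [Uy' B'y'] <-]; apply: B'B; rewrite /= sP.
Qed.

End SurfaceTopology.

Arguments plane_point {R} G z.
Arguments proj {R} G z.

(** * Continuity on subsets, connectedness and convexity *)

Section ContinuityOn.
Implicit Types (S T U : topologicalType).

Definition cont_on S T (A : set S) (f : S -> T) :=
  forall x, A x -> f @ within A (nbhs x) --> f x.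

Lemma cont_onP S T (A : set S) (f : S -> T) :
  {within A, continuous f} <-> cont_on A f.
Proof. exact: subspace_continuousP. Qed.

Lemma cont_onE S T (A : set S) (f : S -> T) : cont_on A f <->
  forall x N, A x -> nbhs (f x) N -> \forall y \near x, A y -> N (f y).
Proof.
split=> H x; first by move=> N Ax nN; have := H x Ax N nN.
by move=> Ax N nN; exact: H.
Qed.

Lemma cont_on_sub S T (A B : set S) (f : S -> T) : B `<=` A ->
  cont_on A f -> cont_on B f.
Proof.
move=> BA /cont_onE h; apply/cont_onE => x N Bx nN.
by have := h x N (BA _ Bx) nN; apply: filterS => y h' /BA.
Qed.

Lemma cont_on_comp S T U (A : set S) (B : set T) (f : S -> T) (h : T -> U) :
  (forall x, A x -> B (f x)) -> cont_on A f -> cont_on B h -> cont_on A (h \o f).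
Proof.
move=> AB /cont_onE cf /cont_onE ch; apply/cont_onE => x N Ax nN.
have := cf x _ Ax (ch (f x) N (AB _ Ax) nN).
by apply: filterS => y h1 Ay; apply: h1 => //; exact: AB.
Qed.

Lemma cont_on_at S T (A : set S) (f : S -> T) :
  (forall x, A x -> f y @[y --> x] --> f x) -> cont_on A f.
Proof. by move=> h x Ax; apply: cvg_within_filter; exact: h. Qed.

(** The two local hypotheses make the truth set of P relatively open and closed in A. *)
Lemma connected_ind S (A : set S) (P : S -> Prop) a : connected A -> A a -> P a ->
  (forall x, A x -> P x -> \forall y \near x, A y -> P y) ->
  (forall x, A x -> ~ P x -> \forall y \near x, A y -> ~ P y) ->
  forall x, A x -> P x.
Proof.
move=> cA Aa Pa h1 h2.
pose C := interior [set y | A y -> P y]; pose D := interior [set y | A y -> ~ P y].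
have E1 : A `&` P = A `&` C.
  apply/seteqP; split=> x [Ax]; last by move=> /interior_subset /(_ Ax).
  by move=> Px; split=> //; exact: h1.
have E2 : A `&` P = A `&` ~` D.
  apply/seteqP; split=> x [Ax Px]; split=> //.
    by move=> /interior_subset /(_ Ax); exact.
  by apply: contrapT => nP; apply: Px; exact: h2.
have : A `&` P = A.
  apply: cA; first by exists a.
    by exists C => //; exact: open_interior.
  by exists (~` D) => //; apply: open_closedC; exact: open_interior.
by move=> E x; rewrite -[in A x]E => -[].
Qed.

End ContinuityOn.

Section Convexity.
Context {R : realType}.
Implicit Types (p q : R * R) (r : R).

Definition seg p q r : R * R :=
  ((1 - r) * p.1 + r * q.1, (1 - r) * p.2 + r * q.2).

Definition convex_set2 (A : set (R * R)) :=
  forall p q r, A p -> A q -> 0 <= r <= 1 -> A (seg p q r).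

Lemma seg_continuous p q : continuous (seg p q).
Proof. by move=> r; apply: cvg_to_pair; cvg_arith. Qed.

Lemma seg0 p q : seg p q 0 = p.
Proof. by case: p => a b; rewrite /seg /= subr0 !mul1r !mul0r !addr0. Qed.

Lemma seg1 p q : seg p q 1 = q.
Proof. by case: q => a b; rewrite /seg /= subrr !mul1r !mul0r !add0r. Qed.

Lemma convex_connected A : convex_set2 A -> connected A.
Proof.
move=> cA; have [->|/set0P[a Aa]] := eqVneq A set0; first exact: connected0.
have -> : A = \bigcup_(b in A) (seg a b @` `[0, 1]).
  apply/seteqP; split=> x.
    move=> Ax; exists x => //; exists 1; last exact: seg1.
    by rewrite /= in_itv /= ler01 lexx.
  by move=> [b Ab [r]]; rewrite /= in_itv /= => hr <-; exact: cA.
apply: bigcup_connected.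
  exists a => b Ab; exists 0; last exact: seg0.
  by rewrite /= in_itv /= ler01 lexx.
move=> b Ab; apply: connected_continuous_connected.
  exact: segment_connected.
by apply: continuous_subspaceT; exact: seg_continuous.
Qed.

(** Compactness of an interval, for additive properties of subintervals that hold for short ones.
    The proof takes the supremum of the right ends reached from a. *)
Lemma interval_additive_ind (P : R -> R -> Prop) (a b : R) : a <= b ->
  (forall s t u, a <= s -> s <= t -> t <= u -> u <= b -> P s t -> P t u -> P s u) ->
  (forall x, a <= x <= b -> exists2 e, 0 < e & forall s t, a <= s -> s <= t ->
     t <= b -> x - e < s -> t < x + e -> P s t) ->
  P a b.
Proof.
move=> ab Padd Ploc.
have Paa : P a a.
  have [|e e0] := Ploc a; first by rewrite lexx.
  by apply=> //; rewrite ?ltrDl // gtrBl.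
pose S := [set t | a <= t <= b /\ P a t].
have hS : has_sup S by split; [exists a; split; rewrite ?lexx|exists b => t [/andP[]]].
have am : a <= sup S by apply: ub_le_sup; [exact: hS.2|split; rewrite ?lexx].
have mb : sup S <= b by apply: ge_sup; [exact: hS.1|move=> t [/andP[]]].
have [|e e0 He] := Ploc (sup S); first by rewrite am mb.
have [t [/andP[at_ tb] Pt] tm] := sup_adherent e0 hS.
have tS : t <= sup S by apply: ub_le_sup; [exact: hS.2|split; rewrite ?at_].
have [bm|mb'] := leP b (sup S).
  apply: (Padd a t b) => //; apply: He => //.
  by apply: (le_lt_trans bm); rewrite ltrDl.
pose t' := Num.min b (sup S + e / 2).
have e2 : 0 < e / 2 by rewrite divr_gt0.
have e2e : e / 2 < e by lra.
have t'm : sup S < t' by rewrite /t' lt_min mb' ltrDl.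
have t'b : t' <= b by rewrite /t' ge_min lexx.
have at' : a <= t' by apply: le_trans am _; exact: ltW.
have tt' : t <= t' by apply: le_trans tS _; exact: ltW.
have t'e : t' < sup S + e by rewrite /t' gt_min ltrD2l e2e orbT.
have : t' <= sup S.
  apply: ub_le_sup; first exact: hS.2.
  split; first by rewrite at'.
  by apply: (Padd a t t') => //; exact: He.
by rewrite leNgt t'm.
Qed.

End Convexity.

(** * Lifting maps from convex sets to the half-plane *)

Section Lifting.
Context {R : realType}.
Variables (G : psl2_subgroup R) (V : set (R * R)).
Hypothesis hV : unimodular V.
Hypothesis VG : forall g v, G g -> V v -> V (vact g v).
Variables (v0 w0 : R * R).
Hypothesis evw : edge V v0 w0.
Hypothesis tfG : torsion_free G.

Definition lift_on (S : topologicalType) (A : set S) (f : S -> filled_surface G)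
    (h : S -> R * R) :=
  cont_on A h /\ forall x, A x -> uhp (h x) /\ proj G (h x) = f x.

Lemma lift_on_sub (S : topologicalType) (A B : set S) f h : B `<=` A ->
  @lift_on S A f h -> lift_on B f h.
Proof.
by move=> BA [c H]; split; [exact: cont_on_sub c|move=> x /BA /H].
Qed.

(** The agreement set is open by [free_nbhs], as nearby points with the same image coincide, and
    closed because the plane is Hausdorff. *)
Lemma lift_unique (S : topologicalType) (A : set S) f h1 h2 a : connected A ->
  @lift_on S A f h1 -> lift_on A f h2 -> A a -> h1 a = h2 a ->
  forall x, A x -> h1 x = h2 x.
Proof.
move=> cA [/cont_onE c1 H1] [/cont_onE c2 H2] Aa ea.
apply: (connected_ind cA Aa ea) => x Ax.
  move=> e; have [z0 zE] := H1 _ Ax.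
  have [U [oU Uz Uu Uf]] := free_nbhs hV VG tfG evw z0.
  have n1 := c1 x U Ax (open_nbhs_nbhs (conj oU Uz)).
  have n2 : \forall y \near x, A y -> U (h2 y).
    by apply: c2 => //; rewrite -e; exact: open_nbhs_nbhs.
  near=> y => Ay.
  have U1 : U (h1 y) by move: Ay; near: y.
  have U2 : U (h2 y) by move: Ay; near: y.
  have [y1 E1] := H1 _ Ay; have [y2 E2] := H2 _ Ay.
  have /projP[//|//|g Gg ge] : proj G (h1 y) = proj G (h2 y) by rewrite E1 E2.
  have := Uf g _ Gg U1; rewrite ge => /(_ U2)[] gE; move: ge; rewrite gE.
    by rewrite moebius1.
  by rewrite moebiusN moebius1.
move=> /eqP ne.
have hT : hausdorff_space (R * R)%type by exact: norm_hausdorff.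
move: hT; rewrite open_hausdorff => /(_ _ _ ne)[[B C] /=[/set_mem Bz /set_mem Cz] [oB oC /eqP BC]].
have n1 := c1 x B Ax (open_nbhs_nbhs (conj oB Bz)).
have n2 := c2 x C Ax (open_nbhs_nbhs (conj oC Cz)).
near=> y => Ay e.
have B1 : B (h1 y) by move: Ay; near: y.
have C1 : C (h2 y) by move: Ay; near: y.
have : (B `&` C) (h1 y) by split=> //; rewrite e.
by rewrite BC.
Unshelve. all: by end_near.
Qed.

(** Lifts may be moved by G, which is how a lift is adjusted to a prescribed value at one point. *)
Lemma lift_act (S : topologicalType) (A : set S) f h g : G g ->
  @lift_on S A f h -> lift_on A f (fun x => moebius g (h x)).
Proof.
move=> Gg [c H]; have dg := psl2_det Gg; split.
  apply: (cont_on_comp (B := uhp)) c _; first by move=> x /H[].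
  by apply: cont_on_at => z z0; exact: moebius_cvg.
by move=> x /H[z0 <-]; split; [exact: moebius_uhp|exact: proj_act].
Qed.

(** An element of G moves the second lift so that both agree at one point of the overlap, hence on
    the whole connected overlap. *)
Lemma lift_glue (S : topologicalType) (A B : set S) f h1 h2 : closed A -> closed B ->
  connected (A `&` B) -> A `&` B !=set0 ->
  @lift_on S A f h1 -> lift_on B f h2 -> exists h, lift_on (A `|` B) f h.
Proof.
move=> clA clB cAB [a [Aa Ba]] L1 L2.
have [z1 E1] := L1.2 _ Aa; have [z2 E2] := L2.2 _ Ba.
have /projP[//|//|g Gg ge] : proj G (h2 a) = proj G (h1 a) by rewrite E1 E2.
have {}L2 := lift_act Gg L2; set h3 := fun x => moebius g (h2 x) in L2.
have agree x : A x -> B x -> h1 x = h3 x.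
  move=> Ax Bx; apply: (lift_unique cAB _ _ (conj Aa Ba)) (conj Ax Bx) => //.
  - exact: lift_on_sub L1.
  - exact: lift_on_sub L2.
exists (fun x => if pselect (A x) then h1 x else h3 x); split; last first.
  by move=> x [Ax|Bx]; case: pselect => // h; [exact: L1.2|exact: L1.2|exact: L2.2].
have [/cont_onE c1 _] := L1; have [/cont_onE c2 _] := L2.
have off (C : set S) x : closed C -> ~ C x -> \forall y \near x, ~ C y.
  by move=> clC nC; apply: open_nbhs_nbhs; split=> //; exact: closed_openC.
have h3E x : B x -> (if pselect (A x) then h1 x else h3 x) = h3 x.
  by move=> Bx; case: pselect => // Ax; exact: agree.
apply/cont_onE => x N ABx nN.
have n1 : \forall y \near x, A y -> N (h1 y).
  have [Ax|nA] := pselect (A x); last by apply: filterS (off _ _ clA nA).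
  by apply: c1 => //; move: nN; case: pselect.
have n2 : \forall y \near x, B y -> N (h3 y).
  have [Bx|nB] := pselect (B x); last by apply: filterS (off _ _ clB nB).
  by apply: c2 => //; move: nN; rewrite h3E.
near=> y.
have m1 : A y -> N (h1 y) by near: y.
have m2 : B y -> N (h3 y) by near: y.
by case: pselect => [Ay _|nA [//|By]]; [exact: m1|exact: m2].
Unshelve. all: by end_near.
Qed.

Lemma local_lift (S : topologicalType) (A : set S) f k : cont_on A f -> A k ->
  ~ cusp_points G (f k) -> exists2 N, nbhs k N & exists h, @lift_on S (A `&` N) f h.
Proof.
move=> /cont_onE cf Ak; case: (filled_surfaceP (f k)) => // -[z z0 fk] _.
have [W [s [oW Wz sz sP sc]]] := local_section hV VG evw tfG z0.
have n1 : \forall y \near k, A y -> W (f y).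
  by apply: cf => //; rewrite fk; exact: open_nbhs_nbhs.
exists [set y | A y -> W (f y)] => //; exists (s \o f); split; last first.
  by move=> x [Ax /(_ Ax)/sP].
apply: (cont_on_comp (B := W)); first by move=> x [Ax /(_ Ax)].
  by apply: cont_on_sub (proj2 (cont_onE _ _) cf) => x [].
by apply: cont_on_at => x; exact: sc.
Qed.

(** A level line of an affine function cuts a convex set into two closed pieces with convex, hence
    connected, overlap, so [lift_glue] applies. An empty piece is treated apart. *)
Lemma lift_cut (K : set (R * R)) f (l : R * R -> R) (t : R) :
  closed K -> convex_set2 K -> continuous l ->
  (forall p q r, l (seg p q r) = (1 - r) * l p + r * l q) ->
  (exists h, lift_on (K `&` [set k | l k <= t]) f h) ->
  (exists h, lift_on (K `&` [set k | t <= l k]) f h) -> exists h, lift_on K f h.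
Proof.
move=> clK cK cl lE [h1 L1] [h2 L2].
set A := _ `&` _ in L1; set B := _ `&` _ in L2.
have KAB : K `<=` A `|` B.
  by move=> k Kk; have [h|h] := leP (l k) t; [left|right; split=> //; exact: ltW].
have [A0|/set0P[p [Kp pt]]] := eqVneq A set0.
  by exists h2; apply: lift_on_sub L2 => k /KAB; rewrite A0 => -[].
have [B0|/set0P[q [Kq qt]]] := eqVneq B set0.
  by exists h1; apply: lift_on_sub L1 => k /KAB; rewrite B0 => -[].
have clA : closed A by apply: closedI => //; apply: (closed_comp (f := l)) (@closed_le R t) => ? _; exact: cl.
have clB : closed B by apply: closedI => //; apply: (closed_comp (f := l)) (@closed_ge R t) => ? _; exact: cl.
have cAB : connected (A `&` B).
  apply: convex_connected => x y r [[Kx xt] [_ tx]] [[Ky yt] [_ ty]] hr.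
  have Ks := cK _ _ _ Kx Ky hr; have /andP[r0 r1] := hr.
  by split; split=> //=; rewrite lE; move: xt tx yt ty => /= *; nra.
have [|h L] := lift_glue clA clB cAB _ L1 L2; last first.
  by exists h; exact: lift_on_sub L.
rewrite /= in pt qt.
have [e|ne] := eqVneq (l p) (l q).
  by exists p; split; split=> //=; rewrite e.
have qp : 0 < l q - l p by rewrite subr_gt0 lt_neqAle ne (le_trans pt qt).
pose r := (t - l p) / (l q - l p).
have hr : 0 <= r <= 1 by rewrite divr_ge0 ?ler_pdivrMr //; lra.
have lr : l (seg p q r) = t by rewrite lE /r; field; rewrite gt_eqF.
by exists (seg p q r); split; split=> /=; rewrite ?lr //; exact: cK.
Qed.

(** Simple connectedness by subdivision of the unit square. Small rectangles have local lifts;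
    [interval_additive_ind] stacks them into thin vertical strips, then joins the strips. *)
Lemma lift_exists (K : set (R * R)) f : closed K -> convex_set2 K ->
  (forall k, K k -> 0 <= k.1 <= 1 /\ 0 <= k.2 <= 1) ->
  cont_on K f -> (forall k, K k -> ~ cusp_points G (f k)) ->
  exists h, lift_on K f h.
Proof.
move=> clK cK Kbox cf nc.
pose S (l : R * R -> R) (a b : R) : set (R * R) := [set k | a <= l k <= b].
have clS (l : R * R -> R) a b : continuous l -> closed (S l a b).
  move=> cl; have -> : S l a b = l @^-1` [set x | a <= x] `&` l @^-1` [set x | x <= b].
    by apply/seteqP; split=> k; [move=> /andP[]|move=> [h1 h2]; apply/andP].
  apply: closedI; [apply: closed_comp (@closed_ge R a)|apply: closed_comp (@closed_le R b)];
    by move=> ? _; exact: cl.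
have cvS (l : R * R -> R) a b : (forall p q r, l (seg p q r) = (1 - r) * l p + r * l q) ->
    convex_set2 (S l a b).
  move=> lE p q r /andP[p1 p2] /andP[q1 q2] /andP[r0 r1].
  by rewrite /S /= lE; apply/andP; split; nra.
have cfst : continuous (fun k : R * R => k.1) by move=> k; exact: cvg_fst.
have csnd : continuous (fun k : R * R => k.2) by move=> k; exact: cvg_snd.
pose rect a b c d := K `&` S fst a b `&` S snd c d.
pose Q a b c d := exists h, lift_on (rect a b c d) f h.
have clr a b c d : closed (rect a b c d) by apply: closedI; [apply: closedI|]; auto.
have cvr a b c d : convex_set2 (rect a b c d).
  move=> p q r [[? ?] ?] [[? ?] ?] hr; split; [split|]; [exact: cK|..];
  by apply: cvS hr.
have Qsub a b c d (A : set (R * R)) : A `<=` rect a b c d -> Q a b c d ->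
    exists h, lift_on A f h.
  by move=> Asub [h Lh]; exists h; exact: lift_on_sub Lh.
have Qv a b c t d : Q a b c t -> Q a b t d -> Q a b c d.
  move=> Q1 Q2; apply: (lift_cut (l := snd) (t := t)) => //.
    by apply: Qsub Q1 => k [[Kk /andP[k1 k2]] /= kt]; split=> //; rewrite /S /= k1.
  by apply: Qsub Q2 => k [[Kk /andP[k1 k2]] /= kt]; split=> //; rewrite /S /= kt.
have Qh a t b c d : Q a t c d -> Q t b c d -> Q a b c d.
  move=> Q1 Q2; apply: (lift_cut (l := fst) (t := t)) => //.
    by apply: Qsub Q1 => k [[[Kk /andP[k1 k2]] k3] /= kt]; split=> //; split=> //; rewrite /S /= k1.
  by apply: Qsub Q2 => k [[[Kk /andP[k1 k2]] k3] /= kt]; split=> //; split=> //; rewrite /S /= kt.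
have loc x y : exists2 e, 0 < e & Q (x - e) (x + e) (y - e) (y + e).
  have [N nN [h Lh]] : exists2 N, nbhs (x, y) N & exists h, lift_on (K `&` N) f h.
    have [Kk|nK] := pselect (K (x, y)); first by apply: local_lift => //; exact: nc.
    exists (~` K); first by apply: open_nbhs_nbhs; split=> //; exact: closed_openC.
    by exists (fun=> (0, 1)); split; rewrite setICr // => k [].
  have /nbhs_ballP[e /= e0 Ne] := nN.
  exists (e / 2); first by rewrite divr_gt0.
  exists h; apply: lift_on_sub Lh => k [[Kk /andP[k1 k2]] /andP[k3 k4]]; split=> //.
  by apply: Ne; split; rewrite /ball /= ltr_norml; apply/andP; split; move: k1 k2 k3 k4 => /= *; lra.
have strip x : exists2 e, 0 < e & Q (x - e) (x + e) 0 1.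
  pose P s t := exists2 e, 0 < e & Q (x - e) (x + e) s t.
  apply: (interval_additive_ind (P := P)) => //.
    move=> s t u _ st tu _ [e1 e10 Q1] [e2 e20 Q2].
    exists (Num.min e1 e2); first by rewrite lt_min e10.
    have [m1 m2] : Num.min e1 e2 <= e1 /\ Num.min e1 e2 <= e2.
      by rewrite !ge_min !lexx orbT.
    by apply: (Qv _ _ _ t); [apply: Qsub Q1|apply: Qsub Q2];
      move=> k [[Kk /andP[k1 k2]] k3]; split=> //; split=> //; apply/andP; split;
      move: k1 k2 => /= *; lra.
  move=> y _; have [e e0 Qe] := loc x y; exists e => // s t _ _ _ ys ty.
  exists e => //; apply: Qsub Qe => k [k1 /andP[k2 k3]]; split=> //.
  by apply/andP; split; move: k2 k3 => /= *; lra.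
have : Q 0 1 0 1.
  apply: (interval_additive_ind (P := fun s t => Q s t 0 1)) => //.
    by move=> s t u _ _ _ _; exact: Qh.
  move=> x _; have [e e0 Qe] := strip x; exists e => // s t _ _ _ xs tx.
  apply: Qsub Qe => k [[Kk /andP[k2 k3]] k1]; split=> //; split=> //.
  by apply/andP; split; move: k2 k3 => /= *; lra.
by apply: Qsub => k Kk; have [k1 k2] := Kbox _ Kk.
Qed.

End Lifting.

(** * The faces of the packing graph *)

Section Frames.
Context {R : realType}.
Implicit Types (v w u : R * R) (z : R * R) (g h : 'M[R]_2).

Definition frame v w : 'M[R]_2 :=
  \matrix_(i, j) (if i == 0 then if j == 0 then v.1 else w.1
                  else if j == 0 then v.2 else w.2).

Lemma frame_det v w : \det (frame v w) = vdet v w.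
Proof. by rewrite det2E !mxE /= /vdet mulrC (mulrC w.1) mulrC. Qed.

Lemma vact_frame v w u : vact (frame v w) u = u.1 *: v + u.2 *: w.
Proof.
by rewrite /vact !mxE /=; apply: injective_projections => /=;
  rewrite mulrC (mulrC _ u.2).
Qed.

(** Source of the sample points used below. In a basis that starts with v, the prescribed values
    mean Im z = 1 / a and Re z = - b / (a det(v, w)). *)
Lemma point_exists v w (a b : R) : vdet v w != 0 -> 0 < a ->
  exists z, [/\ uhp z, qf z v = a & bf z v w = b].
Proof.
move=> d a0; pose M := frame v ((vdet v w)^-1 *: w).
have dM : \det M = 1 by rewrite frame_det vdetZr mulVf.
pose z := (- b / (vdet v w * a), a^-1) : R * R.
have z0 : uhp z by rewrite /uhp /= invr_gt0.
have Me1 : vact M (1, 0) = v by rewrite vact_frame scale1r scale0r addr0.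
have Me2 : vact M (0, vdet v w) = w.
  by rewrite vact_frame scale0r add0r scalerA divff // scale1r.
exists (moebius M z); split; first exact: moebius_uhp.
  by rewrite -[v in qf _ v]Me1 qf_act // /qf /bf /=; field; rewrite gt_eqF.
rewrite -[v in bf _ v]Me1 -[w in bf _ _ w]Me2 bf_act // /bf /=; field.
by rewrite d gt_eqF.
Qed.

(** The values on a basis determine the form, and its coefficients 1 / y and - x / y determine the
    point. *)
Lemma form_inj z z' v w : vdet v w != 0 -> uhp z -> uhp z' ->
  qf z v = qf z' v -> bf z v w = bf z' v w -> qf z w = qf z' w -> z = z'.
Proof.
move=> d z0 z'0 e1 e2 e3.
have E x y : bf z x y = bf z' x y.
  apply: (mulfI (mulf_neq0 d d)).
  have H z1 : vdet v w * vdet v w * bf z1 x y = bf z1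
      (vdet x w *: v + vdet v x *: w) (vdet y w *: v + vdet v y *: w).
    by rewrite -!vdet_expand bfZr bfZl mulrA.
  rewrite !H !(bfDl, bfDr, bfZl, bfZr).
  by rewrite -!/(qf _ _) e1 e3 e2 !(bfC _ w v) e2.
have := E (1, 0) (1, 0); have := E (1, 0) (0, 1); move: z0 z'0; rewrite /uhp /bf /=.
case: z {e1 e2 e3 E} => x y; case: z' => x' y' /= y0 y'0.
rewrite !(mulr0, mul0r, subr0, mulr1, mul1r, addr0, sub0r) => h1 h2.
have yy : y = y' by apply: invr_inj; rewrite -[LHS]mul1r h2 mul1r.
by move: h1; rewrite yy => /mulIf; rewrite invr_eq0 gt_eqF // => /(_ isT)/oppr_inj->.
Qed.

End Frames.

(** * From packings to sets of vectors *)

Section PackingVectors.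
Context {R : realType}.
Variable G : psl2_subgroup R.
Implicit Types (v w u : R * R) (z : R * R) (g h : 'M[R]_2) (t : option R -> R).

Lemma cusp_act g p : G g -> cusp G p -> cusp G (boundary_action g p).
Proof.
move=> Gg [h [Gh h1 hN trh hp]]; have dg := psl2_det Gg; have dh := psl2_det Gh.
have GV := psl2_inv Gg; have ug := unit_det1 dg.
have hE x : g * h * g^-1 = x -> h = g^-1 * x * g.
  by move=> <-; rewrite !mulrA mulVr // mul1r -mulrA mulVr // mulr1.
exists (g * h * g^-1); split.
- by apply: psl2_mul => //; exact: psl2_mul.
- by move/hE; rewrite mulr1 mulVr.
- by move/hE; rewrite mulrN1 mulNr mulVr.
- by rewrite -[\tr _]/(\tr (g *m h *m g^-1)) mxtrace_mulC mulmxA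
    -[_ *m g]/(g^-1 * g) mulVr // mul1mx.
- by rewrite -boundary_actionM ?det1M ?det1V // -mulrA mulVr // mulr1
    boundary_actionM // hp.
Qed.

Definition packing_vectors t : set (R * R) :=
  [set v | [/\ v != 0, cusp G (slope v) & t (slope v) = slope_height v]].

Lemma slope_height_inj v w : v != 0 -> w != 0 -> slope v = slope w ->
  slope_height v = slope_height w -> w = v \/ w = - v.
Proof.
case: v => a c; case: w => b d v0 w0; rewrite /slope /slope_height /=.
have [c0|c0] := eqVneq c 0; have [d0|d0] := eqVneq d 0 => //.
  move=> _ /eqP; rewrite eqf_sqr c0 d0 => /orP[]/eqP->; first by left.
  by right; apply: injective_projections => /=; rewrite ?opprK ?oppr0.
move=> [e] /eqP; rewrite eqf_sqr => /orP[]/eqP h.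
  by left; rewrite -h in e *; congr (_, _); apply: (mulIf (invr_neq0 c0)).
right; apply: injective_projections => /=; last by rewrite h opprK.
by apply: (mulIf (invr_neq0 d0)); rewrite -e h invrN mulrN mulNr.
Qed.

Section FromPacking.
Variable t : option R -> R.
Hypothesis ht : horocycle_packing G t.
Let V := packing_vectors t.

Lemma packing_vectors_cusp p : cusp G p <-> exists2 v, V v & slope v = p.
Proof.
have [tpos _ _ _] := ht.
split=> [cp|[v [_ cv _] <-] //]; have tp := tpos _ cp.
have s0 : Num.sqrt (t p) != 0 by rewrite gt_eqF // sqrtr_gt0.
case: p cp tp s0 => [x|] cp tp s0.
  exists (x * Num.sqrt (t (Some x)), Num.sqrt (t (Some x))).
    rewrite /V /packing_vectors /= /slope /slope_height /= (negPf s0) mulfK //.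
    by split=> //; [rewrite xpair_eqE /= (negPf s0) andbF|rewrite sqr_sqrtr // ltW].
  by rewrite /slope /= (negPf s0) mulfK.
exists (Num.sqrt (t None), 0); last by rewrite /slope /= eqxx.
rewrite /V /packing_vectors /= /slope /slope_height /= eqxx.
by split=> //; [rewrite xpair_eqE /= (negPf s0)|rewrite sqr_sqrtr // ltW].
Qed.

(** One point of the horocycle is enough: by equivariance its image lies on the horocycle at
    [slope (vact g v)], and the form of [vact g v] is 1 there, which fixes the level. *)
Lemma packing_vectors_act g v : G g -> V v -> V (vact g v).
Proof.
have [_ teq _ _] := ht.
move=> Gg [v0 cv tv]; have dg := psl2_det Gg.
have gv0 : vact g v != 0 by rewrite vact_eq0.
have sE := slope_act dg v0; split=> //; first by rewrite sE; exact: cusp_act.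
have [w dw] : exists w, vdet v w != 0.
  have [e|] := eqVneq v.1 0; last by exists (0, 1); rewrite /vdet /= mulr1 mulr0 subr0.
  exists (1, 0); rewrite /vdet /= mulr0 mulr1 sub0r oppr_eq0.
  by apply: contra_neq v0 => e'; exact: injective_projections.
have [z [z0 qz _]] := point_exists 0 dw (@ltr01 R).
have : horocycle (slope (vact g v)) (t (slope (vact g v))) (moebius g z).
  rewrite sE -teq //; exists z => //; rewrite tv horocycleE //.
by move=> [gz0]; rewrite slope_height_qf // qf_act // qz divr1 => <-.
Qed.

(** The packing conditions speak of cusps of the surface. Upstairs they separate any two horoballs
    with different centres, whether these lie in one orbit or in two. *)
Lemma packing_disjoint v w z : V v -> V w -> slope v <> slope w -> uhp z ->
  qf z v < 1 -> qf z w < 1 -> False.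
Proof.
have [_ _ tself tdisj] := ht; move=> Vv Vw vw z0 qv qw.
have [v0 cv tv] := Vv; have [w0 cw tw] := Vw.
have hbE x : V x -> horoball (slope x) (t (slope x)) = [set z | uhp z /\ qf z x < 1].
  by move=> [x0 _ ->]; exact: horoballE.
have [[g Gg gvw]|h] := pselect (exists2 g, G g & boundary_action g (slope v) = slope w).
  have dg := psl2_det Gg; apply: vw; rewrite -gvw; apply/esym.
  apply: tself => //; exists z; rewrite hbE //; split=> //.
  have [gv0 _ tgv] := packing_vectors_act Gg Vv.
  have [e|e] : w = vact g v \/ w = - vact g v.
    by apply: slope_height_inj => //; rewrite ?slope_act // -tgv slope_act // gvw tw.
  - exists (moebius g^-1 z); last by rewrite moebiusVK.
    split; first by apply: moebius_uhp => //; exact: det1V.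
    by rewrite -(qf_act v dg) ?moebiusVK -?e //; apply: moebius_uhp => //; exact: det1V.
  - exists (moebius g^-1 z); last by rewrite moebiusVK.
    split; first by apply: moebius_uhp => //; exact: det1V.
    rewrite -(qf_act v dg) ?moebiusVK //; last by apply: moebius_uhp => //; exact: det1V.
    by rewrite -qfN -e.
have hd := tdisj _ _ cv cw (fun g Gg e => h (ex_intro2 _ _ g Gg e)).
have : (@image_in_surface _ G (horoball (slope v) (t (slope v))) `&`
        image_in_surface (horoball (slope w) (t (slope w)))) (proj G z).
  by split; rewrite hbE // image_in_surfaceE; try (by move=> ? []); exists z.
by rewrite hd.
Qed.

Lemma packing_vectors_unimodular : unimodular V.
Proof.
split; first by move=> v [].
  by move=> v [v0 cv tv]; split; rewrite ?oppr_eq0 ?slopeN ?slope_heightN.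
move=> v w Vv Vw; have [v0 cv tv] := Vv; have [w0 cw tw] := Vw.
have [e|ne] := pselect (slope v = slope w).
  have [] : w = v \/ w = - v; [|by constructor 1|by constructor 2].
  by apply: slope_height_inj => //; rewrite -tv -tw e.
constructor 3; rewrite leNgt; apply/negP => d1.
have d0 : vdet v w != 0 by apply/eqP => /(slope_eq v0 w0).
have d0' : 0 < `|vdet v w| by rewrite normr_gt0.
(* The point of the geodesic where both forms equal [|vdet v w|]. If that is below 1, the point lies
   in both horoballs. *)
have [z [z0 qz bz]] := point_exists 0 d0 d0'.
apply: (packing_disjoint Vv Vw ne z0); first by rewrite qz.
have := qf_gram v w z0; rewrite qz bz expr0n add0r -(real_normK (num_real (vdet _ _))).
by rewrite expr2 => /(mulfI (lt0r_neq0 d0')) ->.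
Qed.

End FromPacking.

Variables (t : option R -> R) (V : set (R * R)).
Hypothesis hV : unimodular V.
Hypothesis VG : forall g v, G g -> V v -> V (vact g v).
Hypothesis cuspV : forall p, cusp G p <-> exists2 v, V v & slope v = p.
Hypothesis tV : forall v, V v -> t (slope v) = slope_height v.

Definition edge_line v w : set (R * R) := [set z | uhp z /\ bf z v w = 0].

Lemma vdet_norm1_sqr v w : `|vdet v w| = 1 -> vdet v w ^+ 2 = 1.
Proof. by move=> d; rewrite -(real_normK (num_real _)) d expr1n. Qed.

(** At a tangency point both forms are 1, so the Gram identity gives |det| <= 1. Conversely, |det| =
    1 and both forms equal to 1 force [bf z v w = 0], which makes the common point unique. *)
Lemma packing_edgeP e : packing_edge G t e <->
  exists v w, edge V v w /\ e = proj G @` edge_line v w.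
Proof.
have [V0 VN VV] := hV.
split.
  move=> [[[p q] z]] /= [/cuspV[v Vv <-] /cuspV[w Vw <-] [pq] tz _] <-.
  have v0 := V0 _ Vv; have w0 := V0 _ Vw.
  have d0 : vdet v w != 0 by apply/eqP => /(slope_eq v0 w0).
  have [[z0 qv] [_ qw]] : (horocycle (slope v) (t (slope v)) `&`
    horocycle (slope w) (t (slope w))) z by rewrite tz.
  rewrite !tV // in qv qw.
  have {}qv : qf z v = 1.
    by have : horocycle (slope v) (slope_height v) z by []; rewrite horocycleE // => -[].
  have {}qw : qf z w = 1.
    by have : horocycle (slope w) (slope_height w) z by []; rewrite horocycleE // => -[].
  exists v, w; split; last by rewrite geodesicE // image_in_surfaceE // => ? [].
  split=> //; apply/eqP; rewrite eq_le; apply/andP; split.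
    have := qf_gram v w z0; rewrite qv qw mulr1 => e1.
    rewrite -(ler_pXn2r (n:=2)) ?nnegrE // real_normK ?num_real // expr1n e1.
    by rewrite lerDr sqr_ge0.
  case: (VV _ _ Vv Vw) => // h; first by case: pq; rewrite h.
  by case: pq; rewrite h slopeN.
move=> [v [w [[Vv Vw d] ->]]].
have v0 := V0 _ Vv; have w0 := V0 _ Vw.
have d0 : vdet v w != 0 by rewrite -normr_gt0 d.
have d2 := vdet_norm1_sqr d.
have [z [z0 qz bz]] := point_exists 0 d0 (@ltr01 R).
have qwz : qf z w = 1.
  by have := qf_gram v w z0; rewrite qz bz d2 expr0n add0r mul1r.
exists (slope v, slope w, z) => /=; last by rewrite geodesicE // image_in_surfaceE // => ? [].
split; [by apply/cuspV; exists v|by apply/cuspV; exists w| |by rewrite geodesicE].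
split; first by move/(slope_eq v0 w0)/eqP; rewrite (negPf d0).
rewrite !tV // !horocycleE //; apply/seteqP; split=> [y [[y0 qy] [_ qwy]]|_ -> //].
apply: (form_inj d0) => //; rewrite ?qz ?qwz ?bz //.
have := qf_gram v w y0; rewrite qy qwy d2 mulr1 => /eqP.
by rewrite -subr_eq subrr eq_sym sqrf_eq0 => /eqP.
Qed.

Lemma proj_edge_free z : uhp z ->
  packing_graph G t (proj G z) <-> ~ edge_free V z.
Proof.
move=> z0; split.
  move=> [/proj_not_cusp|[e /packing_edgeP[v [w [evw ->]]] [y [y0 by0] yz]]].
    by move/(_ z0).
  move=> ef; have /projP[//|//|g Gg gy] := yz.
  apply: (ef (vact g v) (vact g w)); last by rewrite -gy bf_act // (psl2_det Gg).
  have [Vv Vw d] := evw; split; [exact: VG|exact: VG|].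
  by rewrite vdet_act // (psl2_det Gg).
move/existsNP => [v /existsNP[w /not_implyP[evw /contrapT bz]]]; right.
exists (proj G @` edge_line v w); first by apply/packing_edgeP; exists v, w.
by exists z.
Qed.

End PackingVectors.

(** * The chart triangle with its corners cut off *)

Section TruncatedTriangle.
Context {R : realType}.
Implicit Types (k p q : R * R) (e r : R).

(** The corners of a chart go to cusps, which no point of the half-plane covers; lifts are made on
    this part. *)
Definition truncated_triangle e : set (R * R) :=
  [set k | [/\ std_triangle k, e <= k.1 + k.2, e <= 1 - k.1 & e <= 1 - k.2]].

(* Vanishes on the standard triangle exactly at the vertices. *)
Definition vertex_gap k : R := (k.1 + k.2) * (1 - k.1) * (1 - k.2).

Lemma vertex_gap_cvg k : vertex_gap x @[x --> k] --> vertex_gap k.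
Proof. by rewrite /vertex_gap; cvg_arith. Qed.

Lemma vertex_gap_truncated k e : std_triangle k -> e <= vertex_gap k ->
  truncated_triangle e k.
Proof.
move=> [k1 k2 k3]; rewrite /vertex_gap => ek.
have mul_le1 (x y : R) : 0 <= x -> 0 <= y -> x <= 1 -> y <= 1 -> x * y <= x /\ x * y <= y.
  by move=> *; rewrite ler_piMr // ler_piMl.
have [m1 m2] : (k.1 + k.2) * (1 - k.1) <= k.1 + k.2 /\ (k.1 + k.2) * (1 - k.1) <= 1 - k.1.
  by apply: mul_le1; lra.
have [m3 m4] : (k.1 + k.2) * (1 - k.1) * (1 - k.2) <= (k.1 + k.2) * (1 - k.1) /\
    (k.1 + k.2) * (1 - k.1) * (1 - k.2) <= 1 - k.2.
  by apply: mul_le1; rewrite ?mulr_ge0 //; lra.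
by split=> //; lra.
Qed.

Lemma std_triangle_cases k : std_triangle k ->
  [\/ std_triangle_interior k, exists2 s, std_triangle_sides s & s k |
      std_triangle_vertices k].
Proof.
case: k => x y [/= x0 y0 xy].
have [ex|nx] := eqVneq x 0.
  have [ey|ny] := eqVneq y 0; first by constructor 3; left; left; rewrite ex ey.
  have [ey1|ny1] := eqVneq y 1; first by constructor 3; right; rewrite ex ey1.
  constructor 2; exists [set z | z.1 = 0 /\ 0 < z.2 < 1]; first by left; right.
  split=> //=; apply/andP; split; first by rewrite lt_def ny.
  by rewrite lt_def eq_sym ny1; lra.
have [ey|ny] := eqVneq y 0.
  have [ex1|nx1] := eqVneq x 1; first by constructor 3; left; right; rewrite ey ex1.
  constructor 2; exists [set z | 0 < z.1 < 1 /\ z.2 = 0]; first by left; left.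
  split=> //=; apply/andP; split; first by rewrite lt_def nx.
  by rewrite lt_def eq_sym nx1; lra.
have x0' : 0 < x by rewrite lt_def nx.
have y0' : 0 < y by rewrite lt_def ny.
have [e1|n1] := eqVneq (x + y) 1; last first.
  by constructor 1; split=> //=; rewrite lt_def eq_sym n1.
constructor 2; exists [set z | 0 < z.1 < 1 /\ z.2 = 1 - z.1]; first by right.
by split=> /=; [apply/andP; split; lra|lra].
Qed.

Lemma vertex_gap_gt0 k : std_triangle k -> ~ std_triangle_vertices k ->
  0 < vertex_gap k.
Proof.
case: k => x y [/= x0 y0 xy] nv; rewrite /vertex_gap /=.
have n1 : x + y != 0.
  apply: contra_notN nv => /eqP e; left; left.
  by have [-> ->] : x = 0 /\ y = 0 by split; lra.
have n2 : x != 1.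
  apply: contra_notN nv => /eqP e; left; right.
  by have [-> ->] : x = 1 /\ y = 0 by split; lra.
have n3 : y != 1.
  apply: contra_notN nv => /eqP e; right.
  by have [-> ->] : x = 0 /\ y = 1 by split; lra.
rewrite !mulr_gt0 ?subr_gt0 // lt_def; [rewrite n1|rewrite eq_sym n2|rewrite eq_sym n3]; lra.
Qed.

Lemma truncated_not_vertex k e : 0 < e -> truncated_triangle e k ->
  ~ std_triangle_vertices k.
Proof.
by move=> e0 [_ h1 h2 h3] [[ek|ek]|ek]; rewrite ek /= in h1 h2 h3; lra.
Qed.

Lemma std_triangle_interior_sub k : std_triangle_interior k -> std_triangle k.
Proof. by move=> [? ? ?]; split; exact: ltW. Qed.

Lemma interior_not_vertex k : std_triangle_interior k -> ~ std_triangle_vertices k.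
Proof.
by move=> [h1 h2 h3] [[ek|ek]|ek]; rewrite ek /= in h1 h2 h3; lra.
Qed.

Lemma side_sub (s : set (R * R)) k : std_triangle_sides s -> s k ->
  std_triangle k /\ ~ std_triangle_vertices k.
Proof.
by case=> [[]|] -> [/= h1 h2]; (split; [split; lra|
  move=> [[ek|ek]|ek]; rewrite ek /= in h1 h2; lra]).
Qed.

Lemma mix_gt0 (a b r : R) : 0 < a -> 0 < b -> 0 <= r <= 1 ->
  0 < (1 - r) * a + r * b.
Proof.
move=> a0 b0 /andP[r0 r1]; have [->|rn] := eqVneq r 0.
  by rewrite subr0 mul1r mul0r addr0.
by rewrite ltr_wpDl ?mulr_ge0 ?subr_ge0 // ?(ltW a0) // mulr_gt0 // lt_def rn.
Qed.

Lemma convex_interior : convex_set2 (@std_triangle_interior R).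
Proof.
move=> p q r [p1 p2 p3] [q1 q2 q3] hr.
split; rewrite /seg /=; [exact: mix_gt0|exact: mix_gt0|].
rewrite -subr_gt0 (_ : _ - _ = (1 - r) * (1 - (p.1 + p.2)) + r * (1 - (q.1 + q.2))); last by ring.
by apply: mix_gt0; rewrite ?subr_gt0.
Qed.

Lemma convex_truncated e : convex_set2 (truncated_triangle e).
Proof.
move=> p q r [[p1 p2 p3] p4 p5 p6] [[q1 q2 q3] q4 q5 q6] /andP[r0 r1].
by split; [split|..]; rewrite /seg /=; nra.
Qed.

Lemma convex_side (s : set (R * R)) : std_triangle_sides s -> convex_set2 s.
Proof.
have mix (a b r : R) : 0 < a < 1 -> 0 < b < 1 -> 0 <= r <= 1 ->
    0 < (1 - r) * a + r * b < 1.
  move=> /andP[a0 a1] /andP[b0 b1] hr; rewrite mix_gt0 //= -subr_gt0.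
  rewrite (_ : 1 - _ = (1 - r) * (1 - a) + r * (1 - b)); last by ring.
  by apply: mix_gt0; rewrite ?subr_gt0.
case=> [[]|] -> p q r [/= h1 h2] [h3 h4] hr; rewrite /seg /=; split=> //;
  try exact: mix; rewrite ?h1 ?h2 ?h3 ?h4; ring.
Qed.

Lemma convexI (A B : set (R * R)) : convex_set2 A -> convex_set2 B ->
  convex_set2 (A `&` B).
Proof. by move=> cA cB p q r [? ?] [? ?] hr; split; [exact: cA|exact: cB]. Qed.

Lemma closed_le_cont (l : R * R -> R) (a : R) : (forall k, l x @[x --> k] --> l k) ->
  closed [set k | a <= l k].
Proof.
by move=> cl; apply: (closed_comp (f := l)) (@closed_ge R a) => ? _; exact: cl.
Qed.

Lemma closed_std_triangle : closed (@std_triangle R).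
Proof.
have -> : @std_triangle R = [set k | 0 <= k.1] `&` [set k | 0 <= k.2] `&`
    [set k | 0 <= 1 - (k.1 + k.2)].
  apply/seteqP; split=> k; first by move=> [? ? ?]; do 2?split=> //=; lra.
  by move=> [[/= ? ?] ?]; split=> //; lra.
by apply: closedI; [apply: closedI|]; apply: closed_le_cont => k; cvg_arith.
Qed.

Lemma compact_std_triangle : compact (@std_triangle R).
Proof.
have cb : compact (`[0, 1]%classic `*` `[0, 1]%classic : set (R * R)).
  by apply: compact_setX; exact: segment_compact.
apply: subclosed_compact closed_std_triangle cb _ => k [k1 k2 k3].
by split; rewrite /= in_itv /=; apply/andP; split; lra.
Qed.

Lemma closed_truncated e : closed (truncated_triangle e).
Proof.
have -> : truncated_triangle e = std_triangle `&` [set k | e <= k.1 + k.2] `&`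
    [set k | e <= 1 - k.1] `&` [set k | e <= 1 - k.2].
  by apply/seteqP; split=> k; [move=> [? ? ? ?]|move=> [[[? ?] ?] ?]].
apply: closedI; [apply: closedI; [apply: closedI|]|]; try exact: closed_std_triangle;
  by apply: closed_le_cont => k; cvg_arith.
Qed.

Lemma truncated_box e k : truncated_triangle e k -> 0 <= k.1 <= 1 /\ 0 <= k.2 <= 1.
Proof. by move=> [[? ? ?] _ _ _]; split; apply/andP; split; lra. Qed.

End TruncatedTriangle.

(** * Lifting a chart to a face *)

Section TriangleLift.
Context {R : realType}.
Variables (G : psl2_subgroup R) (t : option R -> R) (V : set (R * R)).
Hypothesis hV : unimodular V.
Hypothesis VG : forall g v, G g -> V v -> V (vact g v).
Hypothesis cuspV : forall p, cusp G p <-> exists2 v, V v & slope v = p.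
Hypothesis tV : forall v, V v -> t (slope v) = slope_height v.
Hypothesis tfG : torsion_free G.
Implicit Types (v w u : R * R) (z : R * R).

Let pg := packing_graph G t.
Let I01 : set R := `[0, 1]%classic.

Let I01E r : I01 r <-> 0 <= r <= 1.
Proof. by rewrite /I01 /= in_itv. Qed.


(* The component of the complement of the edges that contains [z0]. *)
Definition face z0 : set (R * R) :=
  [set z | uhp z /\ forall u u', edge V u u' -> 0 < bf z0 u u' * bf z u u'].

Lemma face_edge_free z0 z : face z0 z -> edge_free V z.
Proof. by move=> [_ h] u u' e b; have := h _ _ e; rewrite b mulr0 ltxx. Qed.

Lemma face_refl z0 : uhp z0 -> edge_free V z0 -> face z0 z0.
Proof.
move=> z00 ef; split=> // u u' e; rewrite -expr2 exprn_even_gt0 //.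
by apply/eqP; exact: ef.
Qed.

Lemma mul_gt0_trans (a b c : R) : 0 < a * b -> 0 < b * c -> 0 < a * c.
Proof.
move=> h1 h2; have b2 : 0 < b ^+ 2.
  by rewrite exprn_even_gt0 //=; apply: contraTneq h1 => ->; rewrite mulr0 ltxx.
rewrite -(pmulr_rgt0 _ b2) [ltRHS](_ : _ = a * b * (b * c)); last by ring.
exact: mulr_gt0.
Qed.

Lemma face_sub z0 z1 : face z0 z1 -> face z1 `<=` face z0.
Proof.
by move=> [_ h1] z [? h2]; split=> // u u' e; apply: mul_gt0_trans (h1 _ _ e) (h2 _ _ e).
Qed.

Lemma kpath_face z0 z1 z2 r : face z0 z1 -> face z0 z2 -> 0 <= r <= 1 ->
  face z0 (kpath z1 z2 r).
Proof.
move=> [u1 h1] [u2 h2] hr; have hu := kpath_uhp u1 u2 hr; split=> // u u' e.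
move: (u1) (u2) (hu); rewrite /uhp /= => y1 y2 yr.
rewrite -(pmulr_rgt0 _ yr) mulrCA (bf_kpath _ _ u1 u2 hr).
rewrite [ltRHS](_ : _ = (1 - r) * (z1.2 * (bf z0 u u' * bf z1 u u')) +
  r * (z2.2 * (bf z0 u u' * bf z2 u u'))); last by ring.
by apply: mix_gt0 => //; apply: mulr_gt0 => //; auto.
Qed.

Lemma strip_face v w w' z0 : strip v w w' `<=` edge_free V -> strip v w w' z0 ->
  strip v w w' `<=` face z0.
Proof.
move=> ef S0 z Sz; have [z0' _ _ _] := Sz; split=> // u u' e.
apply: (kpath_same_side (P := strip v w w')) => //.
- by move=> ? [].
- exact: strip_kpath.
- by move=> y /ef; apply.
Qed.

Lemma cont_kpath z1 z2 : cont_on I01 (kpath z1 z2).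
Proof. by apply: cont_on_at => r _; exact: kpath_continuous. Qed.

Lemma face_connected z0 : connected (face z0).
Proof.
have [->|/set0P[a Fa]] := eqVneq (face z0) set0; first exact: connected0.
have [a0 _] := Fa.
have -> : face z0 = \bigcup_(b in face z0) (kpath a b @` I01).
  apply/seteqP; split=> x.
    move=> Fx; exists x => //; exists 1; last by apply: kpath1; case: Fx.
    by apply/I01E; rewrite ler01 lexx.
  by move=> [b Fb [r /I01E hr <-]]; exact: kpath_face.
apply: bigcup_connected.
  exists a => b Fb; exists 0; last exact: kpath0.
  by apply/I01E; rewrite ler01 lexx.
move=> b Fb; apply: connected_continuous_connected; first exact: segment_connected.
exact/cont_onP/cont_kpath.
Qed.

Lemma proj_cont_on (A : set (R * R)) : A `<=` uhp -> cont_on A (proj G).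
Proof. by move=> Au; apply: cont_on_at => z /Au; exact: proj_cvg. Qed.

Variables (z0 v0 w0 : R * R) (phi : R * R -> filled_surface G).
Hypothesis z0u : uhp z0.
Hypothesis ef0 : edge_free V z0.
Hypothesis evw0 : edge V v0 w0.
Let D := face z0.
Let C := connected_component (~` pg) (proj G z0).
Hypothesis phic : {within std_triangle, continuous phi}.
Hypothesis phih : homeomorphism_on std_triangle_interior C phi.
Hypothesis phis : forall s, std_triangle_sides s ->
  exists2 e, packing_edge G t e & homeomorphism_on s e phi.
Hypothesis phiv : phi @` std_triangle_vertices `<=` cusp_points G.

Lemma proj_graphP z : uhp z -> pg (proj G z) <-> ~ edge_free V z.
Proof. exact: proj_edge_free. Qed.

Lemma proj_face z : D z -> C (proj G z).
Proof.
move=> Dz; have cD : connected (proj G @` D).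
  apply: connected_continuous_connected; first exact: face_connected.
  by apply/cont_onP/proj_cont_on => ? [].
apply: (connected_component_max _ _ cD); last by exists z.
  by exists z0 => //; exact: face_refl.
move=> _ [y Dy <-] /proj_graphP[]; first by case: Dy.
exact: face_edge_free Dy.
Qed.

(** theta is the inverse of the chart composed with the projection, so it is constant on orbits;
    this is the last clause, used to turn paths into loops. *)
Lemma chart_exists : exists theta : R * R -> R * R,
  [/\ cont_on D theta, forall z, D z -> std_triangle_interior (theta z),
      forall z, D z -> phi (theta z) = proj G z &
      forall z z', proj G z = proj G z' -> theta z = theta z'].
Proof.
have [[fC _ surj] _ [f' cf' f'K]] := phih.
have ex z : D z -> exists2 k, std_triangle_interior k & phi k = proj G z.
  by move=> /proj_face /surj[k ? ?]; exists k.
exists (f' \o proj G); split.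
- apply: (cont_on_comp (B := C)); [exact: proj_face| |exact/cont_onP].
  by apply: proj_cont_on => ? [].
- by move=> z /ex[k ik e]; rewrite /= -e f'K.
- by move=> z /ex[k ik e]; rewrite /= -e f'K.
- by move=> z z' e; rewrite /= e.
Qed.

Lemma phi_not_cusp k : std_triangle k -> ~ std_triangle_vertices k ->
  ~ cusp_points G (phi k).
Proof.
case/std_triangle_cases => // [ik|[s hs sk]] _.
  have [[fC _ _] _ _] := phih.
  by have /connected_component_sub := fC _ ik; apply: contra_not; left.
have [e /(packing_edgeP hV cuspV tV)[v [w [_ ->]]] [[fe _ _] _ _]] := phis hs.
by have [z [zu _] <-] := fe _ sk; exact: proj_not_cusp.
Qed.

Lemma truncated_lift e : 0 < e -> exists h, lift_on (truncated_triangle e) phi h.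
Proof.
move=> e0; apply: (lift_exists hV VG evw0 tfG).
- exact: closed_truncated.
- exact: convex_truncated.
- exact: truncated_box.
- by apply: cont_on_sub (proj1 (cont_onP _ _) phic) => k [].
- move=> k Tk; apply: phi_not_cusp; first by case: Tk.
  exact: truncated_not_vertex Tk.
Qed.

(** A path in the face between equivalent points becomes a loop in the open triangle, and a lift of
    the chart takes this loop to a loop. By uniqueness that loop is the original path up to an
    element of G, so the path was closed. *)
Lemma proj_face_inj z z' : D z -> D z' -> proj G z = proj G z' -> z = z'.
Proof.
have [theta [tc ti phit tE]] := chart_exists.
move=> Dz Dz' e; pose s := kpath z z'.
have zu : uhp z by case: Dz.
have z'u : uhp z' by case: Dz'.
have sD r : I01 r -> D (s r) by move=> /I01E; exact: kpath_face.
have cs : cont_on I01 (theta \o s).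
  by apply: cont_on_comp sD _ tc; exact: cont_kpath.
have cg : cont_on I01 (fun r => vertex_gap (theta (s r))).
  apply: (cont_on_comp (B := setT) (h := vertex_gap)) cs _ => //.
  by apply: cont_on_at => k _; exact: vertex_gap_cvg.
(* The minimum of [vertex_gap] along the path is positive, so the loop stays in one truncated
   triangle. *)
have [c c01 cmin] := @EVT_min R (fun r => vertex_gap (theta (s r))) 0 1 ler01
  (proj2 (cont_onP _ _) cg).
have icn r : I01 r -> std_triangle (theta (s r)) /\
    ~ std_triangle_vertices (theta (s r)).
  by move=> /sD /ti h; split; [exact: std_triangle_interior_sub|exact: interior_not_vertex].
set eps := vertex_gap (theta (s c)) in cmin.
have [ic1 ic2] := icn _ c01.
have e0 : 0 < eps by exact: vertex_gap_gt0.
have inK r : I01 r -> truncated_triangle eps (theta (s r)).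
  by move=> r01; apply: vertex_gap_truncated; [case: (icn _ r01)|exact: cmin].
have [h Lh] := truncated_lift e0.
have m0 : I01 (0 : R) by apply/I01E; rewrite ler01 lexx.
have m1 : I01 (1 : R) by apply/I01E; rewrite ler01 lexx.
have s0 : s 0 = z by exact: kpath0.
have s1 : s 1 = z' by exact: kpath1.
have Tz : truncated_triangle eps (theta z) by have := inK _ m0; rewrite s0.
have [hu hE] := Lh.2 _ Tz; rewrite phit // in hE.
have /projP[//|//|g Gg ge] := hE.
have {}Lh := lift_act Gg Lh; set h' := fun x => moebius g (h x) in Lh.
have L1 : lift_on I01 (phi \o (theta \o s)) (h' \o (theta \o s)).
  split; last by move=> r r01; have := Lh.2 _ (inK _ r01).
  by apply: (cont_on_comp (B := truncated_triangle eps)) inK cs Lh.1.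
have L2 : lift_on I01 (phi \o (theta \o s)) s.
  split; first exact: cont_kpath.
  by move=> r r01; have Ds := sD _ r01; split; [case: Ds|rewrite /= phit].
have := lift_unique hV VG evw0 tfG (@segment_connected R 0 1) L1 L2 m0 _ m1.
rewrite /= s0 s1 -(tE _ _ e) {1}/h' ge => /(_ erefl) <-.
by rewrite /h' ge.
Qed.

(** Once adjusted at one point, the lift keeps the truncated interior in the face: crossing an edge
    would put an interior point of the chart on the packing graph. As the projection is injective on
    the face, the lift inverts theta. *)
Lemma truncated_lift_face theta e z :
  cont_on D theta -> (forall z, D z -> std_triangle_interior (theta z)) ->
  (forall z, D z -> phi (theta z) = proj G z) ->
  0 < e -> D z -> truncated_triangle e (theta z) ->
  exists h, lift_on (truncated_triangle e) phi h /\
    forall y, D y -> truncated_triangle e (theta y) -> h (theta y) = y.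
Proof.
move=> tc ti phit e0 Dz Tz; have [h0 Lh0] := truncated_lift e0.
have zu : uhp z by case: Dz.
have [hu hE] := Lh0.2 _ Tz; rewrite phit // in hE.
have /projP[//|//|g Gg ge] := hE.
have Lh := lift_act Gg Lh0; set h := fun x => moebius g (h0 x) in Lh.
exists h; split=> // y Dy Ty.
have cI : connected (truncated_triangle e `&` std_triangle_interior).
  apply: convex_connected; apply: convexI; first exact: convex_truncated.
  exact: convex_interior.
have hD k : truncated_triangle e k -> std_triangle_interior k -> D (h k).
  move=> Tk ik; split; first by case: (Lh.2 _ Tk).
  move=> u u' euu.
  have [/cont_onE ch _] := Lh.
  have n0 x : truncated_triangle e x -> std_triangle_interior x -> bf (h x) u u' != 0.
    move=> Tx ix; apply/eqP => b0.
    have [hxu hx] := Lh.2 _ Tx; have [[fC _ _] _ _] := phih.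
    have /connected_component_sub := fC _ ix; rewrite -hx; apply.
    by apply/proj_graphP => // ef; exact: (ef _ _ euu).
  have near_sgn x (s : R) : truncated_triangle e x -> 0 < s * bf (h x) u u' ->
      \forall y \near x, truncated_triangle e y -> 0 < s * bf (h y) u u'.
    move=> Tx px; have [hxu _] := Lh.2 _ Tx.
    have nb : \forall y \near h x, 0 < s * bf y u u'.
      have cb : s * bf y u u' @[y --> h x] --> s * bf (h x) u u'.
        by apply: cvgM; [exact: cvg_cst|exact: bf_cvg].
      exact: (cvgr_gt _ cb).
    exact: ch nb.
  apply: (connected_ind cI (P := fun k => 0 < bf z0 u u' * bf (h k) u u') (conj Tz (ti _ Dz))) => //.
  - by rewrite /h ge; case: Dz => _; apply.
  - by move=> x [Tx ix] px; have := near_sgn x _ Tx px; apply: filterS => y' hy [Ty' _]; exact: hy.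
  - move=> x [Tx ix] npx.
    have px : 0 < - bf z0 u u' * bf (h x) u u'.
      move/negP: npx; rewrite -leNgt mulNr oppr_gt0 le_eqVlt mulf_eq0 (negPf (n0 _ Tx ix)) orbF.
      by case/orP => // /eqP b0; case: (ef0 euu b0).
    have := near_sgn x _ Tx px; apply: filterS => k' hk' [Tk' _]; have := hk' Tk'.
    by rewrite mulNr oppr_gt0 => /lt_trans h1 /h1; rewrite ltxx.
have [_ E] := Lh.2 _ Ty.
by apply: proj_face_inj => //; [exact: hD (ti _ Dy)|rewrite E phit].
Qed.

(** By compactness theta has a cluster point k as the face approaches z. It is no corner, since
    cusps are separated from z; lifts that invert theta send k to z; and k is not interior, since z
    lies on an edge. *)
Lemma boundary_side theta z : cont_on D theta ->
  (forall z, D z -> std_triangle_interior (theta z)) ->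
  (forall z, D z -> phi (theta z) = proj G z) ->
  uhp z -> ~ edge_free V z -> closure D z ->
  exists k, [/\ exists2 s, std_triangle_sides s & s k, 0 < vertex_gap k &
    forall e h, 0 < e < vertex_gap k -> lift_on (truncated_triangle e) phi h ->
      (forall y, D y -> truncated_triangle e (theta y) -> h (theta y) = y) ->
      h k = z].
Proof.
move=> tc ti phit zu nef clz.
pose F := theta @ within D (nbhs z).
have FF : ProperFilter F.
  by apply: fmap_proper_filter; exact: within_nbhs_proper.
have FD : F std_triangle.
  suff : \forall y \near z, D y -> std_triangle (theta y) by [].
  apply: filterE => y Dy.
  exact/std_triangle_interior_sub/ti.
have [k [Tk clk]] := compact_std_triangle FF FD.
have meet A B : nbhs z A -> nbhs k B -> exists y, [/\ D y, A y & B (theta y)].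
  move=> nA nB; have FA : F [set x | exists y, [/\ D y, A y & theta y = x]].
    suff : \forall y \near z, D y -> exists y', [/\ D y', A y' & theta y' = theta y] by [].
    by apply: filterS nA => y Ay Dy; exists y.
  by have [_ [[y [Dy Ay <-]] By]] := clk _ _ FA nB; exists y.
have /cont_onP/cont_onE pc := phic.
have nv : ~ std_triangle_vertices k.
  move=> vk; have ck : cusp_points G (phi k) by apply: phiv; exists k.
  have [A [W [nA nW AW]]] := cusp_separated hV VG cuspV zu ck.
  have nB := pc k W Tk nW.
  have [y [Dy Ay By]] := meet _ _ nA nB.
  apply: (AW _ Ay); first by case: Dy.
  by rewrite -phit //; apply: By; apply/std_triangle_interior_sub/ti.
have g0 := vertex_gap_gt0 Tk nv.
have near_gap e : e < vertex_gap k -> \forall x \near k, std_triangle x ->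
    truncated_triangle e x.
  move=> ek; have n1 : \forall x \near k, e < vertex_gap x.
    exact: (cvgr_gt _ (@vertex_gap_cvg R k)).
  by apply: filterS n1 => x /ltW ex sx; exact: vertex_gap_truncated.
have hk e h : 0 < e < vertex_gap k -> lift_on (truncated_triangle e) phi h ->
      (forall y, D y -> truncated_triangle e (theta y) -> h (theta y) = y) ->
      h k = z.
  move=> /andP[e0 ek] [/cont_onE hc _] hD; apply: contrapT => /eqP ne.
  have hT : hausdorff_space (R * R)%type by exact: norm_hausdorff.
  move: hT; rewrite open_hausdorff => /(_ _ _ ne)[[A B] /=[/set_mem Ak /set_mem Bz] [oA oB /eqP AB]].
  have Tek : truncated_triangle e k by apply: vertex_gap_truncated => //; exact: ltW.
  have n1 := hc k A Tek (open_nbhs_nbhs (conj oA Ak)).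
  have nB : nbhs z B by exact: open_nbhs_nbhs.
  have [y [Dy By [y1 y2]]] := meet _ _ nB (filterI n1 (near_gap _ ek)).
  have Ty : truncated_triangle e (theta y).
    by apply: y2; apply/std_triangle_interior_sub/ti.
  have : (A `&` B) y by split=> //; rewrite -(hD y Dy Ty); exact: y1.
  by rewrite AB.
exists k; split=> //.
case: (std_triangle_cases Tk) => // ik; exfalso.
pose e := vertex_gap k / 2.
have he : 0 < e < vertex_gap k by rewrite /e; apply/andP; split; lra.
have /andP[e0 ek] := he.
have [y [Dy _ yk]] := meet _ _ (@filterT _ (nbhs z) _) (near_gap _ ek).
have Ty : truncated_triangle e (theta y) by apply: yk; apply/std_triangle_interior_sub/ti.
have [h [Lh hD]] := truncated_lift_face tc ti phit e0 Dy Ty.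
have Tek : truncated_triangle e k by apply: vertex_gap_truncated => //; exact: ltW.
have [_ E] := Lh.2 _ Tek; have [[fC _ _] _ _] := phih.
have /connected_component_sub := fC _ ik; rewrite -E (hk e h) //; apply.
exact/proj_graphP.
Qed.

(** The lift carries a side into the lifted packing graph, where lines are isolated by [edge_near],
    so being on the line of v w is open and closed along the side. Boundary points on disjoint edges
    thus come from different sides. *)
Lemma boundary_sides_distinct theta z1 z2 k1 k2 s v w : cont_on D theta ->
  (forall z, D z -> std_triangle_interior (theta z)) ->
  (forall z, D z -> phi (theta z) = proj G z) ->
  std_triangle_sides s -> s k1 -> s k2 -> 0 < vertex_gap k1 -> 0 < vertex_gap k2 ->
  (forall e h, 0 < e < vertex_gap k1 -> lift_on (truncated_triangle e) phi h ->
      (forall y, D y -> truncated_triangle e (theta y) -> h (theta y) = y) ->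
      h k1 = z1) ->
  (forall e h, 0 < e < vertex_gap k2 -> lift_on (truncated_triangle e) phi h ->
      (forall y, D y -> truncated_triangle e (theta y) -> h (theta y) = y) ->
      h k2 = z2) ->
  edge V v w -> bf z1 v w = 0 -> bf z2 v w = 0.
Proof.
move=> tc ti phit hs s1 s2 g1 g2 h1 h2 evw b1.
have gz : 0 < vertex_gap (theta z0).
  have ik := ti _ (face_refl z0u ef0).
  by apply: vertex_gap_gt0; [exact: std_triangle_interior_sub|exact: interior_not_vertex].
pose m := Num.min (vertex_gap (theta z0)) (Num.min (vertex_gap k1) (vertex_gap k2)).
have m0 : 0 < m by rewrite !lt_min gz g1 g2.
pose e := m / 2; have e0 : 0 < e by rewrite /e; lra.
have em : e < m by rewrite /e; lra.
have [/andP[a1 a2] a3] : (e < vertex_gap k1) && (e < vertex_gap k2) /\ e < vertex_gap (theta z0).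
  by move: em; rewrite /m !lt_min => /and3P[-> -> ->].
have D0 : D z0 by exact: face_refl.
have T0 : truncated_triangle e (theta z0).
  by apply: vertex_gap_truncated; [exact/std_triangle_interior_sub/ti|exact: ltW].
have [h [Lh hD]] := truncated_lift_face tc ti phit e0 D0 T0.
have E1 : h k1 = z1 by apply: (h1 e) => //; rewrite e0.
have E2 : h k2 = z2 by apply: (h2 e) => //; rewrite e0.
have T1 : truncated_triangle e k1.
  by apply: vertex_gap_truncated; [case: (side_sub hs s1)|exact: ltW].
have T2 : truncated_triangle e k2.
  by apply: vertex_gap_truncated; [case: (side_sub hs s2)|exact: ltW].
have cS : connected (truncated_triangle e `&` s).
  by apply: convex_connected; apply: convexI; [exact: convex_truncated|exact: convex_side].
rewrite -E2; have {}b1 : bf (h k1) v w = 0 by rewrite E1.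
have [/cont_onE hc _] := Lh.
have on_edge k : truncated_triangle e k -> s k -> exists u u', edge V u u' /\ bf (h k) u u' = 0.
  move=> Tk sk; have [hu hE] := Lh.2 _ Tk.
  have [e' pe [[fe _ _] _ _]] := phis hs.
  have /proj_graphP/existsNP[//|u /existsNP[u' /not_implyP[eu /contrapT bu]]] :
      pg (proj G (h k)).
    by right; exists e' => //; rewrite hE; exact: fe.
  by exists u, u'.
apply: (connected_ind cS (P := fun k => bf (h k) v w = 0) (conj T1 s1)) => //.
- move=> x [Tx sx] bx; have [hu _] := Lh.2 _ Tx.
  have [V0 _ _] := hV; have [Vv Vw _] := evw.
  have q1 := edge_qf hu evw bx.
  wlog qv : v w evw Vv Vw bx q1 b1 / qf (h x) v < 2.
    move=> H; have [|qv] := ltP (qf (h x) v) 2; first exact: H.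
    have /H : edge V w v by exact: edgeC.
    rewrite bfC mulrC => /(_ Vw Vv bx q1); rewrite bfC => /(_ b1).
    have qw : qf (h x) w < 2.
      by have := qf_gt0 hu (V0 _ Vv); have := qf_gt0 hu (V0 _ Vw); nra.
    by move=> /(_ qw); apply: filterS => k; rewrite bfC.
  have nb : \forall y \near h x, [/\ uhp y, qf y v < 2 & `|bf y v w| < qf y v].
    have c1 := @qf_cvg R (h x) v hu.
    have c2 := @bf_cvg R (h x) v w hu.
    have n1 := nbhs_uhp hu.
    have n2 : \forall y \near h x, qf y v < 2 by exact: (cvgr_lt _ c1).
    have n3 : \forall y \near h x, `|bf y v w| < qf y v.
      have c3 : qf y v - `|bf y v w| @[y --> h x] --> qf (h x) v - `|bf (h x) v w|.
        by apply: cvgB => //; exact: cvg_norm.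
      have : 0 < qf (h x) v - `|bf (h x) v w| by rewrite bx normr0 subr0 qf_gt0 ?V0.
      move=> p0; have n3 : \forall y \near h x, 0 < qf y v - `|bf y v w|.
        exact: (cvgr_gt _ c3).
      by apply: filterS n3 => y; rewrite subr_gt0.
    by apply: filterS3 n1 n2 n3 => y *; split.
  have := hc x _ Tx nb; apply: filterS => k hk [Tk sk].
  have [ku q2 b2] := hk Tk; have [u [u' [euu buu]]] := on_edge _ Tk sk.
  exact: (edge_near hV ku evw q2 b2 euu buu).
- move=> x [Tx sx] /eqP bx; have [hu _] := Lh.2 _ Tx.
  have nb : \forall y \near h x, bf y v w != 0.
    have c2 := @bf_cvg R (h x) v w hu.
    exact: cvgr_neq0 c2 bx.
  by have := hc x _ Tx nb; apply: filterS => k hk [Tk _]; apply/eqP; exact: hk.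
Qed.

End TriangleLift.

(** * From a packing to an integral conjugate *)

Section PackableIntegral.
Context {R : realType}.
Implicit Types (v w u : R * R) (z : R * R).

(** Moving from z1 towards z2 along the Klein segment enters the open strip at once. *)
Lemma strip_closure v w w' z1 z2 : uhp z1 -> qf z1 v < 2 -> bf z1 v w <= 0 ->
  0 <= bf z1 v w' -> strip v w w' z2 -> closure (strip v w w') z1.
Proof.
move=> u1 q1 a1 b1 [u2 q2 a2 b2] A nA.
have : \forall r \near (0 : R), A (kpath z1 z2 r).
  by apply: kpath_continuous; rewrite kpath0.
move=> /nbhs_ballP[e /= e0 He]; pose r := Num.min (1 / 2) (e / 2).
have r0 : 0 < r by rewrite lt_min !divr_gt0.
have r1 : r < 1 by rewrite gt_min; apply/orP; left; lra.
have re : r < e by rewrite gt_min; apply/orP; right; lra.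
have hr : 0 <= r <= 1 by rewrite !ltW.
exists (kpath z1 z2 r); split; last first.
  by apply: He; rewrite /ball /= sub0r normrN gtr0_norm.
have hu := kpath_uhp u1 u2 hr; have [/andP[m0 mle] _] := kpath_sqr u1 u2 hr.
have E := bf_kpath _ _ u1 u2 hr.
move: (u1) (u2) (hu); rewrite /uhp /= => y1 y2 yr.
have r1' : 0 < 1 - r by rewrite subr_gt0.
split=> //.
- rewrite -(ltr_pM2l yr) /qf E.
  apply: (lt_le_trans (y := ((1 - r) * z1.2 + r * z2.2) * 2)); last by rewrite ler_pM2r.
  rewrite -subr_gt0.
  have -> : ((1 - r) * z1.2 + r * z2.2) * 2 - ((1 - r) * (z1.2 * bf z1 v v) +
    r * (z2.2 * bf z2 v v)) = (1 - r) * (z1.2 * (2 - qf z1 v)) +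
    r * (z2.2 * (2 - qf z2 v)) by rewrite /qf; ring.
  by rewrite mix_gt0 // mulr_gt0 // subr_gt0.
- rewrite -(pmulr_rlt0 _ yr) E -oppr_gt0.
  have -> : - ((1 - r) * (z1.2 * bf z1 v w) + r * (z2.2 * bf z2 v w)) =
    (1 - r) * (z1.2 * - bf z1 v w) + r * (z2.2 * - bf z2 v w) by ring.
  apply: ltr_wpDl; first by rewrite !mulr_ge0 ?oppr_ge0 // ltW.
  by rewrite !mulr_gt0 // oppr_gt0.
- rewrite -(pmulr_rgt0 _ yr) E.
  apply: ltr_wpDl; last by apply: mulr_gt0 => //; exact: mulr_gt0.
  by apply: mulr_ge0; [exact: ltW|apply: mulr_ge0 => //; exact: ltW].
Qed.

Variables (G : psl2_subgroup R) (t : option R -> R) (V : set (R * R)).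
Hypothesis hV : unimodular V.
Hypothesis VG : forall g v, G g -> V v -> V (vact g v).
Hypothesis cuspV : forall p, cusp G p <-> exists2 v, V v & slope v = p.
Hypothesis tV : forall v, V v -> t (slope v) = slope_height v.
Hypothesis tfG : torsion_free G.
Hypothesis hpack : packable G t.

(* Otherwise the face on one side of the edge [v w] would be bounded by at
   least four edges. *)
Lemma packable_add v w : edge V v w -> V (v + w).
Proof.
move=> evw; apply: contrapT => nVvw.
have [V0 VN VV] := hV; have [Vv Vw d] := evw.
have cV x : V x -> cusp G (slope x) by move=> Vx; apply/cuspV; exists x.
have [a a1 [Vw1 amin]] := next_edge hV VG (cV _ Vv) evw.
have ewv : edge V w v by exact: edgeC.
have [b b1 [Vw2 bmin]] := next_edge hV VG (cV _ Vw) ewv.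
set w1 := w + a *: v in Vw1; set w2 := v + b *: w in Vw2.
have {}a1 : 1 < a.
  rewrite lt_def a1 andbT; apply: contra_notN nVvw => /eqP a1'.
  by move: Vw1; rewrite /w1 a1' scale1r addrC.
have {}b1 : 1 < b.
  rewrite lt_def b1 andbT; apply: contra_notN nVvw => /eqP b1'.
  by move: Vw2; rewrite /w2 b1' scale1r.
have e1 : edge V v w1.
  by split=> //; rewrite /w1 vdetDr vdetZr vdetvv mulr0 addr0.
have e2 : edge V w w2.
  by split=> //; rewrite /w2 vdetDr vdetZr vdetvv mulr0 addr0 vdetC normrN.
have e1' : edge V w1 (- v) by apply/edgeNr/edgeC.
have [c c1 [Vw3 cmin]] := next_edge hV VG (cV _ Vw1) e1'.
set w3 := - v + c *: w1 in Vw3.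
have e3 : edge V w1 w3.
  by split=> //; rewrite /w3 vdetDr vdetZr vdetvv mulr0 addr0; case: e1'.
have ef1 : strip v w w1 `<=` edge_free V.
  by move=> z [zu q h1 h2]; exact: (strip_edge_free hV zu evw amin q h1 h2).
have ef2 : strip w v w2 `<=` edge_free V.
  by move=> z [zu q h1 h2]; exact: (strip_edge_free hV zu ewv bmin q h1 h2).
have ef3 : strip w1 (- v) w3 `<=` edge_free V.
  by move=> z [zu q h1 h2]; exact: (strip_edge_free hV zu e1' cmin q h1 h2).
have dn x y : edge V x y -> vdet x y != 0 by move=> [_ _ h]; rewrite -normr_gt0 h.
have qof x y z : edge V x y -> uhp z -> qf z x = 1 -> qf z y = bf z x y ^+ 2 + 1.
  move=> [_ _ h] zu q; have := qf_gram x y zu.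
  by rewrite q mul1r => ->; rewrite vdet_norm1_sqr.
(* z0 will lie in the strips at v and at w, and z' in those at v and at w1, so the three strips
   belong to one face. *)
have [z0 [z0u qz0 bz0]] := point_exists (- (1 / 2)) (dn _ _ evw) (@ltr01 R).
have qw0 : qf z0 w = 5 / 4 by rewrite (qof _ _ _ evw z0u qz0) bz0; field.
have S1 : strip v w w1 z0.
  by split=> //; rewrite ?qz0 ?bz0 ?bfDr ?bfZr -?/(qf _ _) ?qz0 ?bz0; lra.
have S2 : strip w v w2 z0.
  split=> //; rewrite ?bfDr ?bfZr -?/(qf _ _) ?(bfC _ w v) ?bz0 ?qw0; lra.
have [z' [z'u qz' bz']] := point_exists (1 / 2) (dn _ _ e1) (@ltr01 R).
have qw1' : qf z' w1 = 5 / 4 by rewrite (qof _ _ _ e1 z'u qz') bz'; field.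
have bz'w : bf z' v w = 1 / 2 - a.
  by move: bz'; rewrite /w1 bfDr bfZr -/(qf _ _) qz'; lra.
have S1' : strip v w w1 z' by split=> //; rewrite ?qz' ?bz'w ?bz'; lra.
have S3 : strip w1 (- v) w3 z'.
  split=> //; rewrite ?bfDr ?bfNr ?bfZr -?/(qf _ _) ?(bfC _ w1 v) ?bz' ?qw1'; lra.
pose D := face V z0.
have D1 : strip v w w1 `<=` D by exact: strip_face.
have D2 : strip w v w2 `<=` D by exact: strip_face.
have D3 : strip w1 (- v) w3 `<=` D.
  by move=> z /(strip_face ef3 S3); apply: face_sub; exact: D1.
have ef0 : edge_free V z0 by exact: ef1.
have cl_sub (A : set (R * R)) z : A `<=` D -> closure A z -> closure D z.
  by move=> AD; exact: closureS.
(* The tangency points of the four edges; each is a limit of points of the face. *)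
have [z1 [z1u q1 bz1]] := point_exists 0 (dn _ _ evw) (@ltr01 R).
have [z2 [z2u q2 bz2]] := point_exists 0 (dn _ _ e1) (@ltr01 R).
have [z3 [z3u q3 bz3]] := point_exists 0 (dn _ _ e2) (@ltr01 R).
have [z4 [z4u q4 bz4]] := point_exists 0 (dn _ _ e3) (@ltr01 R).
have lt12 : (1 : R) < 2 by lra.
have cl1 : closure D z1.
  apply: cl_sub D1 _; apply: strip_closure S1; rewrite ?q1 ?bz1 //.
  by rewrite bfDr bfZr -/(qf _ _) q1 bz1; lra.
have cl2 : closure D z2.
  apply: cl_sub D1 _; apply: strip_closure S1; rewrite ?q2 ?bz2 //.
  by move: bz2; rewrite bfDr bfZr -/(qf _ _) q2; lra.
have cl3 : closure D z3.
  apply: cl_sub D2 _; apply: strip_closure S2; rewrite ?q3 ?bz3 //.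
  by move: bz3; rewrite bfDr bfZr -/(qf _ _) q3; lra.
have cl4 : closure D z4.
  apply: cl_sub D3 _; apply: strip_closure S3; rewrite ?q4 ?bz4 //.
  by move: bz4; rewrite bfDr bfZr -/(qf _ _) q4; lra.
have nef x y z : edge V x y -> bf z x y = 0 -> ~ edge_free V z.
  by move=> e h ef; exact: (ef _ _ e).
have ng : ~ packing_graph G t (proj G z0).
  by move/(proj_edge_free hV VG cuspV tV z0u); apply.
have [phi [phic phih phis phiv]] := hpack ng.
have [theta [tc ti phit _]] := chart_exists hV VG cuspV tV z0u ef0 phih.
have bside := boundary_side hV VG cuspV tV tfG z0u ef0 evw phic phih phis phiv tc ti phit.
have [k1 [[s1 hs1 sk1] g1 h1]] := bside z1 z1u (nef _ _ _ evw bz1) cl1.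
have [k2 [[s2 hs2 sk2] g2 h2]] := bside z2 z2u (nef _ _ _ e1 bz2) cl2.
have [k3 [[s3 hs3 sk3] g3 h3]] := bside z3 z3u (nef _ _ _ e2 bz3) cl3.
have [k4 [[s4 hs4 sk4] g4 h4]] := bside z4 z4u (nef _ _ _ e3 bz4) cl4.
have same := boundary_sides_distinct hV VG cuspV tV tfG z0u ef0 evw phic phih phis tc ti phit.
have [[F12 _ _ _ _] _] := four_edges hV evw a1 b1 c1 e1 e2 e3 z2u.
have [[_ F13 _ F23 _] _] := four_edges hV evw a1 b1 c1 e1 e2 e3 z3u.
have [[_ _ F14 _ F24] F34] := four_edges hV evw a1 b1 c1 e1 e2 e3 z4u.
have n12 : s1 <> s2.
  by move=> e; apply: F12 => //; apply: (same _ _ _ _ _ _ _ hs1 sk1 _ g1 g2 h1 h2) => //; rewrite e.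
have n13 : s1 <> s3.
  by move=> e; apply: F13 => //; apply: (same _ _ _ _ _ _ _ hs1 sk1 _ g1 g3 h1 h3) => //; rewrite e.
have n14 : s1 <> s4.
  by move=> e; apply: F14 => //; apply: (same _ _ _ _ _ _ _ hs1 sk1 _ g1 g4 h1 h4) => //; rewrite e.
have n23 : s2 <> s3.
  by move=> e; apply: F23 => //; apply: (same _ _ _ _ _ _ _ hs2 sk2 _ g2 g3 h2 h3) => //; rewrite e.
have n24 : s2 <> s4.
  by move=> e; apply: F24 => //; apply: (same _ _ _ _ _ _ _ hs2 sk2 _ g2 g4 h2 h4) => //; rewrite e.
have n34 : s3 <> s4.
  by move=> e; apply: F34 => //; apply: (same _ _ _ _ _ _ _ hs3 sk3 _ g3 g4 h3 h4) => //; rewrite e.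
(* Four pairwise different sides, while a triangle has three. *)
clear -hs1 hs2 hs3 hs4 n12 n13 n14 n23 n24 n34.
by case: hs1 => [[]|] E1; case: hs2 => [[]|] E2; case: hs3 => [[]|] E3;
  case: hs4 => [[]|] E4; congruence.
Qed.

(** If some point is off the graph, a side of its chart is an edge; otherwise the point i lies on
    one. *)
Lemma packable_edge : exists v w, edge V v w.
Proof.
have [[x nx]|all] := pselect (exists x, ~ packing_graph G t x).
  have [phi [_ _ phis _]] := hpack nx.
  have [|e pe _] := phis [set z | 0 < z.1 < 1 /\ z.2 = 0]; first by left; left.
  have /(packing_edgeP hV cuspV tV)[v [w [evw _]]] := pe.
  by exists v, w.
have iu : uhp (0, 1 : R) by rewrite /uhp /=.
have : packing_graph G t (proj G (0, 1)) by apply: contrapT => nx; apply: all; eexists; exact: nx.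
move/(proj_edge_free hV VG cuspV tV iu)/existsNP => [v /existsNP[w /not_implyP[evw _]]].
by exists v, w.
Qed.

(** A tangent pair of determinant 1 spans a lattice containing V. The columns of the conjugate of h
    are the coordinates of h v and h w, which lie in V, so they are integral. *)
Lemma packable_conj_integral : exists2 g : 'M[R]_2, \det g = 1 &
  forall h, G h -> psl2Z (g * h * g^-1).
Proof.
have [v [w0 evw0]] := packable_edge.
have [w [evw d]] : exists w, edge V v w /\ vdet v w = 1.
  have [_ _ /eqP] := evw0; rewrite eqr_norml ler01 andbT => /orP[]/eqP h.
    by exists w0.
  by exists (- w0); rewrite vdetNr h opprK; split=> //; exact: edgeNr.
have [Vv Vw _] := evw.
pose M := frame v w; have dM : \det M = 1 by rewrite frame_det.
have uM := unit_det1 dM.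
exists M^-1; first exact: det1V.
move=> h Gh; rewrite invrK; have dh := psl2_det Gh.
split; last by rewrite !det1M ?det1V.
have col u : V u -> exists m n : int, vact (M^-1 * h) u = (m%:~R, n%:~R).
  move=> Vu; have [m [n e]] := unimodular_descent hV packable_add evw (VG Gh Vu).
  exists m, n; rewrite vactM e -[RHS](vactK _ dM); congr (vact _ _).
  by rewrite vact_frame.
have [m [n emn]] := col _ Vv; have [m' [n' emn']] := col _ Vw.
have Me1 : vact M (1, 0) = v by rewrite vact_frame scale1r scale0r addr0.
have Me2 : vact M (0, 1) = w by rewrite vact_frame scale1r scale0r add0r.
set N := M^-1 * h * M.
have N1 : (N 0 0, N 1 0) = (m%:~R, n%:~R).
  by rewrite -emn -Me1 -vactM -/N /vact /= !mulr1 !mulr0 !addr0.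
have N2 : (N 0 1, N 1 1) = (m'%:~R, n'%:~R).
  by rewrite -emn' -Me2 -vactM -/N /vact /= !mulr1 !mulr0 !add0r.
have [N00 N10] := N1; have [N01 N11] := N2.
apply/mxOverP => i j.
have H (x : R) (k : int) : x = k%:~R -> x \is a Num.int by move=> ->; exact: intr_int.
case: i => [[|[|//]] i]; case: j => [[|[|//]] j].
- by apply: (H _ m); rewrite -N00; congr (N _ _); exact: val_inj.
- by apply: (H _ m'); rewrite -N01; congr (N _ _); exact: val_inj.
- by apply: (H _ n); rewrite -N10; congr (N _ _); exact: val_inj.
- by apply: (H _ n'); rewrite -N11; congr (N _ _); exact: val_inj.
Qed.

End PackableIntegral.

(** * Hyperbolic area *)

Section DensityMeasure.
Local Open Scope ereal_scope.
Context d (T : measurableType d) (R : realType).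
Variables (mu : {measure set T -> \bar R}) (f : T -> \bar R) (D : set T).
Hypotheses (mf : measurable_fun setT f) (f0 : forall x, 0 <= f x) (mD : measurable D).

(** The hypotheses are arguments so that the measure structure can be attached to the constant
    applied to them. *)
Definition density_measure of measurable_fun setT f & (forall x, 0 <= f x) & measurable D :=
  fun A => \int[mu]_(x in D `&` A) f x.

Local Notation nu := (density_measure mf f0 mD).

Let density_measure0 : nu set0 = 0.
Proof. by rewrite /density_measure setI0 integral_set0. Qed.

Let density_measure_ge0 A : 0 <= nu A.
Proof. by rewrite /density_measure; apply: integral_ge0. Qed.

Let density_measure_sigma_additive : semi_sigma_additive nu.
Proof.
move=> F mF tF mUF; rewrite /density_measure; apply: cvg_toP.
  apply: ereal_nondecreasing_is_cvgn => m n mn.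
  by apply: lee_sum_nneg_natr => // k _ _; apply: integral_ge0.
rewrite setI_bigcupr ge0_integral_bigcup //=.
- by move=> k; exact: measurableI.
- exact: measurable_funTS.
- exact: trivIset_setIl.
Qed.

HB.instance Definition _ := isMeasure.Build _ _ _ nu
  density_measure0 density_measure_ge0 density_measure_sigma_additive.

End DensityMeasure.

Section LebesgueInvariance.
Context {R : realType}.
Local Notation lam := (@lebesgue_measure R).
Implicit Types (A B : set (measurableTypeR R)).

(** Lebesgue measure is characterised by its values on half-open intervals. Scaling and the
    substitution by [ln] are treated in the same way. *)
Lemma lebesgue_measureD A (b : R) : measurable A ->
  lam [set x | A (x + b)] = lam A.
Proof.
move=> mA.
have mS : measurable_fun setT (fun x : measurableTypeR R => (x + b : measurableTypeR R)).
  by apply: measurable_funD.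
rewrite -[LHS]/(pushforward lam (fun x : measurableTypeR R => (x + b : measurableTypeR R)) A).
apply/esym/lebesgue_measure_unique => // _ [[c e] _ <-].
transitivity (lam `](c - b), (e - b)]); last first.
  by congr lam; apply/seteqP; split=> x /=; rewrite !in_itv /= ltrBlDr lerBrDr.
rewrite !lebesgue_measure_itv /= !lte_fin ltrD2r; case: ifP => // _.
by rewrite -!EFinB; congr EFin; ring.
Qed.

Lemma measurable_affine (a b : R) A : measurable A -> measurable [set x : measurableTypeR R | A (a * x + b)].
Proof.
move=> mA.
have mS : measurable_fun setT (fun x : measurableTypeR R => (a * x + b : measurableTypeR R)).
  by apply: measurable_funD => //; apply: measurable_funM.
by rewrite -[X in measurable X]setTI; exact: mS.
Qed.

Lemma lebesgue_measure_affine A (s b : R) : s = 1 \/ s = -1 -> measurable A ->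
  lam [set x | A (s * x + b)] = lam A.
Proof.
move=> hs mA; case: hs => ->.
  by rewrite -(lebesgue_measureD b mA); congr lam; apply/seteqP; split=> x /=; rewrite mul1r.
have mB : measurable [set x : measurableTypeR R | A (x + b)].
  rewrite (_ : mkset _ = [set x : measurableTypeR R | A (1 * x + b)]); first exact: measurable_affine.
  by apply/seteqP; split=> x /=; rewrite mul1r.
rewrite -(lebesgue_measureD b mA) -(lebesgue_measureN mB).
by congr lam; apply/seteqP; split=> x /=; rewrite mulN1r.
Qed.

End LebesgueInvariance.

Section ImageMeasure.
Local Open Scope ereal_scope.
Context d d' (T1 : measurableType d) (T2 : measurableType d') (R : realType).
Variables (m : {measure set T1 -> \bar R}) (f : T1 -> T2).
Hypothesis mf : measurable_fun [set: T1] f.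

Definition image_measure of measurable_fun [set: T1] f := fun A => m (f @^-1` A).

Let image_measure0 : image_measure mf set0 = 0.
Proof. by rewrite /image_measure preimage_set0 measure0. Qed.

Let image_measure_ge0 A : 0 <= image_measure mf A.
Proof. exact: measure_ge0. Qed.

Let image_measure_sigma_additive : semi_sigma_additive (image_measure mf).
Proof.
move=> F mF tF mUF; rewrite /image_measure preimage_bigcup.
apply: measure_semi_sigma_additive.
- by move=> n; rewrite -[X in measurable X]setTI; exact: mf.
- apply/trivIsetP => /= i j _ _ ij; rewrite -preimage_setI.
  by move/trivIsetP : tF => /(_ _ _ _ _ ij) ->//; rewrite preimage_set0.
- by rewrite -preimage_bigcup -[X in measurable X]setTI; exact: mf.
Qed.

HB.instance Definition _ := isMeasure.Build _ _ _ (image_measure mf)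
  image_measure0 image_measure_ge0 image_measure_sigma_additive.

End ImageMeasure.

(** * Logarithmic coordinates *)

Section LogCoordinates.
Context {R : realType}.
Local Notation lam := (@lebesgue_measure R).
Local Notation mR := (measurableTypeR R).
Local Notation lam2 := (@lebesgue_measure R \x @lebesgue_measure R)%E.

Lemma lebesgue_measure_scale (A : set mR) (k : R) : 0 < k -> measurable A ->
  lam [set x | A (k * x)] = ((k^-1)%:E * lam A)%E.
Proof.
move=> k0 mA; have k1 : k != 0 by rewrite gt_eqF.
have mS : measurable_fun setT (fun x : mR => (k * x : mR)) by apply: measurable_funM.
pose kn := NngNum (ltW k0).
have -> : lam A = image_measure (mscale kn lam) mS A.
  apply: lebesgue_measure_unique => // _ [[c e] _ <-].
  rewrite /image_measure /mscale.
  transitivity (k%:E * lam `](c / k)%R, (e / k)%R]%classic)%E; last first.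
    congr (_ * lam _)%E; apply/seteqP; split=> x /=;
      by rewrite !in_itv /= ltr_pdivrMr // ler_pdivlMr // (mulrC x).
  rewrite !lebesgue_measure_itv /= !lte_fin ltr_pM2r ?invr_gt0 //.
  case: ifP => _; last by rewrite mule0.
  by rewrite -!EFinB -EFinM; congr EFin; field.
by rewrite /image_measure /mscale /= muleA -EFinM mulVf // mul1e.
Qed.

Lemma measurable_gt0 : measurable ([set y | 0 < y] : set mR).
Proof.
have -> : [set y : mR | 0 < y] = `]0, +oo[%classic.
  by apply/seteqP; split=> y /=; rewrite in_itv /= andbT.
exact: measurable_itv.
Qed.

Lemma measurable_expRln (c : R) :
  measurable_fun setT (fun y : mR => (expR (c * ln y) : mR)).
Proof.
apply: measurableT_comp; first exact: measurable_expR.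
by apply: measurable_funM => //; exact: measurable_ln.
Qed.

(** dy / y becomes du for u = ln y. The factor [expR (-1 * ln y)] is 1 / y for positive y and is
    measurable on the whole line. *)
Lemma integral_ln_preimage (B : set mR) : measurable B ->
  (\int[lam]_(y in [set y | (0 < y)%R] `&` (fun y => B (ln y))) (expR (-1 * ln y))%:E)%E
  = lam B.
Proof.
move=> mB.
have mf : measurable_fun setT (fun y : mR => (expR (-1 * ln y))%:E).
  by apply/measurable_EFinP; apply: measurable_expRln.
have f0 : forall y : mR, (0 <= (expR (-1 * ln y))%:E)%E by move=> y; rewrite lee_fin expR_ge0.
have ml : measurable_fun setT (@ln R : mR -> mR) by exact: measurable_ln.
rewrite -[LHS]/(image_measure (density_measure lam mf f0 measurable_gt0) ml B).
apply/esym/lebesgue_measure_unique => //.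
move=> _ [[a b] _ <-]; rewrite lebesgue_measure_itv /= lte_fin.
rewrite /image_measure /density_measure.
have -> : [set y : mR | 0 < y] `&` (@ln R : mR -> mR) @^-1` `]a, b] =
    `](expR a), (expR b)]%classic.
  apply/seteqP; split=> y /=; rewrite !in_itv /=.
    by move=> [y0]; rewrite -{3 4}(lnK y0) ltr_expR ler_expR.
  move=> /andP[h1 h2]; have y0 : 0 < y by apply: lt_trans h1; exact: expR_gt0.
  by split=> //; rewrite -ltr_expR -ler_expR lnK // h1.
case: ifPn => [ab|]; last first.
  rewrite -leNgt => ba; rewrite set_itv_ge ?integral_set0 //.
  by rewrite bnd_simp -leNgt ler_expR.
rewrite integral_itv_obnd_cbnd; last exact: measurable_funTS.
have pos x : x \in `[expR a, expR b] -> 0 < x.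
  by rewrite in_itv /= => /andP[h _]; apply: lt_le_trans h; exact: expR_gt0.
rewrite (@continuous_FTC2 R (fun y => expR (-1 * ln y)) (@ln R)); last 4 first.
- by rewrite ltr_expR.
- apply: continuous_in_subspaceT => x /set_mem /pos x0.
  apply: continuous_comp; last exact: continuous_expR.
  by apply: cvgM; [exact: cvg_cst|exact: continuous_ln].
- split.
  + by move=> x xab; apply: ex_derive; apply: is_derive1_ln; apply: pos;
      apply: subset_itv_oo_cc.
  + by apply: cvg_at_right_filter; apply: continuous_ln; exact: expR_gt0.
  + by apply: cvg_at_left_filter; apply: continuous_ln; exact: expR_gt0.
- move=> x xab; have x0 : 0 < x by apply: pos; apply: subset_itv_oo_cc.
  rewrite derive1E; have -> := @derive_val _ _ _ _ _ _ _ (is_derive1_ln x0).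
  by rewrite mulN1r expRN lnK.
by rewrite !expRK -EFinB.
Qed.

End LogCoordinates.

Section HyperbolicAreaInvariance.
Context {R : realType}.
Local Notation lam := (@lebesgue_measure R).
Local Notation mR := (measurableTypeR R).
Local Notation lam2 := (@lebesgue_measure R \x @lebesgue_measure R)%E.
Implicit Types (A E : set (mR * mR)) (g : 'M[R]_2).

Lemma measurable_uhp : measurable (@uhp R : set (mR * mR)).
Proof.
have -> : (@uhp R : set (mR * mR)) = setT `*` [set y | 0 < y].
  by apply/seteqP; split=> z; [split|case].
by apply: measurableX => //; exact: measurable_gt0.
Qed.

Lemma lam2E E : measurable E -> lam2 E = (\int[lam]_y lam (ysection E y))%E.
Proof.
move=> mE; rewrite -[RHS]/((lam \x^ lam)%E E).
by apply: product_measure_unique => // B C mB mC; exact: product_measure2E.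
Qed.

Lemma measurable_preimageT d d' (T : measurableType d) (U : measurableType d')
  (f : T -> U) (B : set U) : measurable_fun setT f -> measurable B ->
  measurable (f @^-1` B).
Proof. by move=> mf mB; rewrite -[X in measurable X]setTI; exact: mf. Qed.

Lemma lam2_hshear E (s : R) (q : mR -> mR) : s = 1 \/ s = -1 ->
  measurable_fun setT q -> measurable E ->
  let F : set (mR * mR) := [set p | E (s * p.1 + q p.2, p.2)] in
  measurable F /\ lam2 F = lam2 E.
Proof.
move=> hs mq mE F.
have mF : measurable F.
  apply: (measurable_preimageT (f := fun p : mR * mR => (s * p.1 + q p.2, p.2) : mR * mR)) mE.
  apply: measurable_fun_pair => //; apply: measurable_funD.
    by apply: measurable_funM => //; exact: measurable_fst.
  by apply: measurableT_comp => //; exact: measurable_snd.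
split=> //; rewrite !lam2E //; apply: eq_integral => y _.
rewrite -(lebesgue_measure_affine (q y) hs (measurable_ysection y mE)).
by congr lam; apply/seteqP; split=> x; rewrite /ysection /= !in_setE.
Qed.

Lemma lam2_vshear E (s : R) (q : mR -> mR) : s = 1 \/ s = -1 ->
  measurable_fun setT q -> measurable E ->
  let F : set (mR * mR) := [set p | E (p.1, s * p.2 + q p.1)] in
  measurable F /\ lam2 F = lam2 E.
Proof.
move=> hs mq mE F.
have mF : measurable F.
  apply: (measurable_preimageT (f := fun p : mR * mR => (p.1, s * p.2 + q p.1) : mR * mR)) mE.
  apply: measurable_fun_pair => //; apply: measurable_funD.
    by apply: measurable_funM => //; exact: measurable_snd.
  by apply: measurableT_comp => //; exact: measurable_fst.
split=> //; apply: eq_integral => x _ /=.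
rewrite -(lebesgue_measure_affine (q x) hs (measurable_xsection x mE)).
by congr lam; apply/seteqP; split=> y; rewrite /xsection /= !in_setE.
Qed.

(* In the coordinates [(x / y, ln y)] the hyperbolic area is Lebesgue measure. *)
Definition log_coord (z : mR * mR) : mR * mR :=
  (expR (-1 * ln z.2) * z.1, ln z.2).

Definition log_point (p : mR * mR) : mR * mR := (p.1 * expR p.2, expR p.2).

Lemma measurable_log_coord : measurable_fun setT log_coord.
Proof.
have m2 : measurable_fun setT (snd : mR * mR -> mR) by exact: measurable_snd.
have m1 : measurable_fun setT (fst : mR * mR -> mR) by exact: measurable_fst.
apply: measurable_fun_pair.
  apply: measurable_funM => //.
  exact: (measurableT_comp (measurable_expRln (-1)) m2).
exact: (measurableT_comp (@measurable_ln R) m2).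
Qed.

Lemma measurable_log_point : measurable_fun setT log_point.
Proof.
have m2 : measurable_fun setT (fun p : mR * mR => expR p.2 : mR).
  by apply: measurableT_comp; [exact: measurable_expR|exact: measurable_snd].
by apply: measurable_fun_pair => //; apply: measurable_funM => //; exact: measurable_fst.
Qed.

Lemma log_pointK z : uhp z -> log_point (log_coord z) = z.
Proof.
case: z => x y; rewrite /uhp /= => y0; rewrite /log_point /log_coord /=.
by rewrite mulN1r expRN lnK // mulrAC mulVf ?gt_eqF // mul1r.
Qed.

(** With x = m y and y = exp u one has dx dy = y^2 dm du. Over a rectangle the x-integral
    contributes a factor y, and the remaining dy / y is Lebesgue measure in u; rectangles determine
    the product measure. *)
Lemma hyp_area_log_coord E : measurable E ->
  hyp_area (uhp `&` log_coord @^-1` E) = lam2 E.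
Proof.
move=> mE.
have mf : measurable_fun setT (fun z : mR * mR => (expR (-2 * ln z.2))%:E).
  apply/measurable_EFinP.
  exact: (measurableT_comp (measurable_expRln (-2)) measurable_snd).
have f0 : forall z : mR * mR, (0 <= (expR (-2 * ln z.2))%:E)%E.
  by move=> z; rewrite lee_fin expR_ge0.
have -> : hyp_area (uhp `&` log_coord @^-1` E) =
    image_measure (density_measure lam2 mf f0 measurable_uhp) measurable_log_coord E.
  rewrite /hyp_area /image_measure /density_measure; apply: eq_integral => z.
  move=> /set_mem[z0 _]; congr EFin; rewrite mulNr expRN; congr (_^-1).
  by rewrite (_ : 2 * _ = ln z.2 + ln z.2) ?expRD ?lnK //; ring.
apply/esym/product_measure_unique => // A B mA mB.
transitivity (\int[lam2]_(z in uhp `&` log_coord @^-1` (A `*` B)) (expR (-2 * ln z.2))%:E)%E => //.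
rewrite integral_mkcond.
pose S : set (mR * mR) := uhp `&` log_coord @^-1` (A `*` B).
have mS : measurable S.
  apply: measurableI; first exact: measurable_uhp.
  by apply: measurable_preimageT measurable_log_coord _; exact: measurableX.
rewrite fubini_tonelli2; last 2 first.
- by apply/(measurable_restrictT _ mS)/measurable_funTS.
- by move=> z; rewrite patchE; case: ifP.
rewrite /fubini_G.
have inner y : (\int[lam]_x ((fun z : mR * mR => (expR (-2 * ln z.2))%:E) \_ S) (x, y) =
    ((fun y => (expR (-1 * ln y))%:E) \_ ([set y | (0 < y)%R] `&` (fun y => B (ln y)))) y
    * lam A)%E.
  rewrite [in RHS]patchE; case: ifPn => [|ny].
    move=> /set_mem[y0 By].
    transitivity (\int[lam]_(x in [set x | A ((expR (-1 * ln y)) * x)%R]) (expR (-2 * ln y))%:E)%E.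
      rewrite [in RHS]integral_mkcond; apply: eq_integral => x _.
      rewrite !patchE; congr (if _ then _ else _).
      by apply/idP/idP => /set_mem h; apply/mem_set; [case: h => _ []|split].
    have mA' : measurable [set x : mR | A (expR (-1 * ln y) * x)].
      have := measurable_affine (expR (-1 * ln y)) 0 mA.
      by congr measurable; apply/seteqP; split=> x /=; rewrite addr0.
    rewrite integral_cst //.
    transitivity ((expR (-2 * ln y))%:E * (((expR (-1 * ln y))^-1)%:E * lam A))%E.
      by congr (_ * _)%E; apply: lebesgue_measure_scale => //; exact: expR_gt0.
    rewrite muleA -EFinM; congr (_%:E * _)%E.
    by rewrite -expRN -expRD; congr expR; ring.
  rewrite mul0e; apply: integral0_eq => x _; rewrite patchE; case: ifPn => //.
  by move=> /set_mem[y0 [_ By]]; case/negP: ny; apply/mem_set.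
under eq_integral do rewrite inner.
rewrite ge0_integralZr //; last 2 first.
- have mD : measurable ([set y : mR | 0 < y] `&` (fun y => B (ln y))).
    apply: measurableI; first exact: measurable_gt0.
    by apply: (measurable_preimageT (f := @ln R : mR -> mR)) => //; exact: measurable_ln.
  apply/(measurable_restrictT _ mD); apply: measurable_funTS; apply/measurable_EFinP; exact: measurable_expRln.
- by move=> y _; rewrite patchE; case: ifP => // _; rewrite lee_fin expR_ge0.
by rewrite -integral_mkcond integral_ln_preimage // muleC.
Qed.

Lemma hyp_area_log A : measurable A -> A `<=` uhp ->
  measurable (log_point @^-1` A) /\ hyp_area A = lam2 (log_point @^-1` A).
Proof.
move=> mA Au; have mE : measurable (log_point @^-1` A).
  by apply: measurable_preimageT measurable_log_point _.
split=> //; rewrite -hyp_area_log_coord //; congr hyp_area.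
apply/seteqP; split=> z.
  by move=> Az; have z0 := Au _ Az; split=> //=; rewrite log_pointK.
by move=> [z0] /=; rewrite log_pointK.
Qed.

Definition area_preserving (T : R * R -> R * R) :=
  (forall z, uhp z -> uhp (T z)) /\
  forall A, measurable A -> A `<=` uhp ->
    measurable (uhp `&` T @^-1` A : set (mR * mR)) /\ hyp_area (uhp `&` T @^-1` A) = hyp_area A.

Lemma area_preserving_log T (S : mR * mR -> mR * mR) :
  (forall z, uhp z -> uhp (T z)) ->
  (forall p, T (log_point p) = log_point (S p)) ->
  (forall E, measurable E -> measurable (S @^-1` E) /\ lam2 (S @^-1` E) = lam2 E) ->
  area_preserving T.
Proof.
move=> Tu TS Sp; split=> // A mA Au.
have [mE ->] := hyp_area_log mA Au.
have [mSE <-] := Sp _ mE.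
have -> : uhp `&` T @^-1` A = uhp `&` log_coord @^-1` (S @^-1` (log_point @^-1` A)).
  by apply/seteqP; split=> z [z0] /= h; split=> //; move: h;
    rewrite -TS log_pointK.
split; last exact: hyp_area_log_coord.
apply: measurableI; first exact: measurable_uhp.
exact: measurable_preimageT measurable_log_coord _.
Qed.

Lemma area_preserving_translation (b : R) :
  area_preserving (fun z => (z.1 + b, z.2)).
Proof.
apply: (area_preserving_log (S := fun p => (1 * p.1 + expR (-1 * p.2) * b, p.2))).
- by move=> z.
- move=> [m u]; rewrite /log_point /=; congr (_, _).
  by rewrite mul1r mulrDl mulrAC -expRD mulN1r addNr expR0 mul1r.
- move=> E mE; apply: (lam2_hshear (q := fun u => expR (-1 * u) * b)) => //; first by left.
  apply: measurable_funM => //; apply: measurableT_comp; first exact: measurable_expR.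
  exact: measurable_funM.
Qed.

Lemma area_preserving_dilation (k : R) : 0 < k ->
  area_preserving (fun z => (k * z.1, k * z.2)).
Proof.
move=> k0.
apply: (area_preserving_log (S := fun p => (p.1, 1 * p.2 + ln k))).
- by move=> z; rewrite /uhp /=; exact: mulr_gt0.
- by move=> [m u]; rewrite /log_point /= mul1r expRD lnK //; congr (_, _); ring.
- by move=> E mE; apply: (lam2_vshear (q := fun=> ln k)) => //; left.
Qed.

Lemma area_preserving_comp T1 T2 : area_preserving T1 -> area_preserving T2 ->
  area_preserving (T1 \o T2).
Proof.
move=> [u1 a1] [u2 a2]; split=> [z z0|A mA Au]; first exact/u1/u2.
have [m1 e1] := a1 A mA Au; have [m2 e2] := a2 _ m1 (@subIsetl _ uhp (T1 @^-1` A)).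
have E : uhp `&` (T1 \o T2) @^-1` A = uhp `&` T2 @^-1` (uhp `&` T1 @^-1` A).
  by apply/seteqP; split=> z [z0]; [split=> //; split=> //; exact: u2|move=> [_]; split].
by rewrite E e2.
Qed.

(** In logarithmic coordinates the inversion sends (m, u) to (- m, - u - ln(1 + m^2)), a vertical
    shear with reflection followed by a reflection. Translations and dilations are shears as
    well. *)
Lemma area_preserving_inversion :
  area_preserving (fun z => (- z.1 / (z.1 ^+ 2 + z.2 ^+ 2), z.2 / (z.1 ^+ 2 + z.2 ^+ 2))).
Proof.
have pos (m : R) : 0 < 1 + m ^+ 2 by rewrite ltr_wpDr ?sqr_ge0.
pose S1 (p : mR * mR) : mR * mR := (p.1, -1 * p.2 - ln (1 + p.1 ^+ 2)).
pose S2 (p : mR * mR) : mR * mR := (-1 * p.1 + 0, p.2).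
apply: (area_preserving_log (S := S2 \o S1)).
- move=> z z0; rewrite /uhp /=; apply: divr_gt0 => //.
  by apply: ltr_wpDl; [exact: sqr_ge0|rewrite exprn_gt0].
- move=> [m u]; rewrite /log_point /S2 /S1 /= addr0 mulN1r mulN1r.
  rewrite expRD !expRN lnK ?posrE //; have e0 : expR u != 0 by rewrite gt_eqF ?expR_gt0.
  have p0 : 1 + m ^+ 2 != 0 by rewrite gt_eqF.
  have -> : (m * expR u) ^+ 2 + expR u ^+ 2 = (1 + m ^+ 2) * expR u ^+ 2 by ring.
  by congr (_, _); field; rewrite e0 p0.
- move=> E mE.
  have [m2 e2] := lam2_hshear (q := fun=> 0) (or_intror erefl) (@measurable_cst _ _ _ _ _ _) mE.
  have mq : measurable_fun setT (fun m : mR => (- ln (1 + m ^+ 2)) : mR).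
    apply: measurableT_comp => //; apply: measurableT_comp; first exact: measurable_ln.
    by apply: measurable_funD => //; exact: measurable_funX.
  have [m1 e1] := lam2_vshear (or_intror erefl) mq m2.
  by split; [exact: m1|rewrite -e2 -e1].
Qed.

(** (a z + b) / (c z + d) equals a / c - 1 / (c^2 (z + d / c)) for c nonzero and a^2 z + a b for c =
    0, a composition of the maps above. *)
Lemma area_preserving_moebius g : \det g = 1 -> area_preserving (moebius g).
Proof.
move=> dg; have ext T1 T2 : (forall z, uhp z -> T1 z = T2 z) -> area_preserving T1 ->
    area_preserving T2.
  move=> e [u1 a1]; split=> [z z0|A mA Au]; first by rewrite -e //; exact: u1.
  have -> : uhp `&` T2 @^-1` A = uhp `&` T1 @^-1` A; last exact: a1.
  by apply/seteqP; split=> z [z0] /= h; split=> //=; move: h; rewrite e.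
have := dg; rewrite det2E => d.
have [c0|c0] := eqVneq (g 1 0) 0.
  rewrite c0 mulr0 subr0 in d.
  have a0 : g 0 0 != 0 by apply: contra_eq_neq d => ->; rewrite mul0r eq_sym oner_neq0.
  have g11 : g 1 1 = (g 0 0)^-1 by apply: (mulfI a0); rewrite d divff.
  apply: (ext _ _ _ (area_preserving_comp (area_preserving_translation (g 0 0 * g 0 1))
    (area_preserving_dilation (_ : 0 < g 0 0 ^+ 2)))).
    by move=> [x y] _; rewrite /moebius /= c0 g11; congr (_, _); field.
  by rewrite exprn_even_gt0.
pose c := g 1 0.
apply: (ext _ _ _ (area_preserving_comp (area_preserving_translation (g 0 0 / c))
  (area_preserving_comp (area_preserving_dilation (_ : 0 < c ^- 2))
  (area_preserving_comp area_preserving_inversion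
    (area_preserving_translation (g 1 1 / c)))))); last first.
  by rewrite invr_gt0 exprn_even_gt0.
move=> [x y]; rewrite /uhp /= => y0; have b : g 0 1 = (g 0 0 * g 1 1 - 1) / c.
  by apply: (mulIf c0); rewrite divfK // -d; ring.
have n0 := moebius_den_gt0 dg (y0 : uhp (x, y)); move: n0; rewrite /moebius /= b /c.
set n := (_ ^+ 2 + _ ^+ 2) => n0.
have -> : (x + g 1 1 / g 1 0) ^+ 2 + y ^+ 2 = n / g 1 0 ^+ 2 by rewrite /n; field.
have n1 : n != 0 by rewrite gt_eqF.
congr (_, _); last by field; rewrite n1 c0.
apply: (mulIf n1); rewrite mulrDl divfK //.
have -> : g 1 0 ^- 2 * (- (x + g 1 1 / g 1 0) / (n / g 1 0 ^+ 2)) * n = - (x + g 1 1 / g 1 0).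
  by field; rewrite n1 c0.
by rewrite /n; field.
Qed.

Lemma hyp_area_moebius g A : \det g = 1 -> measurable A -> A `<=` uhp ->
  measurable (moebius g @` A : set (mR * mR)) /\ hyp_area (moebius g @` A) = hyp_area A.
Proof.
move=> dg mA Au; have [_ h] := area_preserving_moebius (det1V dg).
have -> : moebius g @` A = uhp `&` moebius g^-1 @^-1` A; last exact: h.
apply/seteqP; split=> [_ [z Az <-]|z [z0 Az]].
  have z0 := Au _ Az; split; first exact: moebius_uhp.
  by rewrite /= moebiusK.
by exists (moebius g^-1 z) => //; rewrite moebiusVK.
Qed.

End HyperbolicAreaInvariance.

(** Removing from each set its overlaps with earlier ones makes the sets disjoint and changes no
    measure. *)
Lemma nneseries_measure_null_overlap d (T : measurableType d) (R : realType)
    (mu : {measure set T -> \bar R}) (Y : (set T)^nat) :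
  (forall n, measurable (Y n)) ->
  (forall m n, m <> n -> mu (Y m `&` Y n) = 0%E) ->
  (\sum_(0 <= n <oo) mu (Y n) <= mu (\bigcup_n Y n))%E.
Proof.
move=> mY Y0; have mD n : measurable (seqDU Y n).
  by apply: measurableD => //; apply: bigsetU_measurable => i _.
rewrite seqDU_bigcup_eq (measure_bigcup _ setT) //.
rewrite [leRHS](_ : _ = \sum_(0 <= n <oo) mu (seqDU Y n))%E; last first.
  by apply: eq_eseriesl => n; rewrite in_setT.
apply: lee_nneseries => // n _.
pose Z m := if (m < n)%N then Y m `&` Y n else set0.
have mZ m : measurable (Z m) by rewrite /Z; case: ifP => // _; exact: measurableI.
have Z0 m : mu (Z m) = 0%E.
  rewrite /Z; case: ifP => [mn|_]; last exact: measure0.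
  by apply: Y0 => e; rewrite e ltnn in mn.
have sub : Y n `<=` seqDU Y n `|` \bigcup_m Z m.
  move=> x Yx; have [[m mn Ym]|h] := pselect (exists2 m, (m < n)%N & Y m x).
    by right; exists m => //; rewrite /Z mn.
  left; split=> //; rewrite -bigcup_mkord => -[m /= mn Ym]; apply: h; by exists m.
have mZU : measurable (\bigcup_m Z m) by exact: bigcup_measurable.
have ZU0 : mu (\bigcup_m Z m) = 0%E.
  apply/eqP; rewrite eq_le measure_ge0 andbT.
  apply: le_trans (measure_sigma_subadditive mu mZ mZU (@subset_refl _ _)) _.
  by rewrite eseries0 // => i _ _; exact: Z0.
apply: (@le_trans _ _ (mu (seqDU Y n `|` \bigcup_m Z m))).
  by apply: le_measure => //; apply/mem_set => //; exact: measurableU.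
apply: (le_trans (measureU2 _ _ _)) => //.
by rewrite [X in (_ + X)%E](_ : _ = 0%E) // adde0.
Qed.

(** * Comparison of packing and covering sets *)

Section HyperbolicMeasure.
Context {R : realType}.
Local Notation lam := (@lebesgue_measure R).
Local Notation mR := (measurableTypeR R).
Local Notation lam2 := (@lebesgue_measure R \x @lebesgue_measure R)%E.
Implicit Types (A B N : set (mR * mR)) (g : 'M[R]_2).

(** Equal to [z.2 ^- 2] on the half-plane, in a form that is measurable on the whole plane. *)
Definition hyp_density (z : mR * mR) : \bar R := (expR (-2 * ln z.2))%:E.

Lemma measurable_hyp_density : measurable_fun setT hyp_density.
Proof.
apply/measurable_EFinP.
exact: (measurableT_comp (measurable_expRln (-2)) measurable_snd).
Qed.

Lemma hyp_density_ge0 z : (0 <= hyp_density z)%E.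
Proof. by rewrite lee_fin expR_ge0. Qed.

Lemma hyp_densityE z : uhp z -> hyp_density z = (z.2 ^- 2)%:E.
Proof.
move=> z0; rewrite /hyp_density mulNr expRN; congr (_^-1%:E).
by rewrite (_ : 2 * _ = ln z.2 + ln z.2) ?expRD ?lnK //; ring.
Qed.

Definition hyp_measure :=
  density_measure lam2 measurable_hyp_density hyp_density_ge0 measurable_uhp.

Lemma hyp_areaE A : A `<=` uhp -> hyp_area A = hyp_measure A.
Proof.
move=> Au; rewrite /hyp_area /hyp_measure /density_measure (setIidr Au).
by apply: eq_integral => z /set_mem /Au /hyp_densityE.
Qed.

Lemma hyp_area_le A B : measurable A -> measurable B -> B `<=` uhp -> A `<=` B ->
  (hyp_area A <= hyp_area B)%E.
Proof.
move=> mA mB Bu AB; rewrite !hyp_areaE //; last exact: subset_trans Bu.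
by apply: le_measure => //; exact/mem_set.
Qed.

Variable G : psl2_subgroup R.

(* The pieces cut out of B by the translates of A overlap in null sets and,
   moved back, fill A. *)
Lemma hyp_area_pack_le_cover (iota : 'M[R]_2 -> nat) A B N :
  (forall g h, G g -> G h -> iota g = iota h -> g = h) ->
  measurable A -> measurable B -> measurable N -> A `<=` uhp -> B `<=` uhp ->
  (forall g, G g -> g <> 1 -> g <> -1 -> hyp_area (A `&` moebius g @` A) = 0%E) ->
  (forall z, uhp z -> exists2 g, G g & B (moebius g z)) ->
  (forall g z, G g -> uhp z -> N z -> N (moebius g z)) ->
  (hyp_area (A `&` N) <= hyp_area (B `&` N))%E.
Proof.
move=> inj mA mB mN Au Bu packA covB Ninv.
have mbu g C : G g -> C `<=` uhp -> moebius g @` C `<=` uhp.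
  by move=> Gg Cu _ [z /Cu z0 <-]; exact: moebius_uhp (psl2_det Gg) z0.
have mbm g C : G g -> measurable C -> C `<=` uhp ->
    measurable (moebius g @` C : set (mR * mR)).
  by move=> Gg mC Cu; have [] := hyp_area_moebius (psl2_det Gg) mC Cu.
(* Selects one of g and - g, which act alike and must be counted once. *)
pose pos g := (0 < g 1 0) || ((g 1 0 == 0) && (0 < g 1 1)).
have posN g : G g -> pos g \/ pos (- g).
  move=> /psl2_det dg; rewrite /pos !mxE oppr_eq0 !oppr_gt0.
  case: (ltrgt0P (g 1 0)) => [?|?|c0] /=; [by left|by right|].
  case: (ltrgt0P (g 1 1)) => [?|?|d0] /=; [by left|by right|].
  by move: dg; rewrite det2E c0 d0 !mulr0 subrr => /eqP; rewrite eq_sym oner_eq0.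
have posNN g : pos g -> ~ pos (- g).
  rewrite /pos !mxE oppr_eq0 !oppr_gt0; case: (ltrgt0P (g 1 0)) => //= _.
  by case: (ltrgt0P (g 1 1)).
(* A partial inverse of the index, so that sums over G run over the natural numbers; [act] marks the
   indices that occur. *)
pose el n := xget 1 [set g | [/\ G g, pos g & iota g = n]].
have elE g : G g -> pos g -> el (iota g) = g.
  move=> Gg pg; rewrite /el; case: xgetP => [h _ [Gh _ /inj]|/(_ g)]; first exact.
  by case.
have Gel n : G (el n).
  by rewrite /el; case: xgetP => [h _ []//|_]; exact: psl2_1.
pose act n := `[< [/\ pos (el n) & iota (el n) = n] >].
have GV n : G (el n)^-1 by exact: psl2_inv.
pose Y n : set (mR * mR) := if act n then moebius (el n) @` A `&` (B `&` N) else set0.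
pose X n : set (mR * mR) := if act n then A `&` N `&` moebius (el n)^-1 @` B else set0.
have mX n : measurable (X n).
  rewrite /X; case: ifP => // _; apply: measurableI; first exact: measurableI.
  exact: mbm.
have mY n : measurable (Y n).
  rewrite /Y; case: ifP => // _; apply: measurableI; last exact: measurableI.
  exact: mbm.
have Xu n : X n `<=` uhp by rewrite /X; case: ifP => _ z //; move=> [[Az _] _]; exact: Au.
have Yu n : Y n `<=` uhp by rewrite /Y; case: ifP => _ z //; move=> [_ [Bz _]]; exact: Bu.
have XY n : hyp_area (X n) = hyp_area (Y n).
  rewrite /X /Y; case: ifP => // _.
  have dg := psl2_det (Gel n).
  have mX' : measurable (A `&` N `&` moebius (el n)^-1 @` B : set (mR * mR)).
    by apply: measurableI; [exact: measurableI|exact: mbm].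
  have Xu' : A `&` N `&` moebius (el n)^-1 @` B `<=` uhp by move=> z [[Az _] _]; exact: Au.
  have [_ <-] := hyp_area_moebius dg mX' Xu'; congr hyp_area.
  apply/seteqP; split=> z.
    move=> [w [[Aw Nw] [y By yw]] <-]; have y0 := Bu _ By.
    split; first by exists w.
    split; first by rewrite -yw moebiusVK.
    by apply: Ninv => //; exact: Au.
  move=> [[w Aw <-] [Bw Nw]]; have w0 := Au _ Aw.
  exists w => //; split; last by exists (moebius (el n) w) => //; rewrite moebiusK.
  by split=> //; rewrite -(moebiusK dg w0); apply: Ninv => //; exact: moebius_uhp.
have cov : A `&` N `<=` \bigcup_n X n.
  move=> z [Az Nz]; have z0 := Au _ Az; have [g Gg Bg] := covB _ z0.
  have [h [Gh ph Bh]] : exists h, [/\ G h, pos h & B (moebius h z)].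
    have [pg|pg] := posN _ Gg; first by exists g.
    by exists (- g); split; rewrite ?moebiusN //; exact: psl2_opp.
  exists (iota h) => //; rewrite /X /act elE // asboolT //.
  split=> //; exists (moebius h z) => //; exact: moebiusK (psl2_det Gh) z0.
have mXU : measurable (\bigcup_n X n) by exact: bigcup_measurable.
have mYU : measurable (\bigcup_n Y n) by exact: bigcup_measurable.
have overlap m n : m <> n -> hyp_measure (Y m `&` Y n) = 0%E.
  move=> mn; rewrite -hyp_areaE; last by move=> z [Yz _]; exact: Yu Yz.
  rewrite /Y; case: ifPn => [/asboolP[pm im]|_]; last first.
    by rewrite set0I hyp_areaE // measure0.
  case: ifPn => [/asboolP[pn in_]|_]; last by rewrite setI0 hyp_areaE // measure0.
  have dm := psl2_det (Gel m); have dn := psl2_det (Gel n).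
  pose h := (el m)^-1 * el n; have Gh : G h by exact: psl2_mul.
  have elh : el n = el m * h by rewrite /h mulrA mulrV ?unit_det1 // mul1r.
  have h1 : h <> 1.
    by move=> e; apply: mn; rewrite -im -in_ elh e mulr1.
  have hN : h <> -1.
    by move=> e; apply: (posNN (el m)) => //; rewrite elh e mulrN1 in pn.
  have mAh : measurable (A `&` moebius h @` A : set (mR * mR)).
    by apply: measurableI => //; exact: mbm.
  have Ahu : A `&` moebius h @` A `<=` uhp by move=> z [Az _]; exact: Au.
  have [mI eI] := hyp_area_moebius dm mAh Ahu.
  apply/eqP; rewrite eq_le; apply/andP; split; last first.
    by rewrite hyp_areaE ?measure_ge0 // => z [[_ [Bz _]] _]; exact: Bu.
  rewrite -(packA h Gh h1 hN) -eI; apply: hyp_area_le => //.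
  - by do !apply: measurableI => //; exact: mbm.
  - exact: mbu.
  - move=> z [[[x Ax <-] _] [[y Ay e] _]]; exists x => //; split=> //.
    exists y => //; have y0 := Au _ Ay; have x0 := Au _ Ax.
    rewrite -(moebiusK dm x0) -e elh moebiusM ?(psl2_det Gh) // moebiusK //.
    exact: moebius_uhp (psl2_det Gh) y0.
have ANu : A `&` N `<=` uhp by move=> z [Az _]; exact: Au.
have BNu : B `&` N `<=` uhp by move=> z [Bz _]; exact: Bu.
rewrite !hyp_areaE //.
apply: le_trans (measure_sigma_subadditive hyp_measure mX (measurableI _ _ mA mN) cov) _.
rewrite (eq_eseriesr (g := fun n => hyp_measure (Y n))); last first.
  by move=> n _; have := XY n; rewrite (hyp_areaE (@Xu n)) (hyp_areaE (@Yu n)).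
apply: le_trans (nneseries_measure_null_overlap mY overlap) _.
apply: le_measure; [exact/mem_set|by apply/mem_set; exact: measurableI|].
by move=> z [n _]; rewrite /Y; case: ifP => _ // [].
Qed.

End HyperbolicMeasure.

(** * Area of the modular triangle *)

Section ModularDomainArea.
Context {R : realType}.
Local Notation lam := (@lebesgue_measure R).
Local Notation mR := (measurableTypeR R).
Local Notation lam2 := (@lebesgue_measure R \x @lebesgue_measure R)%E.
Implicit Types (S : set (mR * mR)) (I : set mR).

Lemma integral_sqrV_tail (c : R) (b : bool) : 0 < c ->
  (\int[lam]_(y in [set` Interval (BSide b c) +oo%O]) hyp_density (0%R, y))%E = (c^-1)%:E.
Proof.
move=> c0.
have mh D : measurable_fun D (fun y : mR => hyp_density (0, y)).
  apply: measurable_funTS; apply/measurable_EFinP; exact: (measurable_expRln (-2)).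
have -> : (\int[lam]_(y in [set` Interval (BSide b c) +oo%O]) hyp_density (0%R, y))%E =
    (\int[lam]_(y in `[c, +oo[) hyp_density (0%R, y))%E.
  by case: b => //; rewrite integral_itv_obnd_cbnd //; exact: mh.
have pos x : c <= x -> 0 < x by exact: lt_le_trans.
have dF (x : R) : 0 < x -> is_derive x 1 (fun y : R => - y^-1) (x ^- 2).
  move=> x0; have x1 : id x != 0 by rewrite gt_eqF.
  have h := is_deriveN (is_deriveV x1 (is_derive_id x 1)).
  by apply: is_derive_eq h _; rewrite scaleNr opprK /GRing.scale /= mulr1.
have cV (x : R) : 0 < x -> (y^-1 @[y --> x] --> x^-1).
  by move=> x0; apply: cvgV; [rewrite gt_eqF|exact: cvg_id].
transitivity (\int[lam]_(y in `[c, +oo[) (y ^- 2)%:E)%E.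
  apply: eq_integral => y /set_mem /=; rewrite in_itv /= andbT => /pos y0.
  by rewrite hyp_densityE.
rewrite (@ge0_continuous_FTC2y R (fun y => y ^- 2) (fun y => - y^-1) c 0).
- by rewrite -EFinB sub0r opprK.
- by move=> x _; rewrite invr_ge0 sqr_ge0.
- apply: continuous_in_subspaceT => x /set_mem /=; rewrite in_itv /= andbT => /pos x0.
  by apply: cvgV; [rewrite gt_eqF // exprn_gt0|exact: exprn_continuous].
- rewrite -oppr0; apply: cvgN.
  apply/gtr0_cvgV0; first by exists 0; split => //.
  exact: cvg_id.
- by move=> x /ltW /pos x0; apply: ex_derive; exact: dF.
- by apply: cvg_at_right_filter; apply: cvgN; exact: cV.
- move=> x; rewrite in_itv /= andbT => /ltW /pos x0; rewrite derive1E.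
  exact: (@derive_val _ _ _ _ _ _ _ (dF x x0)).
Qed.

Lemma hyp_area_above S I (c : mR -> R) (b : bool) :
  measurable S -> measurable I -> S `<=` uhp -> (forall x, I x -> 0 < c x) ->
  (forall x y, S (x, y) <-> I x /\ [set` Interval (BSide b (c x)) +oo%O] y) ->
  hyp_area S = (\int[lam]_(x in I) (c x)^-1%:E)%E.
Proof.
move=> mS mI Su cpos SE; rewrite hyp_areaE // /hyp_measure /density_measure.
rewrite (setIidr Su) integral_mkcond fubini_tonelli1; last 2 first.
- apply/(measurable_restrictT _ mS); apply: measurable_funTS.
  exact: measurable_hyp_density.
- by move=> z; rewrite patchE; case: ifP => // _; exact: hyp_density_ge0.
rewrite [RHS]integral_mkcond; apply: eq_integral => x _; rewrite /fubini_F patchE.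
case: ifPn => [/set_mem Ix|nI].
  rewrite -(integral_sqrV_tail b (cpos _ Ix)) [RHS]integral_mkcond.
  apply: eq_integral => y _; rewrite !patchE /=.
  rewrite (_ : ((x, y) \in S) = (y \in [set` Interval (BSide b (c x)) +oo%O])).
    by [].
  apply/idP/idP => /set_mem h; apply/mem_set; first by have [] := (SE _ _).1 h.
  by apply/SE; split.
apply: integral0_eq => y _; rewrite patchE; case: ifPn => // /set_mem /SE[Ix _].
by case/negP: nI; exact/mem_set.
Qed.

(** For a = pi / 6 the equation sin(3 a) = 1 reads 3 s - 4 s^3 = 1, that is (s + 1)(2 s - 1)^2 =
    0. *)
Lemma sin_pi6 : sin (pi / 6%:R) = 1 / 2 :> R.
Proof.
set a := pi / 6%:R; have pi0 : 0 < pi :> R := pi_gt0 R.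
have s0 : 0 < sin a by apply: sin_gt0_pi; rewrite /a; apply/andP; split; lra.
have e : a + (a + a) = pi / 2 by rewrite /a; field.
have := sin_pihalf R; rewrite -e sinD sinD cosD.
have := cos2Dsin2 a; move: (sin a) (cos a) s0 => s c s0 cs h.
have {}h : (s + 1) * (2 * s - 1) ^+ 2 = 0.
  have c2 : c ^+ 2 = 1 - s ^+ 2 by rewrite -cs; ring.
  have : 3 * s - 4 * s ^+ 3 = 1.
    apply: etrans h; transitivity (s * (c ^+ 2 - s ^+ 2) + 2 * (s * c ^+ 2)); last by ring.
    by rewrite c2; ring.
  move=> h3; have -> : (s + 1) * (2 * s - 1) ^+ 2 = 1 - (3 * s - 4 * s ^+ 3) by ring.
  by rewrite h3 subrr.
have s1 : s + 1 != 0 by rewrite gt_eqF // addr_gt0.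
by move: h => /eqP; rewrite mulf_eq0 (negPf s1) sqrf_eq0 /= => /eqP; lra.
Qed.

Lemma asin_half : asin (1 / 2) = pi / 6%:R :> R.
Proof.
rewrite -sin_pi6 sinK // in_itv /=; have := pi_gt0 R; move=> p0.
by apply/andP; split; lra.
Qed.

Lemma asinN_half : asin (- (1 / 2)) = - (pi / 6%:R) :> R.
Proof.
rewrite -sin_pi6 -sinN sinK // in_itv /=; have := pi_gt0 R; move=> p0.
by apply/andP; split; lra.
Qed.

Let asin_bnd (x : R) : x \in `[(- (1 / 2)), (1 / 2)] -> -1 < x < 1.
Proof. by rewrite in_itv /= => /andP[? ?]; apply/andP; split; lra. Qed.

Let sqr_lt1 (x : R) : -(1 / 2) <= x <= 1 / 2 -> x ^+ 2 < 1.
Proof. by move=> /andP[? ?]; nra. Qed.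

Let continuous_asin_deriv :
  {within `[(- (1 / 2)), (1 / 2)], continuous (fun x : R => (Num.sqrt (1 - x ^+ 2))^-1)}.
Proof.
apply: continuous_in_subspaceT => x /set_mem hx.
apply: cvgV; first by rewrite gt_eqF // sqrtr_gt0 subr_gt0 sqr_lt1 //; move: hx; rewrite /= in_itv.
apply: cvg_comp; last exact: sqrt_continuous.
by apply: cvgB; [exact: cvg_cst|exact: exprn_continuous].
Qed.

Lemma integral_asin : (\int[lam]_(x in `[(- (1 / 2))%R, (1 / 2)%R])
  (Num.sqrt (1 - x ^+ 2))^-1%:E)%E = (pi / 3)%:E.
Proof.
rewrite (@continuous_FTC2 R (fun x => (Num.sqrt (1 - x ^+ 2))^-1) asin).
- by rewrite asin_half asinN_half -EFinB; congr EFin; field.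
- lra.
- exact: continuous_asin_deriv.
- have ca (x : R) : -1 < x < 1 -> {for x, continuous asin}.
    move=> hx; apply: differentiable_continuous; apply/derivable1_diffP.
    by apply: ex_derive; exact: is_derive1_asin.
  split.
  + by move=> x /subset_itv_oo_cc /asin_bnd hx; apply: ex_derive; exact: is_derive1_asin.
  + by apply: cvg_at_right_filter; apply: ca; apply/andP; split; lra.
  + by apply: cvg_at_left_filter; apply: ca; apply/andP; split; lra.
- move=> x /subset_itv_oo_cc /asin_bnd hx; rewrite derive1E.
  exact: (@derive_val _ _ _ _ _ _ _ (is_derive1_asin hx)).
Qed.

(** Two versions of the modular triangle, of the same area: translates of the open one are disjoint,
    translates of the closed one cover, and each serves one of the two area inequalities. *)
Definition modular_open : set (R * R) :=
  [set z | [/\ uhp z, -(1 / 2) < z.1 < 1 / 2 & 1 < z.1 ^+ 2 + z.2 ^+ 2]].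

Definition modular_closed : set (R * R) :=
  [set z | [/\ uhp z, -(1 / 2) <= z.1 <= 1 / 2 & 1 <= z.1 ^+ 2 + z.2 ^+ 2]].

Definition cusp_zone : set (R * R) := [set z | 1 < z.2].

Lemma measurable_norm2 : measurable_fun setT (fun z : mR * mR => z.1 ^+ 2 + z.2 ^+ 2 : mR).
Proof.
by apply: measurable_funD; apply: measurable_funX; [exact: measurable_fst|exact: measurable_snd].
Qed.

Lemma measurable_modular_open : measurable (modular_open : set (mR * mR)).
Proof.
have -> : modular_open = uhp `&` fst @^-1` `](- (1 / 2)), (1 / 2)[ `&`
    (fun z : mR * mR => z.1 ^+ 2 + z.2 ^+ 2 : mR) @^-1` `]1, +oo[.
  apply/seteqP; split=> z /=; rewrite !in_itv /= andbT.
    by move=> [? ? ?].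
  by move=> [[? ?] ?].
apply: measurableI; [apply: measurableI; first exact: measurable_uhp|].
  by apply: measurable_preimageT => //; exact: measurable_fst.
by apply: measurable_preimageT => //; exact: measurable_norm2.
Qed.

Lemma measurable_modular_closed : measurable (modular_closed : set (mR * mR)).
Proof.
have -> : modular_closed = uhp `&` fst @^-1` `[(- (1 / 2)), (1 / 2)] `&`
    (fun z : mR * mR => z.1 ^+ 2 + z.2 ^+ 2 : mR) @^-1` `[1, +oo[.
  apply/seteqP; split=> z /=; rewrite !in_itv /= andbT.
    by move=> [? ? ?].
  by move=> [[? ?] ?].
apply: measurableI; [apply: measurableI; first exact: measurable_uhp|].
  by apply: measurable_preimageT => //; exact: measurable_fst.
by apply: measurable_preimageT => //; exact: measurable_norm2.
Qed.

Lemma measurable_cusp_zone : measurable (cusp_zone : set (mR * mR)).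
Proof.
have -> : (cusp_zone : set (mR * mR)) = snd @^-1` `]1, +oo[.
  by apply/seteqP; split=> z /=; rewrite in_itv /= andbT.
by apply: measurable_preimageT => //; exact: measurable_snd.
Qed.

Lemma sqrt_lt_iff (x y : R) : x ^+ 2 < 1 ->
  (0 < y /\ 1 < x ^+ 2 + y ^+ 2) <-> Num.sqrt (1 - x ^+ 2) < y.
Proof.
move=> x1; have p0 : 0 < 1 - x ^+ 2 by rewrite subr_gt0.
have s0 : 0 < Num.sqrt (1 - x ^+ 2) by rewrite sqrtr_gt0.
have e : Num.sqrt (1 - x ^+ 2) ^+ 2 = 1 - x ^+ 2 by rewrite sqr_sqrtr // ltW.
split=> [[y0 h]|h].
  by rewrite -(ltr_pXn2r (n:=2)) ?nnegrE ?(ltW s0) ?(ltW y0) // e; lra.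
have y0 : 0 < y := lt_trans s0 h; split=> //.
by have : Num.sqrt (1 - x ^+ 2) ^+ 2 < y ^+ 2; [rewrite ltr_pXn2r ?nnegrE ?(ltW s0) ?(ltW y0)|rewrite e; lra].
Qed.

Lemma sqrt_le_iff (x y : R) : x ^+ 2 < 1 ->
  (0 < y /\ 1 <= x ^+ 2 + y ^+ 2) <-> Num.sqrt (1 - x ^+ 2) <= y.
Proof.
move=> x1; have p0 : 0 < 1 - x ^+ 2 by rewrite subr_gt0.
have s0 : 0 < Num.sqrt (1 - x ^+ 2) by rewrite sqrtr_gt0.
have e : Num.sqrt (1 - x ^+ 2) ^+ 2 = 1 - x ^+ 2 by rewrite sqr_sqrtr // ltW.
split=> [[y0 h]|h].
  by rewrite -(ler_pXn2r (n:=2)) ?nnegrE ?(ltW s0) ?(ltW y0) // e; lra.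
have y0 : 0 < y := lt_le_trans s0 h; split=> //.
by have : Num.sqrt (1 - x ^+ 2) ^+ 2 <= y ^+ 2; [rewrite ler_pXn2r ?nnegrE ?(ltW s0) ?(ltW y0)|rewrite e; lra].
Qed.

(** The region lies above the unit circle, so its area is the integral of 1 / sqrt(1 - x^2) from
    -1/2 to 1/2, which is 2 asin(1/2). *)
Lemma area_modular_open : hyp_area modular_open = (pi / 3)%:E.
Proof.
rewrite (@hyp_area_above modular_open `](- (1 / 2)), (1 / 2)[%classic
  (fun x => Num.sqrt (1 - x ^+ 2)) false) //.
- rewrite -integral_asin.
  have mf : measurable_fun (`[(- (1 / 2)), (1 / 2)]%classic : set mR)
      (fun x : mR => ((Num.sqrt (1 - x ^+ 2))^-1)%:E).
    apply/measurable_EFinP; apply: subspace_continuous_measurable_fun.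
      exact: measurable_itv.
    exact: continuous_asin_deriv.
  rewrite integral_itv_obnd_cbnd; last first.
    by apply: measurable_funS mf => //; exact: subset_itv_oo_cc.
  rewrite integral_itv_bndo_bndc //.
  by apply: measurable_funS mf => //; exact: subset_itv_co_cc.
- exact: measurable_modular_open.
- by move=> z [].
- move=> x /=; rewrite in_itv /= => /andP[? ?]; rewrite sqrtr_gt0 subr_gt0.
  by apply: sqr_lt1; apply/andP; split; lra.
- move=> x y /=; rewrite !in_itv /= andbT; split.
    move=> [y0 h1 h2]; split=> //; apply/sqrt_lt_iff => //.
    by apply: sqr_lt1; move: h1 => /= /andP[? ?]; apply/andP; split; lra.
  move=> [/andP[h1 h2]] /sqrt_lt_iff [|y0 h3]; last by split=> //=; rewrite h1.
  by apply: sqr_lt1; apply/andP; split; lra.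
Qed.

Lemma area_modular_closed : hyp_area modular_closed = (pi / 3)%:E.
Proof.
rewrite (@hyp_area_above modular_closed `[(- (1 / 2)), (1 / 2)]%classic
  (fun x => Num.sqrt (1 - x ^+ 2)) true) //.
- by rewrite -integral_asin.
- exact: measurable_modular_closed.
- by move=> z [].
- by move=> x /=; rewrite in_itv /= => h; rewrite sqrtr_gt0 subr_gt0; exact: sqr_lt1.
- move=> x y /=; rewrite !in_itv /= andbT; split.
    by move=> [y0 h1 h2]; split=> //; apply/sqrt_le_iff => //; exact: sqr_lt1.
  move=> [h1] /sqrt_le_iff [|y0 h3]; last by split.
  exact: sqr_lt1.
Qed.

Lemma area_cusp_strip (a b : R) (ba bb : bool) : a <= b ->
  hyp_area [set z : R * R | z.1 \in Interval (BSide ba a) (BSide bb b) /\ 1 < z.2] = (b - a)%:E.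
Proof.
move=> ab; set I := Interval _ _.
rewrite (@hyp_area_above _ [set` I] (fun=> 1) false) //.
- under eq_integral do rewrite invr1.
  rewrite integral_cst ?mul1e; last exact: measurable_itv.
  transitivity (lebesgue_measure [set` I]) => //.
  rewrite lebesgue_measure_itv /= lte_fin; case: ifPn => // /negPf nab.
  have -> : a = b by apply/eqP; rewrite eq_le ab /= leNgt nab.
  by rewrite subrr.
- have -> : [set z : mR * mR | z.1 \in I /\ 1 < z.2] = fst @^-1` [set` I] `&` cusp_zone by [].
  apply: measurableI; last exact: measurable_cusp_zone.
  by apply: measurable_preimageT; [exact: measurable_fst|exact: measurable_itv].
- by move=> z [_ h]; exact: lt_trans h.
- by move=> x y; split=> -[h1 h2]; split=> //; move: h2; rewrite /= in_itv /= andbT.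
Qed.

Lemma area_modular_open_cusp : hyp_area (modular_open `&` cusp_zone) = 1%E.
Proof.
have -> : modular_open `&` cusp_zone = [set z : R * R |
    z.1 \in Interval (BSide false (- (1 / 2))) (BSide true (1 / 2)) /\ 1 < z.2].
  apply/seteqP; split=> z /=; rewrite in_itv /=.
    by move=> [[]].
  move=> [h z1]; split=> //; split=> //; first by rewrite /uhp /=; lra.
  by have := sqr_ge0 z.1; nra.
by rewrite area_cusp_strip; [congr EFin; field|lra].
Qed.

Lemma area_modular_closed_cusp : hyp_area (modular_closed `&` cusp_zone) = 1%E.
Proof.
have -> : modular_closed `&` cusp_zone = [set z : R * R |
    z.1 \in Interval (BSide true (- (1 / 2))) (BSide false (1 / 2)) /\ 1 < z.2].
  apply/seteqP; split=> z /=; rewrite in_itv /=.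
    by move=> [[]].
  move=> [h z1]; split=> //; split=> //; first by rewrite /uhp /=; lra.
  by have := sqr_ge0 z.1; nra.
by rewrite area_cusp_strip; [congr EFin; field|lra].
Qed.

End ModularDomainArea.

(** * The modular group and the packing density *)

Section ModularGroup.
Context {R : realType}.
Implicit Types (v w u : R * R) (z : R * R) (g h : 'M[R]_2).

Lemma vact_inj g h : vact g (1, 0) = vact h (1, 0) ->
  vact g (0, 1) = vact h (0, 1) -> g = h.
Proof.
rewrite /vact /= !mulr1 !mulr0 !addr0 !add0r => -[e1 e2] [e3 e4].
apply/matrixP => i j.
have E (a b : 'I_2) : i = a -> j = b -> g a b = h a b -> g i j = h i j by move=> -> ->.
case: i E => [[|[|//]] pi]; case: j => [[|[|//]] pj] E.
- by apply: (E 0 0) => //; exact: val_inj.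
- by apply: (E 0 1) => //; exact: val_inj.
- by apply: (E 1 0) => //; exact: val_inj.
- by apply: (E 1 1) => //; exact: val_inj.
Qed.

Lemma inv2E g : \det g = 1 -> g^-1 = frame (g 1 1, - g 1 0) (- g 0 1, g 0 0).
Proof.
move=> dg; have ug := unit_det1 dg; have := dg; rewrite det2E => d.
apply: (mulrI ug); rewrite mulrV //; apply/esym.
by apply: vact_inj; rewrite vactM vact1 /vact !mxE /=; congr (_, _);
  (rewrite ?(mulr0, mulr1, addr0, add0r); rewrite -?d; ring).
Qed.

Lemma psl2ZP g : psl2Z g <-> (forall i j, g i j \is a Num.int) /\ \det g = 1.
Proof. by split=> -[h1 h2]; split=> //; apply/mxOverP. Qed.

Lemma psl2Z_frame v w : v.1 \is a Num.int -> v.2 \is a Num.int ->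
  w.1 \is a Num.int -> w.2 \is a Num.int -> vdet v w = 1 -> psl2Z (frame v w).
Proof.
move=> *; apply/psl2ZP; split; last by rewrite frame_det.
by move=> i j; rewrite mxE; case: ifP; case: ifP.
Qed.

Lemma psl2Z_1 : psl2Z (1 : 'M[R]_2).
Proof.
apply/psl2ZP; split; last exact: det1.
by move=> i j; rewrite mxE; case: eqP => _; rewrite ?rpred1 ?rpred0.
Qed.

Lemma psl2Z_mul g h : psl2Z g -> psl2Z h -> psl2Z (g * h).
Proof.
move=> /psl2ZP[ig dg] /psl2ZP[ih dh]; apply/psl2ZP; split; last exact: det1M.
by move=> i j; rewrite mul2E rpredD // rpredM.
Qed.

Lemma psl2Z_inv g : psl2Z g -> psl2Z g^-1.
Proof.
move=> /psl2ZP[ig dg]; rewrite inv2E //.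
apply: psl2Z_frame; rewrite /= ?rpredN //.
by rewrite /vdet /= -dg det2E; ring.
Qed.

Lemma int_abs_ge1 (x : R) : x \is a Num.int -> x != 0 -> 1 <= `|x|.
Proof. by move=> ix x0; rewrite norm_intr_ge1. Qed.

(** The coprime integer vectors, given as first columns of integral matrices of determinant 1 so
    that invariance is immediate. *)
Definition primitive : set (R * R) := [set u | exists2 g, psl2Z g & u = vact g (1, 0)].

Lemma primitive_int u : primitive u -> u.1 \is a Num.int /\ u.2 \is a Num.int.
Proof.
move=> [g /psl2ZP[ig _] ->]; rewrite /vact /=.
by rewrite !mulr1 !mulr0 !addr0.
Qed.

Lemma psl2Z_fix_e1 g : psl2Z g -> g 1 0 = 0 ->
  exists2 n : int, `|g 0 0| = 1 & g = g 0 0 *: frame (1, 0) (n%:~R, 1).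
Proof.
move=> /psl2ZP[ig dg] c0; have := dg; rewrite det2E c0 mulr0 subr0 => d.
have a0 : g 0 0 != 0 by apply: contra_eq_neq d => ->; rewrite mul0r eq_sym oner_neq0.
have d0 : g 1 1 != 0 by apply: contra_eq_neq d => ->; rewrite mulr0 eq_sym oner_neq0.
have a1 := int_abs_ge1 (ig _ _) a0; have d1 := int_abs_ge1 (ig _ _) d0.
have ad : `|g 0 0| * `|g 1 1| = 1 by rewrite -normrM d normr1.
have a2 : `|g 0 0| = 1 by nra.
have da : g 1 1 = g 0 0.
  apply: (mulfI a0); rewrite d -expr2 -(real_normK (num_real (g 0 0))) a2 expr1n //.
have /intrP[n nE] : g 0 0 * g 0 1 \is a Num.int by rewrite rpredM.
exists n => //; apply: vact_inj; rewrite /vact !mxE /= -nE;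
  rewrite !mulr1 !mulr0 ?addr0 ?add0r; first by rewrite c0.
rewrite mulrA -expr2 -(real_normK (num_real (g 0 0))) a2 expr1n mul1r.
by rewrite da.
Qed.

Lemma frame_e1 (x : R) : vact (frame (1, 0) (x, 1)) (1, 0) = (1, 0).
Proof. by rewrite vact_frame /= scale1r scale0r addr0. Qed.

(** The determinant of g e1 and h e1 is an entry of the integral matrix [g^-1 * h]. If it is zero,
    that matrix fixes e1 up to sign. *)
Lemma unimodular_primitive : unimodular primitive.
Proof.
split.
- move=> v [g /psl2ZP[_ dg] ->]; rewrite vact_eq0 //.
  by rewrite xpair_eqE oner_eq0.
- move=> v [g /psl2ZP[ig dg] ->]; exists (- g); last by rewrite vactN.
  apply/psl2ZP; split; last by rewrite -dg !det2E !mxE mulrNN mulrNN.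
  by move=> i j; rewrite mxE rpredN.
move=> v w [g hg ->] [h hh ->].
have [ig dg] := (psl2ZP _).1 hg; have [ih dh] := (psl2ZP _).1 hh.
pose k := g^-1 * h; have hk : psl2Z k by apply: psl2Z_mul => //; exact: psl2Z_inv.
have hE : h = g * k by rewrite /k mulrA mulrV ?unit_det1 // mul1r.
have detE : vdet (vact g (1, 0)) (vact h (1, 0)) = k 1 0.
  by rewrite hE vactM vdet_act // /vdet /vact /= mul0r subr0 mul1r mulr1 mulr0 addr0.
have [k0|k0] := eqVneq (k 1 0) 0; last first.
  constructor 3; rewrite detE; apply: int_abs_ge1 => //.
  by have [ik _] := (psl2ZP _).1 hk.
have [n a1 kE] := psl2Z_fix_e1 hk k0.
have -> : vact h (1, 0) = k 0 0 *: vact g (1, 0).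
  rewrite hE vactM -vactZ; congr (vact g _).
  rewrite /vact k0 mulr1 !mulr0 mul0r !addr0.
  by apply: injective_projections; [exact: esym (mulr1 _)|exact: esym (mulr0 _)].
have /eqP := a1; rewrite eqr_norml ler01 andbT => /orP[]/eqP->.
  by constructor 1; rewrite scale1r.
by constructor 2; rewrite scaleN1r.
Qed.

Lemma primitive_act g v : psl2Z g -> primitive v -> primitive (vact g v).
Proof. by move=> hg [h hh ->]; exists (g * h); [exact: psl2Z_mul|rewrite vactM]. Qed.

Lemma primitive_e1 : primitive (1, 0).
Proof. by exists 1; [exact: psl2Z_1|rewrite vact1]. Qed.

Lemma primitive_int1 (x : R) : x \is a Num.int -> primitive (x, 1).
Proof.
move=> ix; exists (frame (x, 1) (-1, 0)).
  by apply: psl2Z_frame; rewrite ?rpredN ?rpred1 ?rpred0 // /vdet /=; ring.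
by rewrite vact_frame /= scale1r scale0r addr0.
Qed.

Lemma primitive_multiple u : u.1 \is a Num.int -> u.2 \is a Num.int -> u != 0 ->
  exists k v, [/\ k != 0, primitive v & u = k *: v].
Proof.
case: u => x y /= /intrP[m ->] /intrP[n ->] u0.
have [a [b e]] := Bezoutz m n; set d := gcdz m n in e.
have d0 : d != 0.
  apply: contra_neq u0; rewrite /d => /eqP; rewrite gcdz_eq0 => /andP[/eqP-> /eqP->].
  by [].
have /dvdzP[m' mE] : (d %| m)%Z by exact: dvdz_gcdl.
have /dvdzP[n' nE] : (d %| n)%Z by exact: dvdz_gcdr.
exists d%:~R, (m'%:~R, n'%:~R); split; first by rewrite intr_eq0.
  exists (frame (m'%:~R, n'%:~R) (- b%:~R, a%:~R)).
    apply: psl2Z_frame; rewrite ?rpredN ?intr_int // /vdet /=.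
    have h : (m' * a + n' * b = 1)%R.
      by apply: (mulIf d0); rewrite mul1r -[RHS]e mE nE; ring.
    by rewrite mulrN opprK -!intrM -intrD h.
  by rewrite vact_frame /= scale1r scale0r addr0.
by rewrite {1}mE {1}nE !intrM mulrC (mulrC n'%:~R).
Qed.

Lemma finite_set_min (T : choiceType) (A : set T) (f : T -> R) : finite_set A ->
  A !=set0 -> exists2 x, A x & forall y, A y -> f x <= f y.
Proof.
move=> /finite_seqP[s ->] [x0 /= x0s].
elim: s x0 x0s => [//|a s IH] x0 _.
have [s0|] := eqVneq s [::].
  exists a; first by rewrite /= mem_head.
  by move=> y; rewrite s0 /= inE => /eqP->.
case: s IH => // b s IH _.
have [|x xs xmin] := IH b; first by rewrite /= mem_head.
have [ax|xa] := leP (f a) (f x).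
  exists a; first by rewrite /= mem_head.
  move=> y; rewrite /= in_cons => /orP[/eqP-> //|ys].
  exact: le_trans ax (xmin _ ys).
exists x; first by rewrite /= in_cons xs orbT.
move=> y; rewrite /= in_cons => /orP[/eqP->|ys]; [exact: ltW|exact: xmin].
Qed.

(** By finiteness [qf z] has a minimum on primitive vectors, at u = g e1 say. Applying [g^-1] and an
    integral translation makes e1 minimal at a point with |x| <= 1/2, and e1 being no longer than e2
    means |z| >= 1. *)
Lemma modular_reduction z : uhp z -> exists2 g, psl2Z g & modular_closed (moebius g z).
Proof.
move=> z0; pose S := [set u | primitive u /\ qf z u <= qf z (1, 0)].
have finS : finite_set S by exact: finite_qf_le unimodular_primitive z0.
have [|u [[g hg ug] _] umin] := finite_set_min (qf z) finS.
  by exists (1, 0); split=> //; exact: primitive_e1.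
have {}umin y : primitive y -> qf z u <= qf z y.
  move=> py; have [h|h] := leP (qf z y) (qf z (1, 0)); first exact: umin.
  by apply: le_trans (ltW h); apply: umin; split=> //; exact: primitive_e1.
have [ig dg] := (psl2ZP _).1 hg.
pose z1 := moebius g^-1 z.
have z10 : uhp z1 by apply: moebius_uhp => //; exact: det1V.
pose n := Num.floor (z1.1 + 1 / 2).
have := floor_itv (z1.1 + 1 / 2); rewrite -/n => /andP[n1 n2].
have fT : psl2Z (frame (1, 0) (- n%:~R, 1) : 'M[R]_2).
  by apply: psl2Z_frame; rewrite ?rpredN ?rpred1 ?rpred0 ?intr_int // /vdet /=; ring.
set T := frame _ _ in fT.
have [_ dT] := (psl2ZP _).1 fT.
have Tz1 : moebius T z1 = (z1.1 - n%:~R, z1.2).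
  rewrite /moebius !mxE /= !mul0r !add0r expr0n addr0 expr1n !divr1.
  by congr (_, _); ring.
have hTg : psl2Z (T * g^-1) by apply: psl2Z_mul => //; exact: psl2Z_inv.
exists (T * g^-1) => //.
rewrite moebiusM ?det1V // -/z1 Tz1.
have Tmin : qf (moebius T z1) (1, 0) <= qf (moebius T z1) (0, 1).
  have pE y : primitive y -> qf (moebius T z1) (vact (T * g^-1) u) <=
      qf (moebius T z1) (vact (T * g^-1) y).
    move=> py; rewrite !vactM !(qf_act _ dT) // !(qf_act _ (det1V dg)) //.
    exact: umin.
  have [y py yE] : exists2 y, primitive y & vact (T * g^-1) y = (0, 1).
    exists (vact (T * g^-1)^-1 (0, 1)).
      apply: primitive_act; first exact: psl2Z_inv.
      by apply: primitive_int1; exact: rpred0.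
    by rewrite vactVK //; apply: det1M => //; exact: det1V.
  have := pE _ py; rewrite yE.
  by rewrite ug vactM vactK // frame_e1.
rewrite Tz1 in Tmin; clear -z10 n1 n2 Tmin.
clearbody n; clearbody z1; case: z1 z10 n1 n2 Tmin => x y; rewrite /uhp /qf /bf /= => y0 n1 n2.
rewrite !(mul1r, mul0r, subr0, addr0, sub0r, mulr1) mulrNN.
rewrite ler_pdivlMr // mulVf ?gt_eqF // => h.
rewrite intrD in n2; split=> /=; [exact: y0|apply/andP; split; lra|by rewrite expr2].
Qed.

(** For u = (a, c) the product is a^2 - 2 a c x + c^2 |z|^2 >= a^2 - |a c| + c^2, a positive
    integer. *)
Lemma modular_min z u : modular_closed z -> primitive u -> 1 <= z.2 * qf z u.
Proof.
move=> [z0 /andP[x1 x2] s1] pu; have [iu1 iu2] := primitive_int pu.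
have [V0 _ _] := unimodular_primitive; have u0 := V0 _ pu.
case: u u0 iu1 iu2 {pu V0} => a c /= u0 ia ic; case: z z0 x1 x2 s1 => x y /= y0 x1 x2 s1.
have -> : y * qf (x, y) (a, c) = a ^+ 2 - 2 * (a * c * x) + c ^+ 2 * (x ^+ 2 + y ^+ 2).
  by rewrite /qf /bf /= mulrC divfK ?gt_eqF //; ring.
have h1 : c ^+ 2 <= c ^+ 2 * (x ^+ 2 + y ^+ 2) by rewrite ler_peMr ?sqr_ge0.
have h2 : 2 * (a * c * x) <= `|a * c|.
  have : `|a * c * x| <= `|a * c| * (1 / 2).
    by rewrite normrM ler_wpM2l // ler_norml; apply/andP; split; lra.
  by have := ler_norm (a * c * x); lra.
have h3 : 1 <= a ^+ 2 - `|a * c| + c ^+ 2.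
  rewrite normrM -(real_normK (num_real a)) -(real_normK (num_real c)).
  have [a0|a0] := eqVneq a 0.
    have c0 : c != 0 by apply: contra_neq u0 => ->; rewrite a0.
    by have := int_abs_ge1 ic c0; rewrite a0 normr0; nra.
  have [c0|c0] := eqVneq c 0.
    by have := int_abs_ge1 ia a0; rewrite c0 normr0; nra.
  have A := int_abs_ge1 ia a0; have C := int_abs_ge1 ic c0.
  by have := sqr_ge0 (`|a| - `|c|); nra.
by lra.
Qed.

(** The estimate of [modular_min] is strict as soon as c is nonzero, because |z| > 1. *)
Lemma modular_min_open z u : modular_open z -> primitive u ->
  z.2 * qf z u <= 1 -> u = (1, 0) \/ u = - (1, 0).
Proof.
move=> [z0 /andP[x1 x2] s1] pu le1; have [iu1 iu2] := primitive_int pu.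
have [_ _ VV] := unimodular_primitive.
case: (VV _ _ primitive_e1 pu) => [|| d]; [by left|by right|].
case: u iu1 iu2 le1 d {pu VV} => a c /= ia ic; case: z z0 x1 x2 s1 => x y /= y0 x1 x2 s1.
have -> : y * qf (x, y) (a, c) = a ^+ 2 - 2 * (a * c * x) + c ^+ 2 * (x ^+ 2 + y ^+ 2).
  by rewrite /qf /bf /= mulrC divfK ?gt_eqF //; ring.
rewrite /vdet /= mul1r mul0r subr0 => le1 C.
have c2 : 0 < c ^+ 2 by rewrite -(real_normK (num_real c)) exprn_gt0 //; lra.
have h1 : c ^+ 2 < c ^+ 2 * (x ^+ 2 + y ^+ 2) by rewrite ltr_pMr.
have h2 : 2 * (a * c * x) <= `|a * c|.
  have : `|a * c * x| <= `|a * c| * (1 / 2).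
    by rewrite normrM ler_wpM2l // ler_norml; apply/andP; split; lra.
  by have := ler_norm (a * c * x); lra.
have h3 : 1 <= a ^+ 2 - `|a * c| + c ^+ 2.
  rewrite normrM -(real_normK (num_real a)) -(real_normK (num_real c)).
  have [a0|a0] := eqVneq a 0; first by rewrite a0 normr0; nra.
  by have A := int_abs_ge1 ia a0; have := sqr_ge0 (`|a| - `|c|); nra.
by exfalso; lra.
Qed.

(** At both points e1 attains the minimum over primitive vectors, so z and its image have the same
    height and g fixes e1 up to sign. The remaining integral translation is shorter than 1. *)
Lemma modular_open_disjoint g z : psl2Z g -> modular_open z ->
  modular_open (moebius g z) -> g = 1 \/ g = -1.
Proof.
move=> hg mz mgz; have [ig dg] := (psl2ZP _).1 hg.
have cl (y : R * R) : modular_open y -> modular_closed y.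
  by move=> [? /andP[? ?] ?]; split=> //; [rewrite !ltW|exact: ltW].
have [z0 _ _] := mz; have [gz0 _ _] := mgz.
have q1 (y : R * R) : uhp y -> y.2 * qf y (1, 0) = 1.
  by case: y => x y; rewrite /uhp /qf /bf /= => y0; field; rewrite gt_eqF.
have hV := psl2Z_inv hg.
have pe := primitive_act hV primitive_e1.
have pg := primitive_act hg primitive_e1.
have E1 : qf z (vact g^-1 (1, 0)) = qf (moebius g z) (1, 0).
  by rewrite -(qf_act _ dg) // vactVK.
have E2 : qf (moebius g z) (vact g (1, 0)) = qf z (1, 0) by rewrite qf_act.
have le1 := modular_min (cl _ mz) pe; have le2 := modular_min (cl _ mgz) pg.
rewrite E1 in le1; rewrite E2 in le2.
have := q1 _ z0; have := q1 _ gz0 => e2 e1.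
move: (z0) (gz0); rewrite /uhp /= => y0 gy0.
have p1 : 0 < qf z (1, 0).
  by apply: qf_gt0 => //; rewrite xpair_eqE oner_eq0.
have p2 : 0 < qf (moebius g z) (1, 0).
  by apply: qf_gt0 => //; rewrite xpair_eqE oner_eq0.
have le3 : (moebius g z).2 * qf (moebius g z) (vact g (1, 0)) <= 1.
  by rewrite E2; nra.
have c0 : g 1 0 = 0.
  case: (modular_min_open mgz pg le3) => /(congr1 snd); rewrite /vact /=;
    by rewrite mulr1 mulr0 addr0 ?oppr0.
have [n a1 gE] := psl2Z_fix_e1 hg c0.
have gT : g = frame (1, 0) (n%:~R, 1) \/ g = - frame (1, 0) (n%:~R, 1).
  have /eqP := a1; rewrite eqr_norml ler01 andbT => /orP[]/eqP e.
    by left; rewrite {1}gE e scale1r.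
  by right; rewrite {1}gE e scaleN1r.
have zE : moebius g z = (z.1 + n%:~R, z.2).
  case: gT => ->; rewrite ?moebiusN /moebius !mxE /= !mul0r !add0r expr0n addr0 expr1n !divr1;
    by congr (_, _); ring.
move: mz mgz => [_ /andP[x1 x2] _] [_ ]; rewrite zE /= => /andP[x3 x4] _.
have n0 : n = 0.
  apply/eqP; apply: contraTT isT => n0.
  have : 1 <= `|n%:~R : R| by apply: int_abs_ge1; [exact: intr_int|rewrite intr_eq0].
  by rewrite leNgt ltr_norml => /negP; case; apply/andP; split; lra.
have F1 : frame (1, 0) (0%:~R, 1) = 1 :> 'M[R]_2.
  by apply: vact_inj; rewrite vact1 vact_frame /= ?scale1r ?scale0r ?addr0 ?add0r.
by case: gT => ->; rewrite n0 F1; [left|right].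
Qed.

End ModularGroup.

(** * Cusps of a group conjugate into the modular group *)

Section IntegralConjugate.
Context {R : realType}.
Local Notation mR := (measurableTypeR R).
Variables (G : psl2_subgroup R) (M : 'M[R]_2).
Hypothesis dM : \det M = 1.
Hypothesis hGM : forall h, G h -> psl2Z (M^-1 * h * M).
Implicit Types (v w u : R * R) (z : R * R) (g h k : 'M[R]_2).

Definition lattice_vectors : set (R * R) := [set v | primitive (vact M^-1 v)].
Local Notation V := lattice_vectors.

Let dMV := det1V dM.
Let uM := unit_det1 dM.

Lemma psl2Z_det g : psl2Z g -> \det g = 1.
Proof. by case. Qed.

Lemma conjK g h : g \is a GRing.unit -> h = g * (g^-1 * h * g) * g^-1.
Proof. by move=> ug; rewrite !mulrA mulrV // mul1r -mulrA mulrV // mulr1. Qed.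

Lemma conjVK g h : g \is a GRing.unit -> h = g^-1 * (g * h * g^-1) * g.
Proof. by move=> ug; rewrite !mulrA mulVr // mul1r -mulrA mulVr // mulr1. Qed.

Lemma lattice_vectors_unimodular : unimodular V.
Proof.
have [p0 pN pV] := @unimodular_primitive R; split.
- by move=> v /p0; rewrite vact_eq0.
- by move=> v /pN; rewrite /lattice_vectors /= vact_opp.
- move=> v w pv pw; rewrite -(vdet_act v w dMV).
  case: (pV _ _ pv pw) => [/(congr1 (vact M))|/(congr1 (vact M))|h].
  + by rewrite !vactVK //; constructor 1.
  + by rewrite vact_opp !vactVK //; constructor 2.
  + by constructor 3.
Qed.
Let hV := lattice_vectors_unimodular.

Lemma lattice_vectors_act g v : G g -> V v -> V (vact g v).
Proof.
move=> Gg pv; rewrite /lattice_vectors /=.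
have -> : vact M^-1 (vact g v) = vact (M^-1 * g * M) (vact M^-1 v).
  by rewrite -!vactM -!mulrA mulrV // mulr1.
by apply: primitive_act pv; exact: hGM.
Qed.

Lemma conj_inj g h : M^-1 * g * M = M^-1 * h * M -> g = h.
Proof.
by move=> e; rewrite (conjK g uM) e -conjK.
Qed.

(** Countability of G, for the area comparison: the entries of the conjugates are integers,
    recovered by [Num.floor]. *)
Lemma group_index : exists iota : 'M[R]_2 -> nat,
  forall g h, G g -> G h -> iota g = iota h -> g = h.
Proof.
pose f (g : 'M[R]_2) := (Num.floor (g 0 0), Num.floor (g 0 1), Num.floor (g 1 0), Num.floor (g 1 1)).
exists (fun g => choice.pickle (f (M^-1 * g * M))) => g h Gg Gh.
move/(pcan_inj choice.pickleK) => e; apply: conj_inj.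
have /psl2ZP[ig _] := hGM Gg; have /psl2ZP[ih _] := hGM Gh.
move: e ig ih; rewrite /f => -[e1 e2 e3 e4] ig ih.
have E i j : Num.floor ((M^-1 * g * M) i j) = Num.floor ((M^-1 * h * M) i j) ->
    (M^-1 * g * M) i j = (M^-1 * h * M) i j.
  by move=> e; rewrite -(floorK (ig i j)) -(floorK (ih i j)) e.
apply: vact_inj; rewrite /vact; congr (_ * _ + _ * _, _ * _ + _ * _); exact: E.
Qed.

Lemma slope_exists (p : option R) : exists2 v, v != 0 & slope v = p.
Proof.
case: p => [x|].
  exists (x, 1); first by rewrite xpair_eqE negb_and oner_eq0 orbT.
  by rewrite /slope /= oner_eq0 divr1.
exists (1, 0); first by rewrite xpair_eqE negb_and oner_eq0.
by rewrite /slope /= eqxx.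
Qed.

(** The quadratic form [vdet v (vact g v)] has discriminant tr^2 - 4 = 0, so up to a factor it is
    the square of the linear form vanishing at (a - d, 2 c). *)
Lemma parabolic_fixed_vector g v : (\tr g) ^+ 2 = 4 -> \det g = 1 -> g 1 0 != 0 ->
  vdet v (vact g v) = 0 -> vdet v (g 0 0 - g 1 1, 2 * g 1 0) = 0.
Proof.
have -> : \tr g = g 0 0 + g 1 1.
  rewrite /mxtrace !big_ord_recl big_ord0 addr0.
  by congr (_ + g _ _); exact: val_inj.
rewrite det2E /vdet /vact /=; move: (g 0 0) (g 0 1) (g 1 0) (g 1 1) v.1 v.2 => a b c d x y t4 d1 c0 h.
apply/eqP; rewrite -sqrf_eq0; apply/eqP.
have -> : (x * (2 * c) - y * (a - d)) ^+ 2 =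
    4 * c * (x * (c * x + d * y) - y * (a * x + b * y)) + y ^+ 2 * ((a + d) ^+ 2 - 4 * (a * d - b * c)).
  by ring.
by rewrite h t4 d1 mulr1 subrr !mulr0 addr0.
Qed.

Lemma tr_conj g : \tr (M^-1 * g * M) = \tr g.
Proof. by rewrite -mulrA [LHS]mxtrace_mulC -[X in \tr X]mulrA; congr mxtrace; rewrite -[RHS]mulr1 -(mulrV uM). Qed.

(** A parabolic integral matrix fixes the direction of an integral vector, e1 or (a - d, 2 c), and
    such a vector is a multiple of a primitive one. *)
Lemma cusp_lattice_vector p : cusp G p -> exists2 v, V v & slope v = p.
Proof.
move=> [g [Gg g1 gN1 tr4 fp]]; have dg := psl2_det Gg.
have [u u0 us] := slope_exists p.
have hk := hGM Gg; set k := M^-1 * g * M in hk; have [/mxOverP ik dk] := hk.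
have kE y : vact k (vact M^-1 y) = vact M^-1 (vact g y).
  by rewrite -!vactM -!mulrA mulrV // mulr1.
pose y := vact M^-1 u.
have y0 : y != 0 by rewrite vact_eq0.
have hy : vdet y (vact k y) = 0.
  rewrite kE vdet_act //; apply/slope_eq; rewrite ?vact_eq0 //.
  by rewrite slope_act // us fp.
have [x [ix1 ix2 x0 yx]] : exists x, [/\ x.1 \is a Num.int, x.2 \is a Num.int, x != 0 & vdet y x = 0].
  have [c0|c0] := eqVneq (k 1 0) 0.
    exists (1, 0); rewrite rpred1 rpred0; split=> //.
      by rewrite xpair_eqE negb_and oner_eq0.
    have [n a1 kT] := psl2Z_fix_e1 hk c0.
    have n0 : n%:~R != 0 :> R.
      apply/eqP => n0; have F1 : frame (1, 0) (n%:~R, 1) = 1 :> 'M[R]_2.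
        by apply: vact_inj; rewrite vact1 vact_frame /= n0 ?scale1r ?scale0r ?addr0 ?add0r.
      have [/eqP e|/eqP e] : k 0 0 == 1 \/ k 0 0 == -1.
        by have /eqP := a1; rewrite eqr_norml ler01 andbT => /orP[]; [left|right].
        by case: g1; apply: conj_inj; rewrite -/k kT e F1 scale1r mulr1 mulVr.
      by case: gN1; apply: conj_inj; rewrite -/k kT e F1 scaleN1r mulrN mulNr mulr1 mulVr.
    have a0 : k 0 0 != 0 by rewrite -normr_gt0 a1.
    move: hy; rewrite kT; move: (k 0 0) a0 => a a0; clearbody y; rewrite /vdet /vact !mxE /= => hy.
    have : y.2 ^+ 2 = 0.
      apply: (mulfI (mulf_neq0 a0 n0)); rewrite mulr0 -[RHS]oppr0 -[in RHS]hy.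
      by move: y.1 y.2 => y1 y2; ring.
    by move/eqP; rewrite sqrf_eq0 => /eqP ->; rewrite mul0r mulr0 subr0.
  exists (k 0 0 - k 1 1, 2 * k 1 0) => /=; split.
  - by rewrite rpredB.
  - by rewrite rpredM // (natr_int R 2).
  - by rewrite xpair_eqE negb_and mulf_neq0 ?orbT.
  - by apply: parabolic_fixed_vector => //; rewrite tr_conj.
have [c [v [c0 pv xE]]] := primitive_multiple ix1 ix2 x0.
have v0 : v != 0 by have [+ _ _] := @unimodular_primitive R; apply.
exists (vact M v); first by rewrite /lattice_vectors /= vactK.
rewrite -us; apply/slope_eq; rewrite ?vact_eq0 //.
rewrite -(vactVK u dM) vdet_act // -/y vdetC.
move: yx; rewrite xE vdetZr => /eqP; rewrite mulf_eq0 (negPf c0) => /eqP->.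
by rewrite oppr0.
Qed.

Lemma qf_e1 z : uhp z -> z.2 * qf z (1, 0) = 1.
Proof. by case: z => x y; rewrite /uhp /qf /bf /= => y0; field; rewrite gt_eqF. Qed.

Lemma qf_e1_lt1 z : uhp z -> (qf z (1, 0) < 1) = (1 < z.2).
Proof.
by move=> z0; rewrite -[LHS](ltr_pM2l (z0 : 0 < z.2)) qf_e1 // mulr1.
Qed.

(** Otherwise e1 and k e1 would have determinant at least 1 in absolute value, while both forms are
    below 1 at the image point. *)
Lemma cusp_zone_translation k z : psl2Z k -> cusp_zone z -> cusp_zone (moebius k z) -> k 1 0 = 0.
Proof.
move=> hk z1 kz1; have [/mxOverP ik dk] := hk.
have z0 : uhp z by exact: lt_trans ltr01 z1.
have kz0 := moebius_uhp dk z0.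
have h1 : qf (moebius k z) (1, 0) < 1 by rewrite qf_e1_lt1.
have h2 : qf (moebius k z) (vact k (1, 0)) < 1 by rewrite qf_act // qf_e1_lt1.
apply/eqP; apply: contraTT isT => c0; have c1 := int_abs_ge1 (ik 1 0) c0.
have := qf_gram (1, 0) (vact k (1, 0)) kz0.
have -> : vdet (1, 0) (vact k (1, 0)) = k 1 0 by rewrite /vdet /vact /=; ring.
have p1 : 0 < qf (moebius k z) (1, 0).
  by apply: qf_gt0 => //; rewrite xpair_eqE negb_and oner_eq0.
have := sqr_ge0 (bf (moebius k z) (1, 0) (vact k (1, 0))).
rewrite -(real_normK (num_real (k 1 0))); nra.
Qed.

(** Without a translation at this cusp, strips of every width b above height 1 would be disjoint
    from their translates by G. Such a strip has area b, so every fundamental domain would have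
    infinite area. *)
Lemma cusp_translation v : cofinite G -> V v ->
  exists k (n : int), [/\ psl2Z k, vact k (1, 0) = vact M^-1 v, n != 0 &
    G (M * k * frame (1, 0) (n%:~R, 1) * (M * k)^-1)].
Proof.
move=> [F [mF Fu covF _] Ffin] [k hk kv].
apply: contrapT => H.
have {}H n : n != 0 -> ~ G (M * k * frame (1, 0) (n%:~R, 1) * (M * k)^-1).
  by move=> n0 Gn; apply: H; exists k, n.
pose K := M * k; have dk := psl2Z_det hk; have dK : \det K = 1 by exact: det1M.
have uK := unit_det1 dK.
pose S (b : R) : set (R * R) := [set z | z.1 \in Interval (BSide false 0) (BSide true b) /\ 1 < z.2].
have mS b : measurable (S b : set (mR * mR)).
  have -> : S b = fst @^-1` [set` Interval (BSide false 0) (BSide true b)] `&` cusp_zone by [].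
  apply: measurableI; last exact: measurable_cusp_zone.
  by apply: measurable_preimageT => //; exact: measurable_fst.
have Su b : S b `<=` uhp by move=> z [_ z1]; exact: lt_trans ltr01 z1.
have le (b : R) : 0 <= b -> (b%:E <= hyp_area F)%E.
  move=> b0; have [mA aA] := hyp_area_moebius dK (mS b) (Su b).
  have [iota inj] := group_index.
  have Au : moebius K @` S b `<=` uhp.
    by move=> _ [z /Su z0 <-]; exact: moebius_uhp.
  have := @hyp_area_pack_le_cover R G iota _ _ uhp inj mA mF measurable_uhp Au Fu _ covF.
  rewrite !setIidl // aA area_cusp_strip // subr0; apply.
    move=> g Gg g1 gN1; rewrite (_ : _ `&` _ = set0).
      by rewrite /hyp_area integral_set0.
    rewrite -subset0 => _ [[z Sz <-] [_ [z' Sz' <-]] e].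
    have dg := psl2_det Gg.
    have hl : psl2Z (K^-1 * g * K).
      rewrite /K invrM ?unit_det1 // -mulrA (mulrA _ M) !mulrA -mulrA mulrA.
      by apply: psl2Z_mul => //; rewrite -!mulrA; apply: psl2Z_mul; [exact: psl2Z_inv|rewrite mulrA; exact: hGM].
    set l := K^-1 * g * K in hl.
    have gl : g = K * l * K^-1 by exact: conjK.
    have dl := psl2Z_det hl.
    have z0 := Su _ _ Sz; have z0' := Su _ _ Sz'.
    have lz : moebius l z' = z.
      have lz0' := moebius_uhp dl z0'; have Kz0' := moebius_uhp dK z0'.
      rewrite -[RHS](moebiusK dK) // -e gl moebiusM ?moebiusK //; [|exact: det1M|exact: det1V].
      by rewrite moebiusM // moebiusK.
    (* l matches two points above height 1, so up to sign it is an integral translation. *)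
    have c0 : l 1 0 = 0.
      by apply: (cusp_zone_translation (z := z')) => //; [case: Sz'|rewrite lz; case: Sz].
    have [n a1 lT] := psl2Z_fix_e1 hl c0.
    have [n0|n0] := eqVneq n 0.
      have F1 : frame (1, 0) (n%:~R, 1) = 1 :> 'M[R]_2.
        by apply: vact_inj; rewrite vact1 vact_frame /= n0 ?scale1r ?scale0r ?addr0 ?add0r.
      have /eqP := a1; rewrite eqr_norml ler01 andbT => /orP[]/eqP h.
        by apply: g1; rewrite gl lT h F1 scale1r mulr1 mulrV.
      by apply: gN1; rewrite gl lT h F1 scaleN1r mulrN mulNr mulr1 mulrV.
    apply: (H _ n0); have /eqP := a1; rewrite eqr_norml ler01 andbT => /orP[]/eqP h.
      by move: Gg; rewrite {1}gl lT h scale1r.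
    by move/psl2_opp : Gg; rewrite {1}gl lT h scaleN1r mulrN mulNr opprK.
  by move=> g z Gg z0 _; exact: moebius_uhp (psl2_det Gg) z0.
have F0 : (0 <= hyp_area F)%E by exact: le.
have /(le _) : 0 <= fine (hyp_area F) + 1 by rewrite addr_ge0 // fine_ge0.
by rewrite -[X in (_ <= X)%E]fineK ?ge0_fin_numE // lee_fin gerDl ler10.
Qed.

Lemma lattice_vector_cusp v : cofinite G -> V v -> cusp G (slope v).
Proof.
move=> cof Vv; have [k [n [hk kv n0 Gn]]] := cusp_translation cof Vv.
have dk := psl2Z_det hk; have dK : \det (M * k) = 1 by exact: det1M.
have uK := unit_det1 dK; set T := frame _ _ in Gn; set K := M * k in Gn dK uK.
have dT : \det T = 1 by rewrite frame_det /vdet /=; ring.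
have vK : v = vact K (1, 0) by rewrite vactM kv vactVK.
clearbody K.
have conj x : K * T * K^-1 = x%:M -> T = x%:M.
  move=> h; rewrite [LHS](conjVK _ uK) h.
  by rewrite -[x%:M]scalemx1 -scalerAr mulr1 -scalerAl mulVr.
have n0R : n%:~R != 0 :> R by rewrite intr_eq0.
have no x : T <> x%:M.
  by move/matrixP/(_ 0 1); rewrite !mxE /= mulr0n => /eqP; rewrite (negPf n0R).
exists (K * T * K^-1); split=> //.
- by move=> h; apply: (no 1); apply: conj; rewrite h.
- move=> h; apply: (no (-1)); apply: conj; rewrite h.
  by rewrite raddfN.
- have -> : \tr (K * T * K^-1) = 2.
    rewrite [LHS]mxtrace_mulC -[X in \tr X]/(K^-1 * (K * T)) mulKr //.
    rewrite /mxtrace !big_ord_recl big_ord0 !mxE /=; ring.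
  by ring.
- rewrite -slope_act.
  + by rewrite vK !vactM vactK // frame_e1.
  + by apply: det1M; [exact: det1M|exact: det1V].
  + by have [+ _ _] := hV; apply.
Qed.

End IntegralConjugate.

(** * The packing by images of the Ford circles *)

Section LatticePacking.
Context {R : realType}.
Local Notation mR := (measurableTypeR R).
Variables (G : psl2_subgroup R) (M : 'M[R]_2).
Hypothesis dM : \det M = 1.
Hypothesis hGM : forall h, G h -> psl2Z (M^-1 * h * M).
Hypothesis cof : cofinite G.
Implicit Types (v w u : R * R) (z : R * R) (g h k : 'M[R]_2) (p q : option R).
Local Notation V := (lattice_vectors M).

Let dMV := det1V dM.
Let uM := unit_det1 dM.
Let hV : unimodular V := lattice_vectors_unimodular dM.
Let VG g v : G g -> V v -> V (vact g v) := @lattice_vectors_act _ _ _ dM hGM g v.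

Lemma lattice_cuspP p : cusp G p <-> exists2 v, V v & slope v = p.
Proof.
split; first exact: cusp_lattice_vector.
by move=> [v Vv <-]; exact: (lattice_vector_cusp dM hGM).
Qed.

(** The vector of V with a given slope is unique up to sign, so the choice does not matter. At other
    slopes the default vector gives the value 1. *)
Definition lattice_height p : R :=
  slope_height (xget (1, 0) [set v | V v /\ slope v = p]).
Local Notation t := lattice_height.

Lemma lattice_heightE v : V v -> t (slope v) = slope_height v.
Proof.
move=> Vv; rewrite /t; case: xgetP => [w _ [Vw sw]|/(_ v)]; last by case.
have [V0 _ VV] := hV.
have d0 : vdet v w = 0 by apply/slope_eq => //; exact: V0.
have [->|->|] := VV _ _ Vv Vw; rewrite ?slope_heightN //.
by rewrite d0 normr0 ler10.
Qed.

Lemma moebius_horocycle g v : \det g = 1 -> v != 0 ->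
  moebius g @` horocycle (slope v) (slope_height v) =
  horocycle (slope (vact g v)) (slope_height (vact g v)).
Proof.
move=> dg v0; rewrite !horocycleE ?vact_eq0 //; apply/seteqP; split=> z.
  by move=> [y [y0 qy] <-]; split; [exact: moebius_uhp|rewrite qf_act].
move=> [z0 qz]; have z0' := moebius_uhp (det1V dg) z0.
exists (moebius g^-1 z); last by rewrite moebiusVK.
by split=> //; rewrite -(qf_act _ dg) // moebiusVK.
Qed.

Lemma lattice_horoballs_disjoint v w z : V v -> V w -> uhp z -> qf z v < 1 ->
  qf z w < 1 -> slope v = slope w.
Proof.
move=> Vv Vw z0 q1 q2; have [V0 _ VV] := hV.
have [->|->|d] := VV _ _ Vv Vw; rewrite ?slopeN //.
have := qf_gram v w z0; have := qf_gt0 z0 (V0 _ Vv); have := qf_gt0 z0 (V0 _ Vw).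
have := sqr_ge0 (bf z v w); rewrite -(real_normK (num_real (vdet v w))).
by move=> *; exfalso; nra.
Qed.

Lemma lattice_horocycle_packing : horocycle_packing G t.
Proof.
have [V0 _ _] := hV; split.
- by move=> _ /lattice_cuspP[v Vv <-]; rewrite lattice_heightE // slope_height_gt0 // V0.
- move=> g _ Gg /lattice_cuspP[v Vv <-]; have dg := psl2_det Gg.
  rewrite -slope_act ?V0 // !lattice_heightE ?moebius_horocycle ?V0 //.
  exact: VG.
- move=> g _ Gg /lattice_cuspP[v Vv <-]; have dg := psl2_det Gg.
  rewrite lattice_heightE // horoballE ?V0 // => -[_ [[z [z0 qz] <-] [z0' qz']]].
  rewrite -slope_act ?V0 //.
  by apply: lattice_horoballs_disjoint (VG Gg Vv) Vv z0' _ qz'; rewrite qf_act.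
- move=> _ _ /lattice_cuspP[v Vv <-] /lattice_cuspP[w Vw <-] nvw.
  rewrite !lattice_heightE // !horoballE ?V0 // !image_in_surfaceE; try by move=> ? [].
  rewrite -subset0 => _ [[z [z0 qz] <-] [y [y0 qy]]].
  move=> /(projP G y0 z0)[g Gg gy].
  have dg := psl2_det Gg.
  apply: (nvw g^-1 (psl2_inv Gg)); rewrite -slope_act ?det1V ?V0 //.
  apply: (lattice_horoballs_disjoint (z := y)) => //; first exact: VG (psl2_inv Gg) Vv.
  by rewrite -(moebiusK dg y0) gy qf_act // det1V.
Qed.

(** V is a single orbit of M SL_2(Z) M^-1, which provides an element taking v to w. *)
Lemma lattice_congruent : congruent_horocycles G t.
Proof.
move=> _ _ /lattice_cuspP[v Vv <-] /lattice_cuspP[w Vw <-].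
have [V0 _ _] := hV; have [k hk kv] := Vv; have [l hl lw] := Vw.
have dk := psl2Z_det hk; have dl := psl2Z_det hl.
have dg : \det (M * l * (M * k)^-1) = 1.
  by apply: det1M; [exact: det1M|apply: det1V; exact: det1M].
exists (M * l * (M * k)^-1) => //.
have gv : vact (M * l * (M * k)^-1) v = w.
  have -> : v = vact (M * k) (1, 0) by rewrite vactM -kv vactVK.
  by rewrite vactM vactK ?det1M // vactM -lw vactVK.
by rewrite !lattice_heightE // moebius_horocycle ?V0 // gv.
Qed.

(** The discs inside the Ford circles together with the region above height 1. *)
Definition modular_horoballs : set (R * R) :=
  [set z | uhp z /\ exists2 u, primitive u & qf z u < 1].

Lemma modular_horoballs_act k z : psl2Z k -> uhp z ->
  modular_horoballs z -> modular_horoballs (moebius k z).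
Proof.
move=> hk z0 [_ [u pu qu]]; have dk := psl2Z_det hk.
split; first exact: moebius_uhp.
by exists (vact k u); [exact: primitive_act|rewrite qf_act].
Qed.

(** By [modular_min] every primitive vector has form at least 1 / y, the value at e1, so only the
    horoball at infinity reaches the modular triangle. *)
Lemma modular_closed_horoballs : modular_closed `&` modular_horoballs =
  modular_closed `&` @cusp_zone R.
Proof.
apply/seteqP; split=> z [mz hz]; split=> //; have [z0 _ _] := mz.
  have [_ [u pu qu]] := hz; have := modular_min mz pu.
  rewrite /cusp_zone /=; move: z0; rewrite /uhp /=; nra.
split=> //; exists (1, 0); first exact: primitive_e1.
by rewrite qf_e1_lt1.
Qed.

Lemma modular_open_closed : modular_open `<=` @modular_closed R.
Proof.
by move=> z [? /andP[? ?] ?]; split=> //; [rewrite !ltW|exact: ltW].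
Qed.

Lemma modular_open_horoballs : modular_open `&` modular_horoballs =
  modular_open `&` @cusp_zone R.
Proof.
have E : modular_open `&` @modular_closed R = modular_open.
  exact: setIidl modular_open_closed.
by rewrite -E -!setIA modular_closed_horoballs.
Qed.

Lemma measurable_modular_horoballs : measurable (modular_horoballs : set (mR * mR)).
Proof.
have -> : modular_horoballs = \bigcup_(ab : int * int) (if `[< primitive ((ab.1)%:~R : R, (ab.2)%:~R : R) >] then
    [set z | uhp z /\ qf z ((ab.1)%:~R, (ab.2)%:~R) < 1] else set0).
  apply/seteqP; split=> z.
    move=> [z0 [[a b] pu qu]]; have [/= /intrP[m aE] /intrP[n bE]] := primitive_int pu.
    rewrite aE bE in pu qu.
    by exists (m, n) => //=; case: asboolP.
  move=> [[m n] _]; case: asboolP => //= pu [z0 qz]; split=> //.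
  by exists (m%:~R, n%:~R).
apply: countable_bigcupT_measurable => [|[m n]] /=; first exact: countableP.
case: asboolP => // -[k hk ->].
have dk := psl2Z_det hk.
have cu : @cusp_zone R `<=` uhp by move=> z z1; exact: lt_trans ltr01 z1.
have [mI _] := hyp_area_moebius dk (@measurable_cusp_zone R) cu.
rewrite (_ : mkset _ = moebius k @` @cusp_zone R) //.
apply/seteqP; split=> z.
  move=> [z0 qz]; have z0' := moebius_uhp (det1V dk) z0.
  exists (moebius k^-1 z); last by rewrite moebiusVK.
  suff : 1 < (moebius k^-1 z).2 by [].
  by rewrite -qf_e1_lt1 // -(qf_act _ dk) // moebiusVK.
move=> [y y1 <-]; have y0 := cu _ y1; split; first exact: moebius_uhp.
by rewrite qf_act // qf_e1_lt1.
Qed.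

Lemma lattice_cusp_neighbourhoods z : cusp_neighbourhoods G t z <->
  uhp z /\ modular_horoballs (moebius M^-1 z).
Proof.
have [V0 _ _] := hV; split.
  move=> [_ /lattice_cuspP[v Vv <-]]; rewrite lattice_heightE // horoballE ?V0 //.
  move=> [z0 qz]; split=> //; split; first exact: moebius_uhp.
  by exists (vact M^-1 v) => //; rewrite qf_act.
move=> [z0 [_ [u pu qu]]].
have Vv : V (vact M u) by rewrite /lattice_vectors /= vactK.
exists (slope (vact M u)); first by apply/lattice_cuspP; exists (vact M u).
rewrite lattice_heightE // horoballE ?V0 //; split=> //.
by rewrite -(moebiusVK dM z0) qf_act //; exact: moebius_uhp.
Qed.

End LatticePacking.

Section HyperbolicAreaUnion.
Context {R : realType}.
Implicit Types A B : set (measurableTypeR R * measurableTypeR R).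

Lemma hyp_areaU_le A B : measurable A -> measurable B -> A `<=` uhp -> B `<=` uhp ->
  (hyp_area (A `|` B) <= hyp_area A + hyp_area B)%E.
Proof.
move=> mA mB Au Bu; rewrite !hyp_areaE //; first exact: measureU2.
by move=> z [/Au|/Bu].
Qed.

Lemma hyp_areaU A B : measurable A -> measurable B -> A `<=` uhp -> B `<=` uhp ->
  A `&` B = set0 -> hyp_area (A `|` B) = (hyp_area A + hyp_area B)%E.
Proof.
move=> mA mB Au Bu AB; rewrite !hyp_areaE //; first exact: measureU.
by move=> z [/Au|/Bu].
Qed.

End HyperbolicAreaUnion.

(** * Finite index and the packing density *)

Section LatticeDensity.
Context {R : realType}.
Local Notation mR := (measurableTypeR R).
Variables (G : psl2_subgroup R) (M : 'M[R]_2).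
Hypothesis dM : \det M = 1.
Hypothesis hGM : forall h, G h -> psl2Z (M^-1 * h * M).
Implicit Types (z : R * R) (g h k : 'M[R]_2) (s : seq 'M[R]_2) (D N : set (R * R)).

Let uM := unit_det1 dM.

(** Representatives of distinct cosets, in SL_2(Z), of the conjugate of G by M. A complete list is
    obtained later, by extending until the translates cover. *)
Definition coset_reps s : Prop :=
  (forall k, k \in s -> psl2Z k) /\
  forall i j, (i < size s)%N -> (j < size s)%N -> i <> j ->
    ~ G (M * nth 1 s i * (nth 1 s j)^-1 * M^-1).

Definition translates s D : set (R * R) :=
  [set z | exists2 k, k \in s & (moebius (M * k) @` D) z].

Lemma translates_nil D : translates [::] D = set0.
Proof. by rewrite -subset0 => z []. Qed.

Lemma translates_cons k s D :
  translates (k :: s) D = moebius (M * k) @` D `|` translates s D.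
Proof.
apply/seteqP; split=> z.
  by move=> [h]; rewrite in_cons => /orP[/eqP->|hs] Dz; [left|right; exists h].
move=> [Dz|[h hs Dz]]; first by exists k; rewrite // mem_head.
by exists h => //; rewrite in_cons hs orbT.
Qed.

Lemma translates_measurable s D : (forall k, k \in s -> psl2Z k) ->
  D `<=` uhp -> measurable (D : set (mR * mR)) ->
  translates s D `<=` uhp /\ measurable (translates s D : set (mR * mR)).
Proof.
move=> + Du mD; elim: s => [_|k s IH hs].
  by rewrite translates_nil; split=> // z [].
have [h|us ms] := IH; first by move=> ks; apply: hs; rewrite in_cons ks orbT.
have dk : \det (M * k) = 1 by apply: det1M => //; apply: psl2Z_det; exact/hs/mem_head.
rewrite translates_cons; split.
  by move=> z [[y /Du y0 <-]|/us //]; exact: moebius_uhp.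
by apply: measurableU => //; have [] := hyp_area_moebius dk mD Du.
Qed.

Section Area.
Variables (D : set (R * R)) (a : R).
Hypotheses (Du : D `<=` uhp) (mD : measurable (D : set (mR * mR))).
Hypothesis aD : hyp_area D = a%:E.

Lemma area_translates_le s : (forall k, k \in s -> psl2Z k) ->
  (hyp_area (translates s D) <= ((size s)%:R * a)%:E)%E.
Proof.
elim: s => [_|k s IH hs].
  by rewrite translates_nil /hyp_area integral_set0 mul0r.
have hs' h : h \in s -> psl2Z h by move=> ks; apply: hs; rewrite in_cons ks orbT.
have [us ms] := translates_measurable hs' Du mD.
have dk : \det (M * k) = 1 by apply: det1M => //; apply: psl2Z_det; exact/hs/mem_head.
have [mk ak] := hyp_area_moebius dk mD Du.
have uk : moebius (M * k) @` D `<=` uhp by move=> _ [y /Du y0 <-]; exact: moebius_uhp.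
rewrite translates_cons; apply: le_trans (hyp_areaU_le mk ms uk us) _.
rewrite ak aD /= -natr1 mulrDl mul1r addrC EFinD.
by apply: leeD => //; exact: IH.
Qed.

Lemma area_translates s : (forall k, k \in s -> psl2Z k) -> uniq s ->
  (forall h k, h \in s -> k \in s -> h != k ->
     moebius (M * h) @` D `&` moebius (M * k) @` D = set0) ->
  hyp_area (translates s D) = ((size s)%:R * a)%:E.
Proof.
elim: s => [_ _ _|k s IH hs /= /andP[ks us'] disj].
  by rewrite translates_nil /hyp_area integral_set0 mul0r.
have sub h : h \in s -> h \in k :: s by rewrite in_cons orbC => ->.
have hs' h : h \in s -> psl2Z h by move=> /sub; exact: hs.
have [us ms] := translates_measurable hs' Du mD.
have dk : \det (M * k) = 1 by apply: det1M => //; apply: psl2Z_det; exact/hs/mem_head.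
have [mk ak] := hyp_area_moebius dk mD Du.
have uk : moebius (M * k) @` D `<=` uhp by move=> _ [y /Du y0 <-]; exact: moebius_uhp.
rewrite translates_cons hyp_areaU //; last first.
  rewrite -subset0 => z [h1 [h hh h2]].
  have : (moebius (M * k) @` D `&` moebius (M * h) @` D) z by [].
  rewrite disj // ?mem_head ?sub //.
  by apply: contraNneq ks => ->.
rewrite ak aD IH //; last by move=> h l /sub hh /sub hl; exact: disj.
by rewrite /= -natr1 mulrDl mul1r addrC EFinD.
Qed.

End Area.

Lemma coset_reps_uniq s : coset_reps s -> uniq s.
Proof.
move=> [hs rep]; apply/(uniqP 1) => i j; rewrite !inE => hi hj e.
apply: contrapT => ij; apply: (rep i j hi hj ij); rewrite -e.
have u : nth 1 s i \is a GRing.unit by apply/unit_det1/psl2Z_det/hs/mem_nth.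
by rewrite -[M * _ * _]mulrA mulrV // mulr1 mulrV //; exact: psl2_1.
Qed.

Lemma coset_reps_eq s h k : coset_reps s -> h \in s -> k \in s ->
  G (M * h * k^-1 * M^-1) -> h = k.
Proof.
move=> [hs rep] /(nthP 1)[i hi <-] /(nthP 1)[j hj <-] Gij.
by have [->//|ij] := eqVneq i j; case: (rep i j hi hj) => //; exact/eqP.
Qed.

(** Brought back to the modular triangle, an overlap is an integral matrix taking one of its
    interior points to another, hence 1 or -1. *)
Lemma translate_overlap h k g z z' : psl2Z h -> psl2Z k -> G g ->
  modular_open z -> modular_open z' ->
  moebius (M * h) z = moebius g (moebius (M * k) z') ->
  M * h * k^-1 * M^-1 = g \/ M * h * k^-1 * M^-1 = - g.
Proof.
move=> hh hk Gg mz mz' e.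
have [z0 _ _] := mz; have [z0' _ _] := mz'.
have [[dh dk] dg] := (psl2Z_det hh, psl2Z_det hk, psl2_det Gg).
have dMh : \det (M * h) = 1 by exact: det1M.
have dMk : \det (M * k) = 1 by exact: det1M.
have hl : psl2Z (h^-1 * (M^-1 * g * M) * k).
  by apply: psl2Z_mul => //; apply: psl2Z_mul; [exact: psl2Z_inv|exact: hGM].
set l := _ * k in hl.
have lz : moebius l z' = z.
  have lE : l = (M * h)^-1 * (g * (M * k)).
    by rewrite invrM ?unit_det1 // /l !mulrA.
  rewrite lE moebiusM ?det1V ?det1M // moebiusM // -e moebiusK //.
have gE : g = M * h * l * k^-1 * M^-1.
  have [uh uk] := (unit_det1 dh, unit_det1 dk).
  by rewrite /l !mulrA mulrK // -[M * h * h^-1]mulrA mulrV // mulr1 mulrV // mul1r mulrK.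
have [l1|l1] := modular_open_disjoint hl mz' (eq_ind_r _ mz lz).
  by left; rewrite gE l1 mulr1.
by right; rewrite gE l1 mulrN mulr1 !mulNr opprK.
Qed.

Lemma modular_open_uhp : modular_open `<=` @uhp R.
Proof. by move=> z []. Qed.

Lemma modular_closed_uhp : modular_closed `<=` @uhp R.
Proof. by move=> z []. Qed.

Lemma translates_disjoint s h k : coset_reps s -> h \in s -> k \in s -> h != k ->
  moebius (M * h) @` modular_open `&` moebius (M * k) @` modular_open = set0.
Proof.
move=> cs hs ks; have [ps _] := cs; apply: contra_neqP => /eqP/set0P[_ [[z mz <-] [z' mz' e]]].
apply: (coset_reps_eq cs) => //.
have k0 : uhp (moebius (M * k) z').
  by apply: moebius_uhp; [exact/det1M/psl2Z_det/ps|exact: modular_open_uhp].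
have e1 : moebius (M * h) z = moebius 1 (moebius (M * k) z') by rewrite moebius1.
case: (translate_overlap (ps _ hs) (ps _ ks) (psl2_1 G) mz mz' e1) => ->; last apply: psl2_opp;
  exact: psl2_1.
Qed.

Lemma translates_packing s g : coset_reps s -> G g -> g <> 1 -> g <> -1 ->
  hyp_area (translates s modular_open `&` moebius g @` translates s modular_open) = 0%E.
Proof.
move=> cs Gg g1 gN1; have [ps _] := cs; rewrite (_ : _ `&` _ = set0).
  by rewrite /hyp_area integral_set0.
rewrite -subset0 => _ [[h hs [z mz <-]] [_ [k ks [z' mz' <-]] e]].
have ov := translate_overlap (ps _ hs) (ps _ ks) Gg mz mz' (esym e).
have hk : h = k.
  by apply: (coset_reps_eq cs) => //; case: ov => ->; [|exact: psl2_opp].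
move: ov; rewrite hk.
have u : k \is a GRing.unit by apply/unit_det1/psl2Z_det/ps.
rewrite -[M * _ * _]mulrA mulrV // mulr1 mulrV // => -[|/eqP].
  by move/esym.
by rewrite eq_sym eqr_oppLR => /eqP.
Qed.

(** An integral matrix k reduces the uncovered point into the modular triangle. The coset of [k^-1]
    is new, since otherwise the orbit of the point would meet a listed translate. *)
Lemma coset_reps_extend s z : coset_reps s -> uhp z ->
  (forall g, G g -> ~ translates s modular_closed (moebius g z)) ->
  exists k, coset_reps (k :: s).
Proof.
move=> cs z0 nz; have [ps rep] := cs.
have [k hk mk] := modular_reduction (moebius_uhp (det1V dM) z0).
have dk := psl2Z_det hk; exists k^-1.
have key h : h \in s -> ~ G (M * h * k * M^-1).
  move=> hs Gh; apply: (nz _ Gh); exists h => //.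
  exists (moebius k (moebius M^-1 z)) => //.
  have dh := psl2Z_det (ps _ hs).
  have z1 := moebius_uhp (det1V dM) z0; have z2 := moebius_uhp dk z1.
  by rewrite !moebiusM ?det1M ?det1V.
have hkV := psl2Z_inv hk; split.
  by move=> h; rewrite in_cons => /orP[/eqP->|/ps].
move=> [|i] [|j] //=; rewrite ?ltnS => hi hj ij.
- have [uj uk] := (unit_det1 (psl2Z_det (ps _ (mem_nth 1 hj))), unit_det1 dk).
  move=> /psl2_inv; rewrite !invrM ?unitrMl ?unitrV //.
  rewrite !invrK !mulrA; exact: key (mem_nth 1 hj).
- by rewrite invrK; exact: key (mem_nth 1 hi).
- by apply: rep => // e; apply: ij; rewrite e.
Qed.

Hypothesis cof : cofinite G.

(** Finite index from finite area: n representatives pack n disjoint triangles of area pi / 3 into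
    the area of F, so the extension must stop, and then the closed translates cover. *)
Lemma coset_reps_complete : exists2 s, coset_reps s &
  forall z, uhp z -> exists2 g, G g & translates s modular_closed (moebius g z).
Proof.
apply: contrapT => H.
have ext n : exists2 s, coset_reps s & size s = n.
  elim: n => [|n [s cs ss]]; first by exists [::].
  have [z z0 nz] : exists2 z, uhp z & forall g, G g -> ~ translates s modular_closed (moebius g z).
    apply: contrapT => nz; apply: H; exists s => // z z0.
    apply: contrapT => ng; apply: nz; exists z => // g Gg tg; apply: ng; by exists g.
  have [k ck] := coset_reps_extend cs z0 nz.
  by exists (k :: s) => //=; rewrite ss.
have [F [mF Fu covF _] Ffin] := cof.
have [iota inj] := group_index dM hGM.
have pi0 : 0 < pi / 3 :> R by rewrite divr_gt0 // pi_gt0.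
have le n : ((n%:R * (pi / 3))%:E <= hyp_area F)%E.
  have [s cs <-] := ext n; have [ps _] := cs.
  have [us ms] := translates_measurable ps modular_open_uhp (@measurable_modular_open R).
  rewrite -(area_translates modular_open_uhp (@measurable_modular_open R) (@area_modular_open R) ps).
  - have := @hyp_area_pack_le_cover R G iota _ _ uhp inj ms mF (@measurable_uhp R) us Fu _ covF.
    rewrite !setIidl //; apply; first by move=> g; exact: translates_packing.
    by move=> g z Gg z0 _; exact: moebius_uhp (psl2_det Gg) z0.
  - exact: coset_reps_uniq.
  - by move=> h k; exact: translates_disjoint.
have F0 : (0 <= hyp_area F)%E by have := le 0; rewrite mul0r.
have fE : hyp_area F = (fine (hyp_area F))%:E by rewrite fineK // ge0_fin_numE.
have := le (Num.truncn (fine (hyp_area F) / (pi / 3))).+1.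
rewrite fE lee_fin -ler_pdivlMr // leNgt => /negP; apply.
by rewrite /= truncnS_gt.
Qed.

Lemma lattice_density : has_packing_density G (lattice_height M) (3 / pi).
Proof.
have [F fF Ffin] := cof; have [mF Fu covF packF] := fF; exists F; split=> //.
have [s cs covs] := coset_reps_complete; have [ps _] := cs.
have [iota inj] := group_index dM hGM.
have pi0 : 0 < pi :> R by exact: pi_gt0.
have s0 : ((size s)%:R : R) != 0.
  have [|g _ [k ks _]] := covs (0, 1); first exact: ltr01.
  by rewrite pnatr_eq0; case: (s) ks.
(* Two comparisons squeeze the area: F packs while the closed translates cover, and the open
   translates pack while F covers. With N the half-plane this gives the area of F, with N the
   horoballs that of the cusp neighbourhoods. *)
have areaE N a : N `<=` uhp -> measurable (N : set (mR * mR)) ->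
    (forall k z, psl2Z k -> uhp z -> N z -> N (moebius k z)) ->
    hyp_area (modular_open `&` N) = a%:E -> hyp_area (modular_closed `&` N) = a%:E ->
    hyp_area (F `&` moebius M @` N) = ((size s)%:R * a)%:E.
  move=> Nu mN actN ao ac.
  have [mMN _] := hyp_area_moebius dM mN Nu.
  have MN_act g z : G g -> uhp z -> (moebius M @` N) z -> (moebius M @` N) (moebius g z).
    move=> Gg _ [y Ny <-]; have y0 := Nu _ Ny.
    have hl := hGM Gg; have dl := psl2Z_det hl.
    exists (moebius (M^-1 * g * M) y); first exact: actN.
    by rewrite -!moebiusM ?(psl2_det Gg) // !mulrA mulrV // mul1r.
  have TE D : D `<=` uhp -> translates s D `&` moebius M @` N = translates s (D `&` N).
    move=> Du; apply/seteqP; split=> z.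
      move=> [[k ks [y Dy <-]] [x Nx e]]; exists k => //; exists y => //; split=> //.
      have dk := psl2Z_det (ps _ ks); have y0 := Du _ Dy; have x0 := Nu _ Nx.
      have -> : y = moebius k^-1 x; last by apply: actN => //; exact/psl2Z_inv/ps.
      have e' : moebius M x = moebius M (moebius k y) by rewrite -moebiusM.
      have := congr1 (moebius M^-1) e'; rewrite !moebiusK //; last exact: moebius_uhp.
      by move=> ->; rewrite moebiusK.
    move=> [k ks [y [Dy Ny] <-]]; split; first by exists k => //; exists y.
    have dk := psl2Z_det (ps _ ks); have y0 := Du _ Dy.
    exists (moebius k y); last by rewrite moebiusM.
    by apply: actN => //; exact: ps.
  have [uo mo] := translates_measurable ps modular_open_uhp (@measurable_modular_open R).
  have [uc mc] := translates_measurable ps modular_closed_uhp (@measurable_modular_closed R).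
  apply/le_anti/andP; split.
    have := @hyp_area_pack_le_cover R G iota _ _ _ inj mF mc mMN Fu uc packF covs MN_act.
    move/le_trans; apply; rewrite TE; last exact: modular_closed_uhp.
    apply: area_translates_le => //; first by move=> z [/modular_closed_uhp].
    by apply: measurableI => //; exact: measurable_modular_closed.
  have := @hyp_area_pack_le_cover R G iota _ _ _ inj mo mF mMN uo Fu _ covF MN_act.
  rewrite TE; last exact: modular_open_uhp.
  rewrite (area_translates (a := a)) //; first by apply=> g; exact: translates_packing.
  - by move=> z [/modular_open_uhp].
  - by apply: measurableI => //; exact: measurable_modular_open.
  - exact: coset_reps_uniq.
  - move=> h k hs ks hk; have := translates_disjoint cs hs ks hk.
    move/seteqP => [e _]; rewrite -subset0 => z [[x [mx _] <-] [y [my _] e']].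
    by apply: (e (moebius (M * h) x)); split; [exists x|exists y].
have area1 : hyp_area F = ((size s)%:R * (pi / 3))%:E.
  rewrite -(areaE uhp) //.
  - congr hyp_area; apply/esym/setIidl => z /Fu z0; exists (moebius M^-1 z).
      by apply: moebius_uhp => //; exact: det1V.
    by rewrite moebiusVK.
  - exact: measurable_uhp.
  - by move=> k z /psl2Z_det dk z0 _; exact: moebius_uhp.
  - rewrite setIidl; [exact: area_modular_open|exact: modular_open_uhp].
  - rewrite setIidl; [exact: area_modular_closed|exact: modular_closed_uhp].
have -> : cusp_neighbourhoods G (lattice_height M) = moebius M @` modular_horoballs.
  apply/seteqP; split=> z; rewrite (lattice_cusp_neighbourhoods dM hGM cof).
    by move=> [z0 hz]; exists (moebius M^-1 z) => //; rewrite moebiusVK.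
  by move=> [y hy <-]; have [y0 _] := hy; rewrite moebiusK //; split=> //; exact: moebius_uhp.
rewrite area1 (areaE modular_horoballs 1) /=.
- by rewrite mulr1; move: (@pi R) pi0 => x x0; field; rewrite s0 gt_eqF.
- by move=> z [].
- exact: measurable_modular_horoballs.
- by move=> k z; exact: modular_horoballs_act.
- by rewrite modular_open_horoballs area_modular_open_cusp.
- by rewrite modular_closed_horoballs area_modular_closed_cusp.
Qed.

End LatticeDensity.

(** * The Farey triangulation *)

Section IdealTriangle.
Context {R : realType}.
Implicit Types (v w u a b c : R * R) (z : R * R) (k : R * R) (g h : 'M[R]_2).

(** a, b and c = - (a + b) form an obtuse superbase: the negated polar values are Selling's
    parameters, positive exactly inside the ideal triangle with vertices at the three slopes. *)
Definition ideal_triangle a b : set (R * R) :=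
  [set z | [/\ uhp z, bf z a b < 0, bf z b (- (a + b)) < 0 & bf z (- (a + b)) a < 0]].

Lemma qf_selling z a b u : vdet a b = 1 ->
  qf z u = - bf z b (- (a + b)) * vdet a u ^+ 2 - bf z (- (a + b)) a * vdet b u ^+ 2
           - bf z a b * vdet (- (a + b)) u ^+ 2.
Proof.
move=> d; have uE : u = vdet u b *: a + vdet a u *: b by rewrite -vdet_expand d scale1r.
rewrite {1}uE /qf !(bfDl, bfDr, bfZl, bfZr, bfNl, bfNr) (bfC z b a).
by rewrite vdetNl vdetDl (vdetC b u); ring.
Qed.

Lemma qf_triangle z a b : vdet a b = 1 ->
  [/\ qf z a = - bf z a b - bf z (- (a + b)) a, qf z b = - bf z a b - bf z b (- (a + b)) &
      qf z (- (a + b)) = - bf z b (- (a + b)) - bf z (- (a + b)) a].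
Proof.
by move=> d; rewrite /qf !(bfDl, bfDr, bfNl, bfNr) (bfC z b a); split; ring.
Qed.

Lemma gram_triangle z a b : uhp z -> vdet a b = 1 ->
  bf z a b * bf z b (- (a + b)) + bf z b (- (a + b)) * bf z (- (a + b)) a +
  bf z (- (a + b)) a * bf z a b = 1.
Proof.
move=> z0 d; have := qf_gram a b z0; rewrite d expr1n.
have [-> -> _] := qf_triangle z d => h; apply: (addrI (bf z a b ^+ 2)); rewrite -h.
ring.
Qed.

(** The second elementary symmetric function of the barycentric coordinates. Divided by its square
    root, these become Selling parameters of a form of determinant 1. *)
Definition bary_sigma k : R :=
  k.1 * k.2 + (1 - (k.1 + k.2)) * k.1 + (1 - (k.1 + k.2)) * k.2.

(** The point whose Selling parameters are proportional to the barycentric coordinates: k.1 for b c,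
    k.2 for c a, the third for a b. In the basis a, b the coefficients 1 / y and - x / y of the form
    give the formula. *)
Definition triangle_point a b k : R * R :=
  moebius (frame a b) ((1 - (k.1 + k.2)) / (1 - k.1), Num.sqrt (bary_sigma k) / (1 - k.1)).

Definition triangle_coord a b z : R * R :=
  let s := bf z b (- (a + b)) + bf z (- (a + b)) a + bf z a b in
  (bf z b (- (a + b)) / s, bf z (- (a + b)) a / s).


Lemma bary_sigma_gt0 k : std_triangle k -> ~ std_triangle_vertices k ->
  0 < bary_sigma k /\ 0 < 1 - k.1.
Proof.
move=> hk nv; have := vertex_gap_gt0 hk nv; have [x0 y0 xy] := hk.
rewrite /vertex_gap /bary_sigma; case: k {hk nv} x0 y0 xy => x y /= x0 y0 xy h.
have x1 : 0 < 1 - x.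
  rewrite lt_neqAle subr_ge0 (le_trans _ xy) ?lerDl // andbT eq_sym.
  by apply: contraTneq h => ->; rewrite mulr0 mul0r ltxx.
have y1 : 0 < 1 - y.
  rewrite lt_neqAle subr_ge0 (le_trans _ xy) ?lerDr // andbT eq_sym.
  by apply: contraTneq h => ->; rewrite mulr0 ltxx.
have s0 : 0 < x + y by move: h; rewrite -mulrA pmulr_lgt0 ?mulr_gt0.
split=> //; have [x00|x00] := eqVneq x 0; first by rewrite x00 in s0 *; nra.
have {}x0 : 0 < x by rewrite lt_neqAle eq_sym x00.
have [y00|y00] := eqVneq y 0; first by rewrite y00; nra.
have {}y0 : 0 < y by rewrite lt_neqAle eq_sym y00.
have : 0 < x * y by exact: mulr_gt0.
have : 0 <= (1 - (x + y)) * (x + y) by apply: mulr_ge0; lra.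
by lra.
Qed.

Lemma triangle_point_bf a b k : vdet a b = 1 -> std_triangle k -> ~ std_triangle_vertices k ->
  let z := triangle_point a b k in let s := Num.sqrt (bary_sigma k) in
  [/\ uhp z, 0 < s, bf z a b = - (1 - (k.1 + k.2)) / s, bf z b (- (a + b)) = - k.1 / s &
      bf z (- (a + b)) a = - k.2 / s].
Proof.
move=> d hk nv z s; have [s0 x1] := bary_sigma_gt0 hk nv.
have ss : s ^+ 2 = bary_sigma k by rewrite sqr_sqrtr // ltW.
have {s0}sp : 0 < s by rewrite sqrtr_gt0.
pose y : R * R := ((1 - (k.1 + k.2)) / (1 - k.1), s / (1 - k.1)).
have y0 : uhp y by rewrite /uhp /= divr_gt0.
have dF : \det (frame a b) = 1 by rewrite frame_det.
have zE : z = moebius (frame a b) y by [].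
have aE : a = vact (frame a b) (1, 0) by rewrite vact_frame /= scale1r scale0r addr0.
have bE : b = vact (frame a b) (0, 1) by rewrite vact_frame /= scale1r scale0r add0r.
have cE : - (a + b) = vact (frame a b) (-1, -1).
  by rewrite vact_frame /= !scaleN1r opprD.
have bfE v w : bf z (vact (frame a b) v) (vact (frame a b) w) = bf y v w by rewrite zE bf_act.
have [sn xn] : s != 0 /\ 1 - k.1 != 0 by rewrite !gt_eqF.
rewrite [in bf z _ (- _)]cE [in bf z (- _) _]cE.
have -> : bf z a b = bf y (1, 0) (0, 1) by rewrite -bfE -aE -bE.
have -> : bf z b (vact (frame a b) (-1, -1)) = bf y (0, 1) (-1, -1) by rewrite -bfE -bE.
have -> : bf z (vact (frame a b) (-1, -1)) a = bf y (-1, -1) (1, 0) by rewrite -bfE -aE.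
split=> //; first by rewrite zE; exact: moebius_uhp.
- by rewrite /bf /=; field; rewrite sn xn.
- rewrite /bf /=; move: ss; rewrite /bary_sigma => ss.
  have -> : (0 - 1 * ((1 - (k.1 + k.2)) / (1 - k.1))) * (-1 - -1 * ((1 - (k.1 + k.2)) / (1 - k.1))) +
    1 * -1 * (s / (1 - k.1)) ^+ 2 =
    ((1 - (k.1 + k.2)) * (1 - k.1) - (1 - (k.1 + k.2)) ^+ 2 - s ^+ 2) / (1 - k.1) ^+ 2 by field.
  by rewrite ss; field; rewrite sn xn.
- by rewrite /bf /=; field; rewrite sn xn.
Qed.

Lemma triangle_coordK a b k : vdet a b = 1 -> std_triangle k -> ~ std_triangle_vertices k ->
  triangle_coord a b (triangle_point a b k) = k.
Proof.
move=> d hk nv; have [_ s0 e1 e2 e3] := triangle_point_bf d hk nv.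
rewrite /triangle_coord e1 e2 e3; move: s0; case: k {hk nv e1 e2 e3} => x y /=.
by move: (Num.sqrt _) => s s0; congr (_, _); field; rewrite gt_eqF //= lt_eqF //; lra.
Qed.

Definition closed_triangle a b : set (R * R) :=
  [set z | [/\ uhp z, bf z a b <= 0, bf z b (- (a + b)) <= 0 & bf z (- (a + b)) a <= 0]].

Lemma triangle_sum_lt0 a b z : vdet a b = 1 -> closed_triangle a b z ->
  bf z b (- (a + b)) + bf z (- (a + b)) a + bf z a b < 0.
Proof.
move=> d [z0 h1 h2 h3]; have := gram_triangle z0 d.
move: (bf z a b) (bf z b _) (bf z _ a) h1 h2 h3 => p q r h1 h2 h3 gr.
rewrite ltNge; apply/negP => h; have [p0 q0] : p = 0 /\ q = 0 by split; lra.
by move: gr; rewrite p0 q0; lra.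
Qed.

Lemma triangle_pointK a b z : vdet a b = 1 -> closed_triangle a b z ->
  [/\ std_triangle (triangle_coord a b z), ~ std_triangle_vertices (triangle_coord a b z) &
      triangle_point a b (triangle_coord a b z) = z].
Proof.
move=> d cz; have s0 := triangle_sum_lt0 d cz; have [z0 h1 h2 h3] := cz.
have gr := gram_triangle z0 d.
have [qa qb qc] := qf_triangle z d.
pose r := - bf z a b; pose p := - bf z b (- (a + b)); pose q := - bf z (- (a + b)) a.
have rE : bf z a b = - r by rewrite opprK.
have pE : bf z b (- (a + b)) = - p by rewrite opprK.
have qE : bf z (- (a + b)) a = - q by rewrite opprK.
clearbody p q r; rewrite rE pE qE in s0 h1 h2 h3 gr qa qb qc; rewrite !oppr_le0 in h1 h2 h3.
have spos : 0 < p + q + r by lra.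
have gr' : r * p + p * q + q * r = 1 by rewrite -gr; ring.
have kE : triangle_coord a b z = (p / (p + q + r), q / (p + q + r)).
  rewrite /triangle_coord rE pE qE; congr (_, _); field;
    by rewrite gt_eqF //= lt_eqF //; lra.
have hk : std_triangle (triangle_coord a b z).
  rewrite kE; split=> /=; try by rewrite divr_ge0 // ltW.
  by rewrite -mulrDl ler_pdivrMr //; lra.
have nv : ~ std_triangle_vertices (triangle_coord a b z).
  have pn : p + q + r != 0 by rewrite gt_eqF.
  rewrite kE => -[[|]|] /pair_equal_spec[/(congr1 ( *%R^~ (p + q + r)))e1 /(congr1 ( *%R^~ (p + q + r)))e2];
    move: e1 e2; rewrite !divfK // ?mul0r ?mul1r => e1 e2.
  - by move: gr'; rewrite e1 e2; lra.
  - by move: gr'; rewrite e2; nra.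
  - by move: gr'; rewrite e1; nra.
split=> //; have [y0 s1 e1 e2 e3] := triangle_point_bf d hk nv.
(* By [gram_triangle] the normalising factor is the inverse of the sum of the parameters. *)
have sE : Num.sqrt (bary_sigma (triangle_coord a b z)) = (p + q + r)^-1.
  have -> : bary_sigma (triangle_coord a b z) = ((p + q + r)^-1) ^+ 2.
    by rewrite kE /bary_sigma /= -[RHS]mul1r -[in RHS]gr'; field; rewrite gt_eqF.
  by rewrite sqrtr_sqr ger0_norm // invr_ge0 ltW.
have k1E : - (1 - ((triangle_coord a b z).1 + (triangle_coord a b z).2)) /
    Num.sqrt (bary_sigma (triangle_coord a b z)) = - r.
  by rewrite sE kE /=; field; rewrite gt_eqF.
have k2E : - (triangle_coord a b z).1 / Num.sqrt (bary_sigma (triangle_coord a b z)) = - p.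
  by rewrite sE kE /=; field; rewrite gt_eqF.
have k3E : - (triangle_coord a b z).2 / Num.sqrt (bary_sigma (triangle_coord a b z)) = - q.
  by rewrite sE kE /=; field; rewrite gt_eqF.
rewrite k1E in e1; rewrite k2E in e2; rewrite k3E in e3.
have [ya yb _] := qf_triangle (triangle_point a b (triangle_coord a b z)) d.
apply: (form_inj (v := a) (w := b)) => //.
- by rewrite d oner_neq0.
- by rewrite qa ya e1 e3.
- by rewrite e1 rE.
- by rewrite qb yb e1 e2.
Qed.

Lemma triangle_coord_cvg a b z : vdet a b = 1 -> closed_triangle a b z ->
  triangle_coord a b y @[y --> z] --> triangle_coord a b z.
Proof.
move=> d cz; have [z0 _ _ _] := cz; have s0 := triangle_sum_lt0 d cz.
have cs : (fun y => bf y b (- (a + b)) + bf y (- (a + b)) a + bf y a b) y @[y --> z] -->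
    bf z b (- (a + b)) + bf z (- (a + b)) a + bf z a b.
  by do 2?apply: cvgD; exact: bf_cvg.
by apply: cvg_to_pair; apply: cvgM; try exact: bf_cvg;
  apply: cvgV cs; rewrite lt_eqF.
Qed.

Lemma bary_sigma_cvg k : bary_sigma x @[x --> k] --> bary_sigma k.
Proof. by rewrite /bary_sigma; cvg_arith. Qed.

Lemma triangle_point_cvg a b k : vdet a b = 1 -> std_triangle k -> ~ std_triangle_vertices k ->
  triangle_point a b x @[x --> k] --> triangle_point a b k.
Proof.
move=> d hk nv; have [s0 x1] := bary_sigma_gt0 hk nv.
have inv : (1 - x.1)^-1 @[x --> k] --> (1 - k.1)^-1.
  by apply: cvgV; [rewrite gt_eqF|cvg_arith].
have base : ((1 - (x.1 + x.2)) / (1 - x.1), Num.sqrt (bary_sigma x) / (1 - x.1)) @[x --> k] -->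
    ((1 - (k.1 + k.2)) / (1 - k.1), Num.sqrt (bary_sigma k) / (1 - k.1)).
  apply: cvg_to_pair; apply: cvgM => //; first by cvg_arith.
  by apply: cvg_comp (@bary_sigma_cvg k) _; exact: sqrt_continuous.
have dF : \det (frame a b) = 1 by rewrite frame_det.
have y0 : uhp ((1 - (k.1 + k.2)) / (1 - k.1), Num.sqrt (bary_sigma k) / (1 - k.1)).
  by rewrite /uhp /= divr_gt0 // sqrtr_gt0.
exact: cvg_comp base (moebius_cvg dF y0).
Qed.

End IdealTriangle.

(** * Translates of edges and triangles *)

Section TriangleTranslates.
Context {R : realType}.
Variables (G : psl2_subgroup R) (V : set (R * R)).
Hypothesis hV : unimodular V.
Hypothesis VG : forall g v, G g -> V v -> V (vact g v).
Hypothesis tfG : torsion_free G.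
Implicit Types (v w u : R * R) (z : R * R) (g h : 'M[R]_2).

(** By [edge_unique], g maps the edge to itself, so it permutes v and w up to sign and its powers
    are bounded. *)
Lemma edge_line_inj v w z z' g : edge V v w -> uhp z -> G g ->
  bf z v w = 0 -> moebius g z = z' -> bf z' v w = 0 -> g = 1 \/ g = -1.
Proof.
move=> evw z0 Gg b0 gz b0'; have dg := psl2_det Gg.
have [Vv Vw d] := evw.
have z0' : uhp z' by rewrite -gz; exact: moebius_uhp.
have gvw : edge V (vact g v) (vact g w) by split; rewrite ?vdet_act //; exact: VG.
have gb0 : bf z' (vact g v) (vact g w) = 0 by rewrite -gz bf_act.
pose P u := (u = v \/ u = - v) \/ (u = w \/ u = - w).
have Pv : P (vact g v) /\ P (vact g w).
  by have [[h1 h2]|[h1 h2]] := edge_unique hV z0' evw gvw b0' gb0; split; [left|right|right|left].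
have Pg u : P u -> P (vact g u).
  have PN y : P y -> P (- y).
    by move=> [[->|->]|[->|->]]; rewrite ?opprK; [left; right|left; left|right; right|right; left].
  by move=> [[->|->]|[->|->]]; rewrite ?vact_opp; try apply: PN; case: Pv.
have PX n : P (vact (g ^+ n) v) /\ P (vact (g ^+ n) w).
  elim: n => [|n [IH1 IH2]]; first by rewrite !vact1; split; [left; left|right; left].
  by rewrite exprS !vactM; split; exact: Pg.
have Pq u : P u -> qf z u <= Num.max (qf z v) (qf z w).
  by move=> [[->|->]|[->|->]]; rewrite ?qfN le_max lexx ?orbT.
apply: (bounded_powers_trivial hV VG tfG (M := Num.max (qf z v) (qf z w)) evw z0 Gg) => n.
by have [h1 h2] := PX n; split; exact: Pq.
Qed.

Lemma edge_line_isolated v w z : edge V v w -> uhp z -> bf z v w = 0 ->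
  \forall y \near z, forall g z2, G g -> uhp z2 -> bf z2 v w = 0 ->
    moebius g z2 = y -> bf y v w = 0.
Proof.
move=> evw z0 b0.
wlog qv : v w evw b0 / qf z v < 2.
  move=> H; have [h|h] := ltP (qf z v) 2; first exact: H.
  have h2 : qf z w < 2.
    have := edge_qf z0 evw b0; have [Vv Vw _] := evw; have [V0 _ _] := hV.
    by have := qf_gt0 z0 (V0 _ Vv); have := qf_gt0 z0 (V0 _ Vw) => *; nra.
  have ewv := edgeC evw; rewrite bfC in b0.
  have := H w v ewv b0 h2; apply: filterS => y hy g z2 Gg z20 bz2 gz.
  by rewrite bfC; apply: (hy g z2) => //; rewrite bfC.
have [Vv Vw d] := evw; have [V0 _ _] := hV.
have c1 : \forall y \near z, qf y v < 2 by have /cvgr_lt/(_ _ qv) := @qf_cvg R z v z0.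
have c2 : \forall y \near z, `|bf y v w| < qf y v.
  have c : (qf y v - `|bf y v w|) @[y --> z] --> qf z v - `|bf z v w|.
    by apply: cvgB; [exact: qf_cvg|apply: cvg_norm; exact: bf_cvg].
  have p0 : 0 < qf z v - `|bf z v w| by rewrite b0 normr0 subr0 qf_gt0 // V0.
  have : \forall y \near z, 0 < qf y v - `|bf y v w| by exact: (cvgr_gt _ c).
  by apply: filterS => y; rewrite subr_gt0.
near=> y => g z2 Gg z20 bz2 gz; have dg := psl2_det Gg.
have y0 : uhp y by near: y; exact: nbhs_uhp.
apply: (edge_near (V := V) hV y0 evw (u := vact g v) (u' := vact g w)).
- by near: y.
- by near: y.
- by split; rewrite ?vdet_act //; exact: VG.
- by rewrite -gz bf_act.
Unshelve. all: by end_near.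
Qed.

(** Serves open triangles and edges alike. As the projection is open, its inverse on the image of E
    is continuous once points close to E and equivalent to points of E are in E; edges need this as
    an extra condition, not being open. *)
Lemma homeomorphism_proj (A E : set (R * R)) (psi theta : R * R -> R * R) phi :
  E `<=` uhp -> (forall k, A k -> [/\ phi k = proj G (psi k), E (psi k) & theta (psi k) = k]) ->
  (forall z, E z -> [/\ A (theta z), psi (theta z) = z & theta y @[y --> z] --> theta z]) ->
  (forall z z', E z -> E z' -> proj G z = proj G z' -> z = z') ->
  (forall z, E z -> \forall y \near z, forall z2, E z2 -> uhp y -> proj G z2 = proj G y -> E y) ->
  cont_on A phi -> homeomorphism_on A (proj G @` E) phi.
Proof.
move=> Eu Apsi Etheta inj iso cphi.
pose f y := theta (xget (0, 0) [set z | E z /\ proj G z = y]).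
have fE z : E z -> f (proj G z) = theta z.
  move=> Ez; rewrite /f; case: xgetP => [z' _ [Ez' e]|/(_ z)]; last by case.
  by rewrite (inj _ _ Ez' Ez e).
split.
- split.
  + by move=> k Ak; have [-> Ek _] := Apsi _ Ak; exists (psi k).
  + move=> k k' /set_mem Ak /set_mem Ak'.
    have [-> Ek <-] := Apsi _ Ak; have [-> Ek' <-] := Apsi _ Ak'.
    have [_ -> _] := Etheta _ Ek; have [_ -> _] := Etheta _ Ek'.
    by move=> e; rewrite (inj _ _ Ek Ek' e).
  + move=> _ [z Ez <-]; have [At pt _] := Etheta _ Ez; exists (theta z) => //.
    by have [-> _ _] := Apsi _ At; rewrite pt.
- exact/cont_onP.
- exists f; last by move=> k Ak; have [-> Ek <-] := Apsi _ Ak; rewrite fE // ; have [_ ->] := Etheta _ Ek.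
  apply/cont_onP/cont_onE => _ N [z Ez <-]; rewrite fE // => Nz.
  have [_ _ ct] := Etheta _ Ez; have z0 := Eu _ Ez.
  have : nbhs z [set y | [/\ uhp y, N (theta y) & forall z2, E z2 -> uhp y -> proj G z2 = proj G y -> E y]].
    near=> y; split; [near: y; exact: nbhs_uhp|near: y; exact: ct|near: y; exact: iso].
  rewrite nbhsE => -[U [oU Uz] US].
  have oP : open (proj G @` U) by apply: open_proj_image => // y /US[].
  have nP : nbhs (proj G z) (proj G @` U) by apply: open_nbhs_nbhs; split=> //; exists z.
  apply: filterS nP => _ [y Uy <-] [z2 Ez2 e]; have [y0 Ny hy] := US _ Uy.
  by rewrite fE //; exact: hy e.
Unshelve. all: by end_near.
Qed.

Section Triangle.
Variables a b : R * R.
Local Notation c := (- (a + b)).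
Hypotheses (Va : V a) (Vb : V b) (Vc : V c) (dab : vdet a b = 1).
Local Notation T := (ideal_triangle a b).

Lemma triangle_edges : [/\ edge V a b, edge V b c & edge V c a].
Proof.
split; split=> //; first by rewrite dab normr1.
  by rewrite vdetNr vdetDr vdetvv addr0 (vdetC a b) opprK dab normr1.
by rewrite vdetNl vdetDl vdetvv add0r (vdetC a b) opprK dab normr1.
Qed.

Definition triangle_vector u :=
  [\/ u = a \/ u = - a, u = b \/ u = - b | u = c \/ u = - c].

(** The sum of Selling's parameters separates vectors inside the triangle: the six vectors of the
    triangle have smaller form, all others in V at least this value. *)
Definition triangle_sum z : R := - bf z b c - bf z c a - bf z a b.

Lemma triangle_short_vectors z u : T z -> V u -> ~ triangle_vector u ->
  triangle_sum z <= qf z u.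
Proof.
move=> [z0 h1 h2 h3] Vu nP; rewrite (qf_selling z u dab) /triangle_sum.
have D v : V v -> (u = v \/ u = - v -> triangle_vector u) -> 1 <= vdet v u ^+ 2.
  move=> Vv hv; apply: (sqr_vdet_ge1 hV) => // e; apply: nP; apply: hv; [left|right]; exact: e.
have Da : 1 <= vdet a u ^+ 2 by apply: D => // ?; constructor 1.
have Db : 1 <= vdet b u ^+ 2 by apply: D => // ?; constructor 2.
have Dc : 1 <= vdet c u ^+ 2 by apply: D => // ?; constructor 3.
move: (bf z a b) (bf z b c) (bf z c a) h1 h2 h3 => r p q *.
by nra.
Qed.

(** With parameters p, q, r the form of a is q + r, and (q + r)(p + q + r) = 1 + q^2 + q r + r^2. *)
Lemma triangle_vector_qf z u : T z -> triangle_vector u ->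
  qf z u < triangle_sum z /\ 1 < qf z u * triangle_sum z.
Proof.
move=> [z0 h1 h2 h3] Pu; have [qa qb qc] := qf_triangle z dab.
rewrite qfN in qc.
have K (x y w : R) : x < 0 -> y < 0 -> x * y + y * w + w * x = 1 ->
    1 < (- x - y) * (- x - y - w).
  move=> x0 y0 e; have xy : 0 < x * y by rewrite nmulr_rgt0.
  have -> : (- x - y) * (- x - y - w) = x * y + y * w + w * x + (x ^+ 2 + x * y + y ^+ 2) by ring.
  by rewrite e; have := sqr_ge0 x; have := sqr_ge0 y; lra.
have := gram_triangle z0 dab; rewrite /triangle_sum.
case: Pu => -[->|->]; rewrite ?qfN ?qa ?qb ?qc;
  move: (bf z a b) (bf z b c) (bf z c a) h1 h2 h3 => r p q r0 p0 q0 e; (split; first lra);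
  have e1 : r * q + q * p + p * r = 1 by rewrite -e; ring.
all: have e2 : r * p + p * q + q * r = 1 by rewrite -e; ring.
all: have e3 : p * q + q * r + r * p = 1 by rewrite -e; ring.
all: by have := K _ _ _ r0 q0 e1; have := K _ _ _ r0 p0 e2; have := K _ _ _ p0 q0 e3; lra.
Qed.

(** The forms of an edge through z have product 1. This excludes two vectors outside the six, and by
    [triangle_vector_qf] one inside and one outside; two of the six are never orthogonal in the open
    triangle. *)
Lemma triangle_edge_free : T `<=` edge_free V.
Proof.
move=> z Tz u u' euu' b0; have [z0 h1 h2 h3] := Tz; have [Vu Vu' d] := euu'.
have q1 := edge_qf z0 euu' b0.
have s1 : 1 < triangle_sum z * triangle_sum z.
  have := gram_triangle z0 dab; rewrite /triangle_sum.
  by move: (bf z a b) (bf z b c) (bf z c a) h1 h2 h3 => r p q *; nra.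
have s0 : 0 < triangle_sum z by rewrite /triangle_sum; lra.
have q u1 : V u1 -> (triangle_vector u1 /\ 1 < qf z u1 * triangle_sum z) \/ triangle_sum z <= qf z u1.
  move=> Vu1; have [Pu|Pu] := pselect (triangle_vector u1).
    by left; split=> //; have [] := triangle_vector_qf Tz Pu.
  by right; exact: triangle_short_vectors.
case: (q _ Vu) (q _ Vu') => [[Pu qu]|qu] [[Pu' qu']|qu']; try by nra.
have [V0 _ _] := hV.
have := qf_gt0 z0 (V0 _ Va); have := qf_gt0 z0 (V0 _ Vb); have := qf_gt0 z0 (V0 _ Vc).
move: h1 h2 h3 Pu Pu' b0; rewrite /triangle_vector /qf; move: c => w h1 h2 h3 Pu Pu' b0.
have [h1' h2' h3'] : [/\ bf z b a < 0, bf z w b < 0 & bf z a w < 0].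
  by rewrite (bfC z b a) (bfC z w b) (bfC z a w).
move=> qw qb qa; case: Pu Pu' b0 => -[->|->] [] [->|->]; rewrite ?bfNl ?bfNr; lra.
Qed.

Lemma triangle_kpath z0 z1 r : T z0 -> T z1 -> 0 <= r <= 1 -> T (kpath z0 z1 r).
Proof.
move=> [u0 a0 b0 c0] [u1 a1 b1 c1] hr; have ur := kpath_uhp u0 u1 hr.
have neg v w : bf z0 v w < 0 -> bf z1 v w < 0 -> bf (kpath z0 z1 r) v w < 0.
  move=> n0 n1; rewrite -(pmulr_rlt0 _ (ur : 0 < (kpath z0 z1 r).2)) bf_kpath //.
  have : 0 < (1 - r) * (z0.2 * - bf z0 v w) + r * (z1.2 * - bf z1 v w).
    by apply: mix_gt0 => //; apply: mulr_gt0; rewrite ?oppr_gt0.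
  by move: (bf z0 v w) (bf z1 v w) => x y; rewrite !mulrN -opprD oppr_gt0.
by split=> //; exact: neg.
Qed.

Lemma triangle_face z0 : T z0 -> T = face V z0.
Proof.
move=> T0; have [eab ebc eca] := triangle_edges; apply/seteqP; split=> z.
  move=> Tz; have [zu _ _ _] := Tz; split=> // u u' e.
  apply: (kpath_same_side (P := T)) => //; first by move=> y [].
    by move=> y1 y2 r; exact: triangle_kpath.
  by move=> y /triangle_edge_free; apply.
move: T0 => [_ a0 b0 c0] [zu h]; split=> //.
- by have := h _ _ eab; rewrite nmulr_rgt0.
- by have := h _ _ ebc; rewrite nmulr_rgt0.
- by have := h _ _ eca; rewrite nmulr_rgt0.
Qed.

Lemma triangle_perm_trivial z g : T z -> G g -> triangle_vector (vact g a) ->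
  triangle_vector (vact g b) -> triangle_vector (vact g c) -> g = 1 \/ g = -1.
Proof.
move=> Tz Gg Pa Pb Pc; have [z0 _ _ _] := Tz; have [eab _ _] := triangle_edges.
have PN u : triangle_vector u -> triangle_vector (- u).
  by move=> [[->|->]|[->|->]|[->|->]]; rewrite ?[- - a]opprK ?[- - b]opprK ?[- - c]opprK;
  [constructor 1; right|constructor 1; left|constructor 2; right|constructor 2; left
  |constructor 3; right|constructor 3; left].
have Pg u : triangle_vector u -> triangle_vector (vact g u).
  by move=> [[->|->]|[->|->]|[->|->]] //; rewrite vact_opp; exact: PN.
have PX n u : triangle_vector u -> triangle_vector (vact (g ^+ n) u).
  elim: n => [|n IH] Pu; first by rewrite vact1.
  by rewrite exprS vactM; apply: Pg; exact: IH.
apply: (bounded_powers_trivial hV VG tfG (M := triangle_sum z) eab z0 Gg) => n.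
by split; apply: ltW; apply: (triangle_vector_qf Tz _).1; apply: PX;
  [constructor 1; left|constructor 2; left].
Qed.

(** If [triangle_sum] does not decrease from z to z', the images of the six vectors stay below the
    threshold at z', so g permutes them. Otherwise the inverse is used. *)
Lemma triangle_inj z z' g : T z -> T z' -> G g -> moebius g z = z' -> g = 1 \/ g = -1.
Proof.
have half y y' h : T y -> T y' -> G h -> moebius h y = y' ->
    triangle_sum y <= triangle_sum y' -> h = 1 \/ h = -1.
  move=> Ty Ty' Gh hy le; have dh := psl2_det Gh; have [y0 _ _ _] := Ty.
  have P u : V u -> triangle_vector u -> triangle_vector (vact h u).
    move=> Vu Pu; apply: contrapT => nP.
    have := triangle_short_vectors Ty' (VG Gh Vu) nP.
    rewrite -hy qf_act // hy => h1.
    have [h2 _] := triangle_vector_qf Ty Pu.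
    by have := lt_le_trans h2 (le_trans le h1); rewrite ltxx.
  apply: (triangle_perm_trivial Ty Gh); apply: P => //;
    [constructor 1|constructor 2|constructor 3]; by left.
move=> Tz Tz' Gg gz; have [le|lt] := leP (triangle_sum z) (triangle_sum z').
  exact: half le.
have [z0 _ _ _] := Tz; have dg := psl2_det Gg; have ug := unit_det1 dg.
have gz' : moebius g^-1 z' = z by rewrite -gz moebiusK.
have [e|e] := half _ _ _ Tz' Tz (psl2_inv Gg) gz' (ltW lt).
  by left; rewrite -[g]invrK e invr1.
by right; rewrite -[g]invrK e invrN invr1.
Qed.

Lemma open_triangle : open T.
Proof.
rewrite openE => z [z0 h1 h2 h3].
have lt0 v w : bf z v w < 0 -> \forall y \near z, bf y v w < 0.
  by move=> h; have /cvgr_lt/(_ _ h) := @bf_cvg R z v w z0.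
rewrite /interior; near=> y; split; near: y; [exact: nbhs_uhp|exact: lt0..].
Unshelve. all: by end_near.
Qed.

Lemma triangle_closed : T `<=` closed_triangle a b.
Proof. by move=> z [? ? ? ?]; split=> //; exact: ltW. Qed.

End Triangle.

End TriangleTranslates.

(** * Charts of the Farey triangles *)

Section FareyTriangulation.
Context {R : realType}.
Variables (G : psl2_subgroup R) (t : option R -> R) (V : set (R * R)).
Hypothesis hV : unimodular V.
Hypothesis VG : forall g v, G g -> V v -> V (vact g v).
Hypothesis cuspV : forall p, cusp G p <-> exists2 v, V v & slope v = p.
Hypothesis tV : forall v, V v -> t (slope v) = slope_height v.
Hypothesis tfG : torsion_free G.
Implicit Types (v w u : R * R) (z : R * R) (g h : 'M[R]_2).

Lemma cusp_nbhs v (x : cusped_plane G) (N : set (filled_surface G)) :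
  v != 0 -> val x = inr (slope v) -> nbhs (orbit_of x) N ->
  exists2 s, 0 < s & forall z, uhp z -> qf z v < s -> N (proj G z).
Proof.
move=> v0 xv; rewrite nbhsE => -[U [oU Ux] UN]; rewrite open_filledE in oU.
have [_ /(_ x _ Ux xv)[r r0 hr]] := oU; have h0 := slope_height_gt0 v0.
exists (slope_height v / r); first exact: divr_gt0.
move=> z z0 qz; apply: UN.
have rE : r = slope_height v / (slope_height v / r) by field; rewrite !gt_eqF.
have [|y Uy yz] := hr z.
  by rewrite rE horoball_slope ?divr_gt0.
by rewrite /proj -(plane_pointE yz).2.
Qed.

Section Triangle.
Variables a b : R * R.
Local Notation c := (- (a + b)).
Hypotheses (Va : V a) (Vb : V b) (Vc : V c) (dab : vdet a b = 1).
Local Notation T := (ideal_triangle a b).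
Local Notation psi := (triangle_point a b).
Local Notation theta := (triangle_coord a b).

(** kap is the barycentric coordinate equal to 1 at the corner. As
    [bary_sigma k >= kap k * (1 - kap k)], the squared form of v is at most (1 - kap) / kap, so it
    tends to 0 and the image enters every horoball at v. *)
Lemma triangle_vertex_continuous (phi : R * R -> filled_surface G) (kap : R * R -> R)
    v k0 (x : cusped_plane G) N :
  V v -> val x = inr (slope v) -> kap y @[y --> k0] --> kap k0 -> kap k0 = 1 ->
  (forall k, std_triangle k -> ~ std_triangle_vertices k ->
    [/\ phi k = proj G (psi k), kap k * (1 - kap k) <= bary_sigma k &
        qf (psi k) v = (1 - kap k) / Num.sqrt (bary_sigma k)]) ->
  (forall k, std_triangle_vertices k -> k = k0 \/ kap k = 0) ->
  phi k0 = orbit_of x -> nbhs (phi k0) N ->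
  \forall y \near k0, std_triangle y -> N (phi y).
Proof.
move=> Vv xv ck k1 hphi hvert phi0 Nx; have [V0 _ _] := hV.
have Nk := nbhs_singleton Nx; rewrite phi0 in Nx.
have [s s0 hs] := cusp_nbhs (V0 _ Vv) xv Nx.
have cl : s ^+ 2 * kap y - (1 - kap y) @[y --> k0] --> s ^+ 2 * kap k0 - (1 - kap k0).
  by apply: cvgB; [apply: cvgM => //; exact: cvg_cst|apply: cvgB => //; exact: cvg_cst].
have p0 : 0 < s ^+ 2 * kap k0 - (1 - kap k0) by rewrite k1 subrr subr0 mulr1 exprn_gt0.
have nk : \forall y \near k0, 0 < s ^+ 2 * kap y - (1 - kap y) by exact: (cvgr_gt _ cl).
apply: filterS nk => y hy sy; have [vy|nvy] := pselect (std_triangle_vertices y).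
  have [->//|ky] := hvert _ vy; by move: hy; rewrite ky; lra.
have [-> sig qE] := hphi _ sy nvy; have [z0 s1 _ _ _] := triangle_point_bf dab sy nvy.
apply: hs => //; rewrite qE ltr_pdivrMr //.
have q0 := qf_gt0 z0 (V0 _ Vv); rewrite qE in q0.
have d0 : 0 < 1 - kap y by move: q0; rewrite pmulr_lgt0 // invr_gt0.
have [sg0 _] := bary_sigma_gt0 sy nvy.
rewrite -(ltr_pXn2r (n := 2)) ?nnegrE ?mulr_ge0 ?(ltW d0) ?(ltW s0) ?(ltW s1) //.
rewrite exprMn sqr_sqrtr ?(ltW sg0) //.
have s2 : 0 < s ^+ 2 by rewrite exprn_gt0.
by apply: lt_le_trans (_ : s ^+ 2 * (kap y * (1 - kap y)) <= _); [nra|rewrite ler_pM2l].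
Qed.

Variables xa xb xc : cusped_plane G.
Hypotheses (xaE : val xa = inr (slope a)) (xbE : val xb = inr (slope b))
  (xcE : val xc = inr (slope c)).

(** [bary_sigma] vanishes at the corners, where the formula leaves the half-plane; the three cusps
    are inserted there. *)
Definition triangle_map (k : R * R) : filled_surface G :=
  if k == (1, 0) then orbit_of xa else if k == (0, 1) then orbit_of xb
  else if k == (0, 0) then orbit_of xc else proj G (psi k).
Local Notation phi := triangle_map.

Let neq10 : ((0, 1) == (1, 0) :> R * R) = false.
Proof. by rewrite xpair_eqE (eq_sym 0 1) oner_eq0. Qed.
Let neq00 : ((0, 0) == (1, 0) :> R * R) = false.
Proof. by rewrite xpair_eqE (eq_sym 0 1) oner_eq0. Qed.
Let neq01 : ((0, 0) == (0, 1) :> R * R) = false.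
Proof. by rewrite xpair_eqE (eq_sym 0 1) oner_eq0 andbF. Qed.

Lemma triangle_map_proj k : ~ std_triangle_vertices k -> phi k = proj G (psi k).
Proof.
move=> nv; rewrite /triangle_map; case: eqP => [e|_]; first by case: nv; left; right.
case: eqP => [e|_]; first by case: nv; right.
by case: eqP => [e|//]; case: nv; left; left.
Qed.

Lemma triangle_point_qf k : std_triangle k -> ~ std_triangle_vertices k ->
  let s := Num.sqrt (bary_sigma k) in
  [/\ qf (psi k) a = (1 - k.1) / s, qf (psi k) b = (1 - k.2) / s &
      qf (psi k) c = (1 - (1 - (k.1 + k.2))) / s].
Proof.
move=> hk nv s; have [z0 s0 e1 e2 e3] := triangle_point_bf dab hk nv.
have [-> -> ->] := qf_triangle (psi k) dab; rewrite e1 e2 e3 -/s.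
by split; rewrite !mulNr !opprK -!mulrDl; congr (_ / _); ring.
Qed.

Lemma triangle_map_continuous : cont_on std_triangle phi.
Proof.
apply/cont_onE => k N hk Nk; have [vk|nvk] := pselect (std_triangle_vertices k); last first.
  have [z0 _ _ _ _] := triangle_point_bf dab hk nvk.
  rewrite triangle_map_proj // in Nk.
  have c1 : \forall y \near k, N (proj G (psi y)).
    have cp := triangle_point_cvg dab hk nvk; have cq := @proj_cvg _ G _ z0.
    by have := cp _ (cq _ Nk).
  have c2 : \forall y \near k, 0 < vertex_gap y.
    by have /cvgr_gt/(_ _ (vertex_gap_gt0 hk nvk)) := @vertex_gap_cvg R k.
  near=> y => sy; rewrite triangle_map_proj; first by near: y.
  have : 0 < vertex_gap y by near: y.
  move=> gy [[|]|] e; move: gy; rewrite /vertex_gap e /=.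
  - by rewrite addr0 !mul0r ltxx.
  - by rewrite subrr mulr0 mul0r ltxx.
  - by rewrite subrr mulr0 ltxx.
have sg (y : R * R) : std_triangle y -> [/\ y.1 * (1 - y.1) <= bary_sigma y, y.2 * (1 - y.2) <= bary_sigma y &
    (1 - (y.1 + y.2)) * (1 - (1 - (y.1 + y.2))) <= bary_sigma y].
  move=> [h1 h2 h3]; rewrite /bary_sigma.
  have p1 : 0 <= y.1 * y.2 by exact: mulr_ge0.
  have p2 : 0 <= (1 - (y.1 + y.2)) * y.1 by apply: mulr_ge0 => //; lra.
  have p3 : 0 <= (1 - (y.1 + y.2)) * y.2 by apply: mulr_ge0 => //; lra.
  by split; lra.
case: vk => [[|]|] kE.
- rewrite kE in Nk *.
  apply: (triangle_vertex_continuous (kap := fun y => 1 - (y.1 + y.2)) Vc xcE _ _ _ _ _ Nk) => /=.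
  + by cvg_arith.
  + by rewrite addr0 subr0.
  + move=> y sy nvy; have [_ _ q] := triangle_point_qf sy nvy; have [_ _ s] := sg _ sy.
    by split=> //; exact: triangle_map_proj.
  + by move=> y [[->|->]|->] /=; [left|right|right]; rewrite ?addr0 ?add0r ?subrr.
  + by rewrite /triangle_map neq00 neq01 eqxx.
- rewrite kE in Nk *.
  apply: (triangle_vertex_continuous (kap := fun y => y.1) Va xaE _ _ _ _ _ Nk) => //=.
  + by cvg_arith.
  + move=> y sy nvy; have [q _ _] := triangle_point_qf sy nvy; have [s _ _] := sg _ sy.
    by split=> //; exact: triangle_map_proj.
  + by move=> y [[->|->]|->] /=; [right|left|right].
  + by rewrite /triangle_map eqxx.
- rewrite kE in Nk *.
  apply: (triangle_vertex_continuous (kap := fun y => y.2) Vb xbE _ _ _ _ _ Nk) => //=.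
  + by cvg_arith.
  + move=> y sy nvy; have [_ q _] := triangle_point_qf sy nvy; have [_ s _] := sg _ sy.
    by split=> //; exact: triangle_map_proj.
  + by move=> y [[->|->]|->] /=; [right|right|left].
  + by rewrite /triangle_map neq10 eqxx.
Unshelve. all: by end_near.
Qed.

Lemma proj_inj_of_trivial z z' : uhp z -> uhp z' -> proj G z = proj G z' ->
  (forall g, G g -> moebius g z = z' -> g = 1 \/ g = -1) -> z = z'.
Proof.
move=> z0 z0' /(projP G z0 z0')[g Gg gz] tr.
by rewrite -gz; case: (tr _ Gg gz) => ->; rewrite ?moebiusN moebius1.
Qed.

Lemma triangle_interior_homeomorphism :
  homeomorphism_on std_triangle_interior (proj G @` T) phi.
Proof.
apply: (@homeomorphism_proj _ _ _ _ psi theta).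
- by move=> z [].
- move=> k ik; have sk := std_triangle_interior_sub ik; have nv := interior_not_vertex ik.
  have [z0 s0 e1 e2 e3] := triangle_point_bf dab sk nv; have [k1 k2 k3] := ik.
  split; [exact: triangle_map_proj| |exact: triangle_coordK].
  by split=> //; rewrite ?e1 ?e2 ?e3 mulNr oppr_lt0 divr_gt0 //; lra.
- move=> z Tz; have cz := triangle_closed Tz; have [sk nv pK] := triangle_pointK dab cz.
  split=> //; last exact: triangle_coord_cvg.
  have [z0 s0 e1 e2 e3] := triangle_point_bf dab sk nv.
  have [_ h1 h2 h3] : T (psi (theta z)) by rewrite pK.
  have si : 0 < (Num.sqrt (bary_sigma (theta z)))^-1 by rewrite invr_gt0.
  move: h1 h2 h3; rewrite e1 e2 e3 !mulNr !oppr_lt0 !(pmulr_lgt0 _ si) => h1 h2 h3.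
  by split=> //; lra.
- move=> z z' Tz Tz' e; have [z0 _ _ _] := Tz; have [z0' _ _ _] := Tz'.
  apply: proj_inj_of_trivial e _ => // g Gg gz.
  exact: (triangle_inj hV VG tfG Va Vb Vc dab Tz Tz' Gg gz).
- move=> z Tz; have : nbhs z T by apply: open_nbhs_nbhs; split=> //; exact: open_triangle.
  exact: filterS.
- by apply: cont_on_sub triangle_map_continuous => k; exact: std_triangle_interior_sub.
Qed.

Lemma triangle_side_homeomorphism v w s : edge V v w -> std_triangle_sides s ->
  (forall k, s k -> bf (psi k) v w = 0) ->
  (forall z, uhp z -> bf z v w = 0 -> closed_triangle a b z /\ s (theta z)) ->
  exists2 e, packing_edge G t e & homeomorphism_on s e phi.
Proof.
move=> evw hs hpsi htheta; exists (proj G @` edge_line v w).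
  by apply/(packing_edgeP hV cuspV tV); exists v, w.
apply: (@homeomorphism_proj _ _ _ _ psi theta).
- by move=> z [].
- move=> k sk; have [hk nv] := side_sub hs sk.
  have [z0 _ _ _ _] := triangle_point_bf dab hk nv.
  split; [exact: triangle_map_proj| |exact: triangle_coordK].
  by split=> //; exact: hpsi.
- move=> z [z0 bz]; have [cz sz] := htheta _ z0 bz; have [_ _ pK] := triangle_pointK dab cz.
  by split=> //; exact: triangle_coord_cvg.
- move=> z z' [z0 bz] [z0' bz'] e; apply: proj_inj_of_trivial e _ => // g Gg gz.
  exact: (edge_line_inj hV VG tfG evw z0 Gg bz gz bz').
- move=> z [z0 bz]; have := edge_line_isolated hV VG evw z0 bz.
  apply: filterS => y hy z2 [z20 bz2] y0 /(projP G z20 y0)[g Gg gz].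
  by split=> //; exact: (hy g z2).
- by apply: cont_on_sub triangle_map_continuous => k /(side_sub hs)[].
Qed.

Lemma ratio_lt1 (x y : R) : x < 0 -> y < 0 -> 0 < x / (x + y) < 1.
Proof.
move=> x0 y0; have s0 : x + y < 0 by lra.
have -> : x / (x + y) = (- x) / (- x - y) by rewrite -opprD invrN mulrNN.
apply/andP; split; first by apply: divr_gt0; lra.
by rewrite ltr_pdivrMr; lra.
Qed.

Lemma triangle_sides s : std_triangle_sides s ->
  exists2 e, packing_edge G t e & homeomorphism_on s e phi.
Proof.
move=> hs; have [eab ebc eca] := triangle_edges Va Vb Vc dab; have [V0 _ _] := hV.
have Q z : uhp z -> [/\ 0 < qf z a, 0 < qf z b & 0 < qf z c] by move=> z0; split; apply: qf_gt0 => //; apply: V0.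
have E k := (fun sk : s k => let: conj hk nv := side_sub hs sk in triangle_point_bf dab hk nv).
(* A vanishing barycentric coordinate is a vanishing polar value: the sides z.2 = 0, z.1 = 0 and the
   hypotenuse go to the edges c a, b c and a b. *)
case: (hs) => [[|]|] sE.
- apply: (triangle_side_homeomorphism eca hs) => [k sk|z z0 bz].
    have [_ _ _ _ ->] := E k sk; move: sk; rewrite sE => -[_ ->].
    by rewrite oppr0 mul0r.
  have [q1 q2 q3] := Q _ z0; have [qa qb qc] := qf_triangle z dab.
  rewrite bz subr0 in qa; rewrite bz subr0 in qc.
  rewrite qa oppr_gt0 in q1; rewrite qc oppr_gt0 in q3.
  split; first by split; rewrite ?bz // ltW.
  by rewrite sE /triangle_coord /= bz mul0r addr0; split=> //; exact: ratio_lt1.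
- apply: (triangle_side_homeomorphism ebc hs) => [k sk|z z0 bz].
    have [_ _ _ -> _] := E k sk; move: sk; rewrite sE => -[-> _].
    by rewrite oppr0 mul0r.
  have [q1 q2 q3] := Q _ z0; have [qa qb qc] := qf_triangle z dab.
  rewrite bz subr0 in qb; rewrite bz oppr0 sub0r in qc.
  rewrite qb oppr_gt0 in q2; rewrite qc oppr_gt0 in q3.
  split; first by split; rewrite ?bz // ltW.
  by rewrite sE /triangle_coord /= bz mul0r add0r; split=> //; exact: ratio_lt1.
- apply: (triangle_side_homeomorphism eab hs) => [k sk|z z0 bz].
    have [_ _ -> _ _] := E k sk; move: sk; rewrite sE => -[_ ->].
    by rewrite subrKC subrr oppr0 mul0r.
  have [q1 q2 q3] := Q _ z0; have [qa qb qc] := qf_triangle z dab.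
  rewrite bz oppr0 sub0r in qa; rewrite bz oppr0 sub0r in qb.
  rewrite qa oppr_gt0 in q1; rewrite qb oppr_gt0 in q2.
  split; first by split; rewrite ?bz // ltW.
  rewrite sE /triangle_coord /= bz addr0; split; first exact: ratio_lt1.
  by field; rewrite lt_eqF //; lra.
Qed.

Lemma triangle_vertices_cusps : phi @` std_triangle_vertices `<=` cusp_points G.
Proof.
move=> _ [k [[->|->]|->] <-]; rewrite /triangle_map ?neq10 ?neq00 ?neq01 ?eqxx.
- by exists xc => //; exists (slope c).
- by exists xa => //; exists (slope a).
- by exists xb => //; exists (slope b).
Qed.

End Triangle.

Hypothesis triangle_cover : forall z, uhp z -> edge_free V z ->
  exists a b, [/\ V a, V b, V (- (a + b)), vdet a b = 1 & ideal_triangle a b z].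

(** Every other region is also the image of an open triangle, and two triangles with overlapping
    translates have the same image. So the image is relatively open and closed in the complement of
    the graph. *)
Lemma triangle_component a b z : V a -> V b -> V (- (a + b)) -> vdet a b = 1 ->
  ideal_triangle a b z ->
  connected_component (~` packing_graph G t) (proj G z) = proj G @` ideal_triangle a b.
Proof.
move=> Va Vb Vc dab Tz; have [z0 _ _ _] := Tz.
have pgP y : uhp y -> packing_graph G t (proj G y) <-> ~ edge_free V y.
  exact: proj_edge_free.
have ef : edge_free V z := triangle_edge_free hV Va Vb Vc dab Tz.
have Tf := triangle_face hV Va Vb Vc dab Tz.
apply/seteqP; split; last first.
  by move=> _ [y Ty <-]; apply: (proj_face hV VG cuspV tV z0 ef); rewrite -Tf.
have oT a' b' : open (proj G @` ideal_triangle a' b').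
  by apply: open_proj_image; [exact: open_triangle|move=> y []].
have np : ~ packing_graph G t (proj G z) by rewrite pgP.
apply: (connected_ind (P := proj G @` ideal_triangle a b) (@component_connected _ _ _)
  (@connected_component_refl _ (~` packing_graph G t) _ np)).
- by exists z.
- by move=> y _ Py; apply: filterS (open_nbhs_nbhs (conj (oT a b) Py)).
- move=> y /connected_component_sub ny nPy.
  have [[z' z0' yE]|cy] := filled_surfaceP y; last by case: ny; left.
  rewrite yE in ny nPy *; have ef' : edge_free V z' by apply: contrapT; rewrite -pgP.
  have [a' [b' [Va' Vb' Vc' dab' Tz']]] := triangle_cover z0' ef'.
  have Py' : (proj G @` ideal_triangle a' b') (proj G z') by exists z'.
  apply: filterS (open_nbhs_nbhs (conj (oT a' b') Py')) => _ [z2 Tz2 <-] _ [z1 Tz1 e].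
  have [z10 _ _ _] := Tz1; have [z20 _ _ _] := Tz2.
  have [g Gg gz] := (projP G z20 z10).1 (esym e); have dg := psl2_det Gg.
  apply: nPy; exists (moebius g z'); last exact: proj_act.
  rewrite (triangle_face hV Va Vb Vc dab Tz1).
  have [_ h] : face V z2 z' by rewrite -(triangle_face hV Va' Vb' Vc' dab' Tz2).
  split; first exact: moebius_uhp.
  move=> u u' [Vu Vu' d]; have dVg := det1V dg.
  have e' : edge V (vact g^-1 u) (vact g^-1 u').
    by split; rewrite ?vdet_act //; apply: VG => //; exact: psl2_inv.
  have := h _ _ e'; rewrite -(bf_act (g := g) (z := z2)) // -(bf_act (g := g) (z := z')) //.
  by rewrite !vactVK // gz.
Qed.

Lemma farey_packable : packable G t.
Proof.
move=> x nx; have [[z z0 xE]|cx] := filled_surfaceP x; last by case: nx; left.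
rewrite xE in nx *; have ef : edge_free V z.
  by apply: contrapT; rewrite -(proj_edge_free hV VG cuspV tV z0).
have [a [b [Va Vb Vc dab Tz]]] := triangle_cover z0 ef.
have ex v : V v -> exists y : cusped_plane G, val y = inr (slope v).
  move=> Vv; have cv : cusp G (slope v) by apply/cuspV; exists v.
  by exists (exist _ (inr (slope v)) (asboolT cv)).
have [[xa xaE] [xb xbE] [xc xcE]] := And3 (ex _ Va) (ex _ Vb) (ex _ Vc).
rewrite (triangle_component Va Vb Vc dab Tz).
exists (triangle_map a b xa xb xc); split.
- by apply/cont_onP; exact: triangle_map_continuous.
- exact: triangle_interior_homeomorphism.
- exact: triangle_sides.
- exact: triangle_vertices_cusps.
Qed.

End FareyTriangulation.

(** After reduction to the modular triangle, the superbase is e1, (-1, 1), (0, -1) left of the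
    imaginary axis and e1, e2, (-1, -1) right of it; the axis itself is the line of the edge e1
    e2. *)
Lemma lattice_triangle_cover (R : realType) (M : 'M[R]_2) (z : R * R) : \det M = 1 ->
  uhp z -> edge_free (lattice_vectors M) z ->
  exists a b, [/\ lattice_vectors M a, lattice_vectors M b, lattice_vectors M (- (a + b)),
    vdet a b = 1 & ideal_triangle a b z].
Proof.
move=> dM z0 ef; have dMV := det1V dM.
have [g hg [y0 /andP[y1 y2] y3]] := modular_reduction (moebius_uhp dMV z0).
have dg := psl2Z_det hg; set y := moebius g _ in y0 y1 y2 y3.
pose K := M * g^-1; have dK : \det K = 1 by apply: det1M => //; exact: det1V.
have zE : z = moebius K y.
  by rewrite /K /y moebiusM ?det1V ?moebiusK ?moebiusVK //; apply: moebius_uhp.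
have VK u : primitive u -> lattice_vectors M (vact K u).
  move=> pu; rewrite /lattice_vectors /= /K vactM vactK //.
  by apply: primitive_act => //; exact: psl2Z_inv.
clearbody K; clearbody y.
have key (u w : R * R) : primitive u -> primitive w -> primitive (- (u + w)) -> vdet u w = 1 ->
    bf y u w < 0 -> bf y w (- (u + w)) < 0 -> bf y (- (u + w)) u < 0 ->
  exists a b, [/\ lattice_vectors M a, lattice_vectors M b, lattice_vectors M (- (a + b)),
    vdet a b = 1 & ideal_triangle a b z].
  move=> pu pw pc d h1 h2 h3; exists (vact K u), (vact K w).
  by rewrite -vactD -vact_opp vdet_act //; split; [exact: VK..|exact: d|rewrite zE;
    split; rewrite -?vactD -?vact_opp ?bf_act //; exact: moebius_uhp].
have [_ pN _] := @unimodular_primitive R.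
have pe : primitive (1, 0) := @primitive_e1 R.
have pn (x : R) : x \is a Num.int -> primitive (x, 1) by exact: primitive_int1.
have p0 := pn 0 (rpred0 _); have p1 := pn 1 (rpred1 _).
have pm : primitive (-1 : R, 1) by apply: pn; rewrite rpredN rpred1.
case: y y0 y1 y2 y3 zE key => x y; rewrite /uhp /= => y0 y1 y2 y3 zE key.
have neg (A : R) : A < 0 -> A / y < 0 by move=> h; rewrite pmulr_llt0 ?invr_gt0.
have [x0|x0|x0] := ltgtP x 0.
- apply: (key (1, 0) (-1, 1)) => //.
  + have -> : - ((1, 0) + (-1, 1)) = - (0, 1) :> R * R by congr (- (_, _)) => /=; ring.
    exact: pN.
  + by rewrite /vdet /=; ring.
  + by rewrite /bf /=; apply: neg; lra.
  + by rewrite /bf /=; apply: neg; nra.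
  + by rewrite /bf /=; apply: neg; nra.
- apply: (key (1, 0) (0, 1)) => //.
  + have -> : (1, 0) + (0, 1) = (1, 1) :> R * R by congr (_, _) => /=; ring.
    exact: pN.
  + by rewrite /vdet /=; ring.
  + by rewrite /bf /=; apply: neg; lra.
  + by rewrite /bf /=; apply: neg; nra.
  + by rewrite /bf /=; apply: neg; nra.
- case: (ef (vact K (1, 0)) (vact K (0, 1))).
    split; [exact: VK|exact: VK|rewrite vdet_act // /vdet /=].
    by rewrite mul1r mulr0 subr0 normr1.
  by rewrite zE bf_act // /bf /= x0 !(mulr0, mul0r, subrr, addr0).
Qed.

Theorem theorem2 (R : realType) (G : psl2_subgroup R)
    (hG : hyperbolic_surface_with_cusps G) :
  (exists t : option R -> R,
     [/\ horocycle_packing G t, congruent_horocycles G t, packable G t &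
         has_packing_density G t (3 / pi)]) <->
  (exists2 g : 'M[R]_2, \det g = 1 &
     forall h, G h -> psl2Z (g * h * g^-1)).
Proof.
have [tfG _ cofG _] := hG; split.
  move=> [t [ht _ hpack _]].
  apply: (packable_conj_integral (packing_vectors_unimodular ht)
    (packing_vectors_act ht) (packing_vectors_cusp ht) _ tfG hpack).
  by move=> v [].
move=> [g dg hg]; have ug := unit_det1 dg.
(* M is [g^-1]: the packing vectors are the images of the primitive ones under it. *)
have dM := det1V dg.
have hGM h : G h -> psl2Z (g^-1^-1 * h * g^-1) by rewrite invrK; exact: hg.
exists (lattice_height g^-1); split.
- exact: (lattice_horocycle_packing dM hGM cofG).
- exact: (lattice_congruent dM hGM cofG).
- apply: (farey_packable (lattice_vectors_unimodular dM) _ _ _ tfG).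
  + by move=> h v; exact: lattice_vectors_act.
  + exact: (lattice_cuspP dM hGM cofG).
  + by move=> v; exact: (lattice_heightE dM).
  + by move=> z; exact: lattice_triangle_cover.
- exact: (lattice_density dM hGM cofG).
Qed.
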